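(* Let $p$ be an odd prime and let $\ell\neq p$ be a prime. For every non-negative integer $n$, the work of Sekiguchi and Suwa (their unification of Kummer and Artin--Schreier--Witt theories, recalled in the context) provides an isomorphism between the abelian group of rank-one ($\ell$-adic) local systems on $\mathbb{G}_{m,\overline{\mathbb{Q}}_p}$ whose order divides $(p-1)p^n$ and the abelian group of (continuous, $\overline{\mathbb{Q}}_\ell^\times$-valued) characters of $\mathbb{Z}_p^\times$ of depth less than or equal to $n$.
   Context: **Groups and depth.** Rank-one local systems form a group under tensor product, and the order of a local system is its order in this group. For every continuous character $\chi:\mathbb{Z}_p^\times\to\overline{\mathbb{Q}}_\ell^\times$ there is an integer $n\ge 0$ such that $\chi$ is trivial on $1+p^{n+1}\mathbb{Z}_p$; the smallest such $n$ is the depth of $\chi$. **The work of Sekiguchi and Suwa.** Fix $n\ge 0$ and a primitive $p^n$-th root of unity $\zeta\in\overline{\mathbb{Q}}_p$, and set $R=\mathbb{Z}_p[\zeta]$, $K=\mathbb{Q}_p(\zeta)$. Let $\mathbb{W}_n$ denote the Witt vectors of length $n$. The theorem of Sekiguchi and Suwa provides an exact sequence of commutative group schemes over $R$ $$0\to\mathbb{Z}/(p-1)\mathbb{Z}\times\mathbb{Z}/p^n\mathbb{Z}\to\mathcal{Y}\xrightarrow{f}\mathcal{X}\to 0,$$ isomorphisms $\mathcal{Y}_K\cong\mathbb{G}_{m,K}^{n+1}$ and $\mathcal{X}_K\cong\mathbb{G}_{m,K}^{n+1}$ on generic fibres under which $f_K$ becomes $$\gamma(x_0,\dots,x_n)=\Big(x_0^{p-1},\,x_1^p,\,\tfrac{x_2^p}{x_1},\dots,\tfrac{x_n^p}{x_{n-1}}\Big),$$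 and isomorphisms $\mathcal{Y}_{\mathbb{F}_p}\cong\mathbb{G}_{m,\mathbb{F}_p}\times\mathbb{W}_{n,\mathbb{F}_p}$ and $\mathcal{X}_{\mathbb{F}_p}\cong\mathbb{G}_{m,\mathbb{F}_p}\times\mathbb{W}_{n,\mathbb{F}_p}$ on special fibres under which $f_{\mathbb{F}_p}$ becomes the Lang isogeny $\mathrm{Lang}$ (that is, $x\mapsto \mathrm{Fr}(x)-x$ in additive notation). Moreover $\alpha\circ\gamma=\theta\circ m$, where $\theta(x)=x^{(p-1)p^n}$ on $\mathbb{G}_{m,K}$, $m:\mathbb{G}_{m,K}^{n+1}\to\mathbb{G}_{m,K}$ is the multiplication map, and $$\alpha(x_0,\dots,x_n)=\frac{(x_0x_1\cdots x_n)^{p^n}}{x_1x_2^{p}x_3^{p^2}\cdots x_n^{p^{n-1}}}.$$ **How the isomorphism arises (the $p$-adic trace).** Let $\mathsf{K}(\mathbb{G}_{m,K})$ be the group, under tensor product, of irreducible summands of $\theta_!\overline{\mathbb{Q}}_\ell$, and let $\mathsf{C}(\mathbb{G}_{m,\mathbb{F}_p}\times\mathbb{W}_{n,\mathbb{F}_p})$ be the group of irreducible summands of $\mathrm{Lang}_!\overline{\mathbb{Q}}_\ell$. The maps $\theta,\gamma,f_K,f,f_{\mathbb{F}_p}$ are Galois covers of order $(p-1)p^n$, and the squares relating them, namely the one given by $m,\alpha$ and those given by the generic-fibre and special-fibre restrictions, are Cartesian; they determine a canonical isomorphism $S:\mathsf{K}(\mathbb{G}_{m,K})\to\mathsf{C}(\mathbb{G}_{m,\mathbb{F}_p}\times\mathbb{W}_{n,\mathbb{F}_p})$.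 The $p$-adic trace is $\mathcal{K}\mapsto t_{\mathrm{Fr}}(S(\mathcal{K}))\in\operatorname{Hom}(\mathbb{G}_m(\mathbb{F}_p)\times\mathbb{W}_n(\mathbb{F}_p),\overline{\mathbb{Q}}_\ell^\times)$, where $t_{\mathrm{Fr}}$ is trace of Frobenius. Since $p$ is odd, the exponential map gives an isomorphism $\mathbb{G}_m(\mathbb{F}_p)\times\mathbb{W}_n(\mathbb{F}_p)=\mathbb{Z}/(p-1)\times\mathbb{Z}/p^n\cong\mathbb{Z}_p^\times/(1+p^{n+1}\mathbb{Z}_p)$, through which the $p$-adic trace is regarded as a continuous character of $\mathbb{Z}_p^\times$. Local systems on $\mathbb{G}_{m,\overline{\mathbb{Q}}_p}$ of order dividing $(p-1)p^n$ can be defined on $\mathbb{G}_{m,K}$. *)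

(* Defs.v *)
From HB Require Import structures.
From mathcomp Require Import all_boot all_order all_algebra.
From mathcomp Require Import mpoly.

Set Implicit Arguments.
Unset Strict Implicit.
Unset Printing Implicit Defensive.

Import Order.TTheory GRing.Theory Num.Theory.
Local Open Scope ring_scope.

(* Every scheme below is affine and is handled through its coordinate ring. A
   scheme over Spec S is an S-algebra, given by its structure map; morphisms of
   schemes are S-algebra homomorphisms in the opposite direction; the T-points
   of Spec O are the elements of [hom O T]. *)

Record alg (S : comNzRingType) := Alg {
  acar :> comNzRingType;
  astr : {rmorphism S -> acar} }.

Record hom (S : comNzRingType) (A B : alg S) := Hom {
  hmap :> {rmorphism A -> B};
  hmapE : forall s, hmap (astr A s) = astr B s }.

Definition triv (S : comNzRingType) : alg S := Alg (idfun : {rmorphism S -> S}).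

Definition hcomp (S : comNzRingType) (A B C : alg S)
    (g : hom B C) (f : hom A B) : hom A C.
Proof.
by exists (hmap g \o hmap f : {rmorphism A -> C}) => s /=; rewrite !hmapE.
Defined.

Definition resAlg (S S' : comNzRingType) (j : {rmorphism S -> S'})
    (A : alg S') : alg S :=
  Alg (astr A \o j : {rmorphism S -> A}).

Definition resHom (S S' : comNzRingType) (j : {rmorphism S -> S'})
    (A B : alg S') (f : hom A B) : hom (resAlg j A) (resAlg j B).
Proof.
by refine (@Hom S (resAlg j A) (resAlg j B) (hmap f) _) => s /=; rewrite hmapE.
Defined.

Definition linear_form (A : comNzRingType) (B : alg A) (g : B -> A) : Prop :=
  (forall x y, g (x + y) = g x + g y) /\
  (forall a x, g (astr B a * x) = a * g x).

(* B is finite etale over A: it is a finitely generated projective A-module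
   (b, f is a dual basis) and its trace form is perfect, where the trace of x is
   the trace of multiplication by x, namely sum_i f_i(x b_i). *)
Definition fet (A : comNzRingType) (B : alg A) : Prop :=
  exists (k : nat) (b : 'I_k -> B) (f : 'I_k -> B -> A),
    [/\ forall i, linear_form (f i),
        forall x, x = \sum_(i < k) astr B (f i x) * b i &
        forall g : B -> A, linear_form g ->
          exists! y : B, forall x, g x = \sum_(i < k) f i (x * y * b i)].

Record geomPt (A : comNzRingType) := GeomPt {
  gfield : closedFieldType;
  gmap : {rmorphism A -> gfield} }.

Definition geomAlg (A : comNzRingType) (w : geomPt A) : alg A := Alg (gmap w).
Coercion geomAlg : geomPt >-> alg.

(* The image of a geometric point of Spec A' under Spec A' -> Spec A. *)
Definition geomIm (A A' : comNzRingType) (phi : {rmorphism A -> A'})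
    (w : geomPt A') : geomPt A :=
  GeomPt (gmap w \o phi : {rmorphism A -> gfield w}).

(* The fibre functor at w sends B to the set [hom B w] of geometric points of B
   above w. A path is an isomorphism of fibre functors; the etale fundamental
   group pi_1(Spec A, w) is [path w w]. *)
Record path (A : comNzRingType) (w1 w2 : geomPt A) := Path {
  pfun :> forall B : alg A, fet B -> hom B w1 -> hom B w2;
  pfun_nat : forall (B C : alg A) (HB : fet B) (HC : fet C) (g : hom B C)
    (h : hom C w1), pfun HB (hcomp h g) = hcomp (pfun HC h) g;
  pfun_bij : forall (B : alg A) (HB : fet B), bijective (pfun HB) }.

(* v is a valuation; the value v 0 is meaningless, whence the first disjunct. *)
Definition near (F : fieldType) (v : F -> rat) (M : rat) (x y : F) : Prop :=
  x = y \/ M <= v (x - y).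

Definition limit (F : fieldType) (v : F -> rat) (u : nat -> F) (x : F) : Prop :=
  forall M : rat, exists m : nat, forall k, (m <= k)%N -> near v M (u k) x.

Definition isQp (F : fieldType) (v : F -> rat) (x : F) : Prop :=
  exists u : nat -> rat, limit v (fun k => ratr (u k)) x.

(* An algebraic closure of Q_p with its p-adic valuation, normalised by
   v(p) = 1. Q_p is the closure of the prime field Q: the valuation induced on Q
   is the p-adic one, Cauchy sequences of rational numbers converge, and
   everything is algebraic over the limits of such sequences. *)
Record padicClosure (p : nat) := PadicClosure {
  pcf :> closedFieldType;
  pval : pcf -> rat;
  pc_char0 : [pchar pcf] =i pred0;
  pvalM : forall x y, x != 0 -> y != 0 -> pval (x * y) = pval x + pval y;
  pvalD : forall x y, x != 0 -> y != 0 -> x + y != 0 ->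
    Num.min (pval x) (pval y) <= pval (x + y);
  pvalp : pval p%:R = 1;
  pc_complete : forall u : nat -> rat,
    (forall M : rat, exists m : nat, forall i k, (m <= i)%N -> (m <= k)%N ->
       near pval M (ratr (u i)) (ratr (u k))) ->
    exists x, limit pval (fun k => ratr (u k)) x;
  pc_alg : forall x, exists P : {poly pcf},
    [/\ P != 0, forall i, isQp pval P`_i & root P x] }.

Definition isZp (p : nat) (Q : padicClosure p) (x : Q) : Prop :=
  isQp (@pval p Q) x /\ near (@pval p Q) 0 x 0.

Record Zpunit (p : nat) (Q : padicClosure p) := ZpUnit {
  uval :> Q;
  uvalP : [/\ isZp uval, uval != 0 & pval uval = 0] }.

Record finClosure (p : nat) := FinClosure {
  fcf :> closedFieldType;
  fcin : {rmorphism 'F_p -> fcf};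
  fc_alg : forall x : fcf, exists2 P : {poly 'F_p},
    P != 0 & root (map_poly fcin P) x }.

Definition fcPt (p : nat) (k : finClosure p) : geomPt ('F_p : comNzRingType) :=
  GeomPt (fcin k).

(* R = Z_p[z] and K = Q_p(z) = Q_p[z] inside the algebraic closure of Q_p, for z
   algebraic over Q_p, with the inclusion of R in K and the residue map of R. *)
Record cyclotomic (p : nat) (Q : padicClosure p) (z : Q) := Cyclotomic {
  cR : comNzRingType;
  cK : fieldType;
  cRin : {rmorphism cR -> Q};
  cKin : {rmorphism cK -> Q};
  cRK : {rmorphism cR -> cK};
  cRF : {rmorphism cR -> 'F_p};
  cRin_inj : injective cRin;
  cRin_im : forall x : Q, (exists r, cRin r = x) <->
    (exists2 P : {poly Q}, (forall i, isZp P`_i) & x = P.[z]);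
  cKin_im : forall x : Q, (exists r, cKin r = x) <->
    (exists2 P : {poly Q}, (forall i, isQp (@pval p Q) P`_i) & x = P.[z]);
  cRKE : forall r, cKin (cRK r) = cRin r }.

(* A rank-one local system on the connected scheme Spec A, up to isomorphism: a
   continuous character of pi_1(Spec A, w). The product is written through its
   values on fibres so as not to depend on a choice of proofs inside paths. The
   open subgroups of pi_1 are those containing the elements that act trivially
   on the fibres of finitely many finite etale algebras. *)
Record locsys (l : nat) (Q : padicClosure l) (A : comNzRingType)
    (w : geomPt A) := Locsys {
  lchar :> path w w -> Q;
  lchar_neq0 : forall s, lchar s != 0;
  lcharM : forall s t r : path w w,
    (forall (B : alg A) (HB : fet B) h, r B HB h = s B HB (t B HB h)) ->
    lchar r = lchar s * lchar t;
  lchar_cont : forall M : rat, exists (k : nat) (B : 'I_k -> alg A)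
    (HB : forall i, fet (B i)), forall s : path w w,
      (forall i h, s (B i) (HB i) h = h) -> near (@pval l Q) M (lchar s) 1 }.

Definition isTensor (l : nat) (Q : padicClosure l) (A : comNzRingType)
    (w : geomPt A) (L1 L2 L3 : locsys Q w) : Prop :=
  forall s, L3 s = L1 s * L2 s.

Definition hasOrder (l : nat) (Q : padicClosure l) (A : comNzRingType)
    (w : geomPt A) (L : locsys Q w) (d : nat) : Prop :=
  [/\ (0 < d)%N, forall s, L s ^+ d = 1 &
      forall e, (0 < e)%N -> (forall s, L s ^+ e = 1) -> (d <= e)%N].

Definition orderDvd (l : nat) (Q : padicClosure l) (A : comNzRingType)
    (w : geomPt A) (N : nat) (L : locsys Q w) : Prop :=
  exists2 d, hasOrder L d & (d %| N)%N.

(* L' is isomorphic to the pull-back of L along Spec A' -> Spec A. The path tau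
   from the image of w' to w identifies pi_1(A, image of w') with pi_1(A, w), and
   s is the image of s' in the latter group: it is determined by its action on
   points of the form h' o g, since every point of B above the image of w' is of
   this form for B' the base change of B to A'. *)
Definition isPullback (l : nat) (Q : padicClosure l) (A A' : comNzRingType)
    (w : geomPt A) (w' : geomPt A') (phi : {rmorphism A -> A'})
    (L : locsys Q w) (L' : locsys Q w') : Prop :=
  exists tau : path (geomIm phi w') w,
    forall s' : path w' w', exists s : path w w,
      (forall (B : alg A) (HB : fet B) (B' : alg A') (HB' : fet B')
              (g : hom B (resAlg phi B')) (h' : hom B' w'),
         s B HB (tau B HB (hcomp (resHom phi h') g))
         = tau B HB (hcomp (resHom phi (s' B' HB' h')) g)) /\
      L' s' = L s.

(* L is a summand of pi_! of the constant sheaf, for the finite etale cover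
   pi : Spec B -> Spec A. The fibre of pi_! at w is the space of functions
   v on [hom B w], on which s acts by v |-> v o s^-1; L is a summand if it
   occurs in this representation, which has finite image and hence is
   semisimple. The covers to which this is applied are abelian, so that all their
   irreducible summands have rank one. *)
Definition isSummand (l : nat) (Q : padicClosure l) (A : comNzRingType)
    (w : geomPt A) (B : alg A) (L : locsys Q w) : Prop :=
  exists (HB : fet B) (v : hom B w -> Q),
    (exists h, v h != 0) /\
    forall (s : path w w) h, v h = L s * v (s B HB h).

(* c is the trace on L of the geometric Frobenius at the F_p-point x: the
   automorphism h |-> Fr^-1 o h of the fibres above x, moved to w along tau. *)
Definition frobTrace (p l : nat) (Q : padicClosure l) (k : finClosure p)
    (A : comNzRingType) (w : geomPt A) (L : locsys Q w)
    (x : {rmorphism A -> 'F_p}) (c : Q) : Prop :=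
  exists (tau : path (geomIm x (fcPt k)) w) (s : path w w),
    (forall (B : alg A) (HB : fet B) (h h' : hom B (geomIm x (fcPt k))),
       (forall b, hmap h b = hmap h' b ^+ p) ->
       s B HB (tau B HB h) = tau B HB h') /\
    c = L s.

Record grpScheme (S : comNzRingType) := GrpScheme {
  gring : alg S;
  gmul : forall T : alg S, hom gring T -> hom gring T -> hom gring T;
  gone : forall T : alg S, hom gring T;
  gmul_nat : forall (T T' : alg S) (g : hom T T') x y,
    hcomp g (gmul x y) = gmul (hcomp g x) (hcomp g y);
  gone_nat : forall (T T' : alg S) (g : hom T T'), hcomp g (gone T) = gone T';
  gmulA : forall T, associative (@gmul T);
  gmulC : forall T, commutative (@gmul T);
  gmul1 : forall T, left_id (gone T) (@gmul T);
  gmulV : forall T (x : hom gring T), exists y, gmul x y = gone T }.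

(* A group scheme with explicit coordinates: its T-points are the points of T^d
   satisfying xdom, and xop x y z means that z is the product of x and y. *)
Record xgroup (d : nat) := XGroup {
  xdom : forall T : comNzRingType, {ffun 'I_d -> T} -> Prop;
  xop : forall T : comNzRingType,
    {ffun 'I_d -> T} -> {ffun 'I_d -> T} -> {ffun 'I_d -> T} -> Prop }.

Definition isUnit (T : comNzRingType) (a : T) : Prop := exists b, a * b = 1.

Definition torus (d : nat) : xgroup d := {|
  xdom := fun T x => forall i, isUnit (x i);
  xop := fun T x y z => forall i, z i = x i * y i |}.

Definition ghost (p : nat) (T : comNzRingType) (n : nat) (x : {ffun 'I_n -> T})
    (k : 'I_n) : T :=
  \sum_(i < n | (i <= k)%N) x i ^+ (p ^ (k - i)) *+ (p ^ i).

(* P consists of the n Witt addition polynomials: the (unique, integral)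
   polynomials in x_0, .., x_{n-1}, y_0, .., y_{n-1} such that each ghost
   component of P is the sum of those of x and y. *)
Definition wittPolys (p n : nat) (P : {ffun 'I_n -> {mpoly int[n + n]}}) : Prop :=
  forall k, ghost p P k =
    ghost p [ffun i => 'X_(lshift n i)] k + ghost p [ffun i => 'X_(rshift n i)] k.

Definition wittAdd (p n : nat) (T : comNzRingType)
    (x y z : {ffun 'I_n -> T}) : Prop :=
  exists2 P : {ffun 'I_n -> {mpoly int[n + n]}}, wittPolys p P &
    forall k, z k = mmap intr (fun i => match split i with
                                        | inl a => x a | inr b => y b end) (P k).

Definition ftail (n : nat) (T : Type) (x : {ffun 'I_n.+1 -> T}) :
  {ffun 'I_n -> T} := [ffun i => x (lift ord0 i)].

(* G_m x W_n, with the coordinate of G_m first *)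
Definition gmWitt (p n : nat) : xgroup n.+1 := {|
  xdom := fun T x => isUnit (x ord0);
  xop := fun T x y z =>
    z ord0 = x ord0 * y ord0 /\ wittAdd p (ftail x) (ftail y) (ftail z) |}.

(* The coordinate ring of G over S, i.e. an S-algebra representing the functor
   of points of G; xuniv is the universal point. *)
Record coordRing (S : comNzRingType) (d : nat) (G : xgroup d) := CoordRing {
  xring :> alg S;
  xuniv : {ffun 'I_d -> xring};
  xuniv_dom : xdom G xuniv;
  xuniv_ex : forall (T : alg S) (x : {ffun 'I_d -> T}), xdom G x ->
    exists h : hom xring T, forall i, h (xuniv i) = x i;
  xuniv_uniq : forall (T : alg S) (h h' : hom xring T),
    (forall i, h (xuniv i) = h' (xuniv i)) -> h = h' }.

(* An isomorphism of S'-group schemes from the base change of X along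
   j : S -> S' to G, on points with values in S'-algebras. *)
Record fibreIso (S S' : comNzRingType) (j : {rmorphism S -> S'})
    (X : grpScheme S) (d : nat) (G : xgroup d) := FibreIso {
  fiso :> forall T : alg S', hom (gring X) (resAlg j T) -> {ffun 'I_d -> T};
  fiso_nat : forall (T T' : alg S') (g : hom T T')
    (x : hom (gring X) (resAlg j T)) i,
    fiso (T := T') (hcomp (resHom j g) x) i = g (fiso x i);
  fiso_inj : forall T : alg S', injective (@fiso T);
  fiso_im : forall (T : alg S') (t : {ffun 'I_d -> T}),
    xdom G t <-> exists x, fiso x = t;
  fisoM : forall (T : alg S') (x y : hom (gring X) (resAlg j T)),
    xop G (fiso x) (fiso y) (fiso (gmul x y)) }.

(* z = gamma(x) = (x_0^(p-1), x_1^p, x_2^p / x_1, .., x_n^p / x_(n-1)) *)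
Definition isGamma (p n : nat) (T : comNzRingType)
    (x z : {ffun 'I_n.+1 -> T}) : Prop :=
  forall i : 'I_n.+1,
    match val i with
    | 0 => z i = x i ^+ p.-1
    | 1 => z i = x i ^+ p
    | k.+2 => z i * x (inord k.+1) = x i ^+ p
    end.

(* a = alpha(x) = (x_0 .. x_n)^(p^n) / (x_1 x_2^p .. x_n^(p^(n-1))) *)
Definition isAlpha (p n : nat) (T : comNzRingType)
    (x : {ffun 'I_n.+1 -> T}) (a : T) : Prop :=
  a * (\prod_(i < n.+1 | (0 < i)%N) x i ^+ (p ^ i.-1))
  = (\prod_(i < n.+1) x i) ^+ (p ^ n).

(* z = Fr(x) - x in additive notation, i.e. z + x = Fr(x) *)
Definition isLang (p d : nat) (G : xgroup d) (T : comNzRingType)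
    (x z : {ffun 'I_d -> T}) : Prop :=
  xop G z x [ffun i => x i ^+ p].

(* A T-point of the constant scheme with finite set of values C: a decomposition
   of 1 into orthogonal idempotents indexed by C. *)
Definition constPt (C : finType) (T : comNzRingType) (e : {ffun C -> T}) : Prop :=
  \sum_c e c = 1 /\ forall c c', e c * e c' = if c == c' then e c else 0.

(* The unification of Kummer and Artin-Schreier-Witt theories over R. The
   constant group Z/(p-1) x Z/p^n is 'I_(p-1) x 'I_(p^n) with addition modulo
   p-1 and p^n. Exactness: ssf is a finite etale surjective homomorphism, and
   ssi identifies, on T-points, the constant group with the kernel of ssf. *)
Record sekiguchiSuwa (p n : nat) (R K : comNzRingType)
    (j : {rmorphism R -> K}) (r : {rmorphism R -> 'F_p}) := SekiguchiSuwa {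
  ssY : grpScheme R;
  ssX : grpScheme R;
  ssf : hom (gring ssX) (gring ssY);
  ssf_morph : forall (T : alg R) (y y' : hom (gring ssY) T),
    hcomp (gmul y y') ssf = gmul (hcomp y ssf) (hcomp y' ssf);
  ssf_fet : fet (Alg (hmap ssf));
  ssf_inj : injective (hmap ssf);
  ssi : 'I_p.-1 * 'I_(p ^ n) -> hom (gring ssY) (triv R);
  ssi_morph : forall a b c : 'I_p.-1 * 'I_(p ^ n),
    c.1 = a.1 + b.1 %[mod p.-1] -> c.2 = a.2 + b.2 %[mod p ^ n] ->
    ssi c = gmul (ssi a) (ssi b);
  ssi_exact : forall (T : alg R) (y : hom (gring ssY) T),
    hcomp y ssf = gone ssX T <->
    exists! e : {ffun 'I_p.-1 * 'I_(p ^ n) -> T},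
      constPt e /\ forall b, y b = \sum_c e c * astr T (ssi c b);
  ssYK : fibreIso j ssY (torus n.+1);
  ssXK : fibreIso j ssX (torus n.+1);
  ssfK : forall (T : alg K) (y : hom (gring ssY) (resAlg j T)),
    isGamma p (ssYK T y) (ssXK T (hcomp y ssf));
  ssYF : fibreIso r ssY (gmWitt p n);
  ssXF : fibreIso r ssX (gmWitt p n);
  ssfF : forall (T : alg ('F_p : comNzRingType))
    (y : hom (gring ssY) (resAlg r T)),
    isLang p (gmWitt p n) (ssYF T y) (ssXF T (hcomp y ssf)) }.

Record zpchar (p l : nat) (Q : padicClosure p) (Ql : padicClosure l) := ZpChar {
  zfun :> Zpunit Q -> Ql;
  zfun_neq0 : forall u, zfun u != 0;
  zfunM : forall u v t : Zpunit Q,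
    uval t = uval u * uval v -> zfun t = zfun u * zfun v;
  zfun_cont : forall M : rat, exists m : rat, forall u : Zpunit Q,
    near (@pval p Q) m (uval u) 1 -> near (@pval l Ql) M (zfun u) 1 }.

Definition trivialOn (p l : nat) (Q : padicClosure p) (Ql : padicClosure l)
    (c : zpchar Q Ql) (n : nat) : Prop :=
  forall u : Zpunit Q, near (@pval p Q) n.+1%:R (uval u) 1 -> c u = 1.

Definition hasDepth (p l : nat) (Q : padicClosure p) (Ql : padicClosure l)
    (c : zpchar Q Ql) (n : nat) : Prop :=
  trivialOn c n /\ forall m, trivialOn c m -> (n <= m)%N.

Definition depthLe (p l : nat) (Q : padicClosure p) (Ql : padicClosure l)
    (n : nat) (c : zpchar Q Ql) : Prop :=
  exists2 d, hasDepth c d & (d <= n)%N.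

Definition isTeich (p : nat) (Q : padicClosure p) (a : 'F_p) (t : Q) : Prop :=
  [/\ isZp t, t ^+ p = t & near (@pval p Q) 1 t (a : nat)%:R].

(* The point x of (G_m x W_n)(F_p) corresponds to the class of u modulo
   1 + p^(n+1) Z_p: with W_n(F_p) = Z/p^n in the usual way, (x_1, .., x_n)
   being sum_i p^i [x_(i+1)], u is congruent to
   [x_0] exp (p sum_i p^i [x_(i+1)]). *)
Definition expIso (p n : nat) (Q : padicClosure p) (u : Zpunit Q)
    (x : {ffun 'I_n.+1 -> 'F_p}) : Prop :=
  exists (t : 'I_n.+1 -> Q) (e : Q),
    [/\ forall i, isTeich (x i) (t i),
        limit (@pval p Q)
          (fun m => \sum_(k < m)
             (p%:R * \sum_(i < n) p%:R ^+ i * t (lift ord0 i)) ^+ k / k`!%:R) e &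
        near (@pval p Q) n.+1%:R (uval u) (t ord0 * e)].

Definition isTheta (S : comNzRingType) (Gm : coordRing S (torus 1)) (N : nat)
    (th : hom Gm Gm) : Prop :=
  th (xuniv Gm ord0) = xuniv Gm ord0 ^+ N.

(* KL belongs to the group K(G_m) of irreducible summands of theta_! *)
Definition inKummer (l : nat) (Ql : padicClosure l) (S : comNzRingType)
    (Gm : coordRing S (torus 1)) (w : geomPt Gm) (N : nat) (KL : locsys Ql w) :
    Prop :=
  exists2 th : hom Gm Gm, isTheta N th & isSummand (Alg (hmap th)) KL.

(* CL belongs to the group C of irreducible summands of Lang_! *)
Definition inLang (p n l : nat) (Ql : padicClosure l)
    (GW : coordRing ('F_p : comNzRingType) (gmWitt p n)) (w : geomPt GW)
    (CL : locsys Ql w) : Prop :=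
  exists2 lg : hom GW GW,
    isLang p (gmWitt p n) (xuniv GW) [ffun i => lg (xuniv GW i)] &
    isSummand (Alg (hmap lg)) CL.

(* CL = S(KL): some summand XL of f_! on the group scheme X has pull-back
   alpha^* KL on the generic fibre G_m^(n+1) and CL on the special fibre
   G_m x W_n. The inclusion of a fibre in X corresponds to the universal point
   of this fibre. *)
Definition isS (p n l : nat) (Ql : padicClosure l) (R K : comNzRingType)
    (j : {rmorphism R -> K}) (r : {rmorphism R -> 'F_p})
    (D : sekiguchiSuwa n j r)
    (Gm : coordRing K (torus 1)) (Gmn : coordRing K (torus n.+1))
    (GW : coordRing ('F_p : comNzRingType) (gmWitt p n))
    (wG : geomPt Gm) (wGn : geomPt Gmn) (wX : geomPt (gring (ssX D)))
    (wW : geomPt GW) (KL : locsys Ql wG) (CL : locsys Ql wW) : Prop :=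
  exists (al : hom Gm Gmn)
         (uK : hom (gring (ssX D)) (resAlg j Gmn))
         (uF : hom (gring (ssX D)) (resAlg r GW))
         (ML : locsys Ql wGn) (XL : locsys Ql wX),
    [/\ isAlpha p (xuniv Gmn) (al (xuniv Gm ord0)),
        ssXK D Gmn uK = xuniv Gmn,
        ssXF D GW uF = xuniv GW,
        isSummand (Alg (hmap (ssf D))) XL &
        [/\ isPullback (hmap al) KL ML,
            isPullback (hmap uK) XL ML,
            isPullback (hmap uF) XL CL &
            inLang CL]].

(* c is the character t_Fr(CL) of (G_m x W_n)(F_p), regarded as a character of
   the group of p-adic units. *)
Definition isTraceChar (p n l : nat) (Q : padicClosure p) (Ql : padicClosure l)
    (k : finClosure p) (GW : coordRing ('F_p : comNzRingType) (gmWitt p n))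
    (wW : geomPt GW) (CL : locsys Ql wW) (c : zpchar Q Ql) : Prop :=
  forall u : Zpunit Q, exists x : hom GW (triv ('F_p : comNzRingType)),
    expIso u [ffun i => x (xuniv GW i)] /\ frobTrace k CL (hmap x) (c u).

Definition isBaseChange (l : nat) (Ql : padicClosure l) (S S' : comNzRingType)
    (j : {rmorphism S -> S'}) (G : coordRing S (torus 1))
    (G' : coordRing S' (torus 1)) (w : geomPt G) (w' : geomPt G')
    (KL : locsys Ql w) (L : locsys Ql w') : Prop :=
  exists2 phi : hom G (resAlg j G'), phi (xuniv G ord0) = xuniv G' ord0 &
    isPullback (hmap phi) KL L.

(* Main.v *)
From HB Require Import structures.
From mathcomp Require Import all_boot all_order all_algebra.
From mathcomp Require Import boolp cyclic separable.
From mathcomp Require cyclotomic.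
From mathcomp Require Import mpoly ring lra zify.
Require Import Defs.

Set Implicit Arguments.
Unset Strict Implicit.
Unset Printing Implicit Defensive.

Import Order.TTheory GRing.Theory Num.Theory.
Local Open Scope ring_scope.

(* Both groups are the dual of Gam = Z/(p-1) x Z/p^n. The covers theta, gamma, f
   and Lang are Gam-torsors, and the squares relating them are equivariant. Over a
   connected base, a Gam-torsor attaches a local system to each character of Gam;
   an equivariant map of torsors matches pull-backs of these local systems with
   equality of characters, and if the torsor is connected the character is
   determined by the local system, and all summands arise in this way. The last
   facts rest on the transitivity of pi_1 on the fibres of connected covers: a
   path with a prescribed effect on one connected cover is an ultraproduct of
   choices of points on the pointed connected covers.

   The scheme Y is connected because it has a section over R and its two fibres
   are connected, an element of R that vanishes in F_p being nilpotent modulo p.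

   On the multiplicative group over an algebraic closure of Q_p, a local system L
   with L^N = 1 is trivialised by theta: a Lagrange resolvent on a cover
   trivialising L generates, after division by a greatest common divisor of its
   coefficients, a function f with f^N a unit of the ring of Laurent polynomials,
   hence of the form a t^m.

   On the special fibre, Frobenius at an F_p-point x acts on the fibre of Lang as
   the inverse of translation by the element of the kernel of Lang with the
   coordinates x, so that the trace of Frobenius at x is the inverse of the value
   of the character. The exponential map turns these points into the classes of
   the units of Z_p modulo 1 + p^(n+1) Z_p. *)

(** * Paths and local systems *)

(** The correspondence is a relation with hidden intermediate local systems, and it has to be the
    graph of a bijection. Existence and uniqueness both become visible once every local system is
    replaced by its character of Gam. A perfect trace form is awkward under base change, composition
    and passage to factors. It is traded for a separability idempotent, which is equational and also
    measures where two maps out of a cover agree. Base points on the various schemes are unrelated,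
    so a character must not depend on the path that joins them; this holds because Gam is abelian.
    Rings are nonzero by their type. A base change, a factor or a quotient can thus be formed only
    once something is known to survive in it: a geometric point, a nonzero idempotent, a proper
    ideal. Finite fibres let maps be proved injective first and bijective afterwards by counting.
    Oddness of p enters the arithmetic through v_p(k!) < k/2 for k > 0, which makes exp converge on
    p Z_p with exp(a) = 1 + a modulo a higher power of p than the one dividing a. *)

Lemma hom_ext (S : comNzRingType) (A B : alg S) (f g : hom A B) :
  (forall x, f x = g x) -> f = g.
Proof.
case: f g => f Hf [g Hg] /= E.
have {}E : f = g.
  case: f g E {Hf Hg} => f Cf [g Cg] /= E.
  have {}E : f = g by apply/funext.
  rewrite -{g}E in Cg *; congr GRing.RMorphism.Pack.
  case: Cf Cg => [[a] [b]] [[a'] [b']].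
  by rewrite (Prop_irrelevance a a') (Prop_irrelevance b b').
by rewrite -{g}E in Hg *; congr Hom; apply: Prop_irrelevance.
Qed.

Definition hid (S : comNzRingType) (A : alg S) : hom A A :=
  @Hom S A A (idfun : {rmorphism A -> A}) (fun=> erefl).

Lemma hcompA (S : comNzRingType) (A B C D : alg S) (f : hom C D) (g : hom B C)
  (h : hom A B) : hcomp f (hcomp g h) = hcomp (hcomp f g) h.
Proof. exact: hom_ext. Qed.

Lemma hcomp1 (S : comNzRingType) (A B : alg S) (f : hom A B) :
  hcomp f (hid A) = f.
Proof. exact: hom_ext. Qed.

Lemma hcomp1l (S : comNzRingType) (A B : alg S) (f : hom A B) :
  hcomp (hid B) f = f.
Proof. exact: hom_ext. Qed.

Lemma locsys_ext (l : nat) (Q : padicClosure l) (A : comNzRingType)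
  (w : geomPt A) (L L' : locsys Q w) : (forall s, L s = L' s) -> L = L'.
Proof.
case: L L' => f a b c [f' a' b' c'] /= E.
have {}E : f = f' by apply/funext.
by rewrite -{f'}E in a' b' c' *; congr Locsys; apply: Prop_irrelevance.
Qed.

Lemma zpchar_ext (p l : nat) (Q : padicClosure p) (Ql : padicClosure l)
  (c c' : zpchar Q Ql) : (forall u, c u = c' u) -> c = c'.
Proof.
case: c c' => f a b d [f' a' b' d'] /= E.
have {}E : f = f' by apply/funext.
by rewrite -{f'}E in a' b' d' *; congr ZpChar; apply: Prop_irrelevance.
Qed.

Definition path_id (A : comNzRingType) (w : geomPt A) : path w w.
Proof.
by exists (fun B (_ : fet B) (h : hom B w) => h) => // B HB; exists id.
Defined.

Definition path_comp (A : comNzRingType) (w1 w2 w3 : geomPt A)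
  (t : path w2 w3) (s : path w1 w2) : path w1 w3.
Proof.
exists (fun B HB h => t B HB (s B HB h)).
- by move=> B C HB HC g h; rewrite !(pfun_nat _ HB HC).
- by move=> B HB; apply: bij_comp; apply: pfun_bij.
Defined.

Lemma path_inv_ex (A : comNzRingType) (w1 w2 : geomPt A) (s : path w1 w2) :
  exists t : path w2 w1, forall B HB, cancel (s B HB) (t B HB) /\
    cancel (t B HB) (s B HB).
Proof.
have I B (HB : fet B) : exists t, cancel (s B HB) t /\ cancel t (s B HB).
  by case: (pfun_bij s HB) => t ? ?; exists t.
pose t B HB := projT1 (cid (I B HB)).
have tK B HB : cancel (s B HB) (t B HB) /\ cancel (t B HB) (s B HB).
  exact: projT2 (cid (I B HB)).
have tn (B C : alg A) (HB : fet B) (HC : fet C) (g : hom B C) h :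
    t B HB (hcomp h g) = hcomp (t C HC h) g.
  rewrite -{1}[h](tK C HC).2 -(pfun_nat _ HB HC); exact: (tK B HB).1.
have tb B HB : bijective (t B HB) by exists (s B HB); case: (tK B HB).
by exists (Path tn tb).
Qed.

Definition path_inv (A : comNzRingType) (w1 w2 : geomPt A) (s : path w1 w2) :=
  projT1 (cid (path_inv_ex s)).

Lemma path_invK (A : comNzRingType) (w1 w2 : geomPt A) (s : path w1 w2) B HB :
  cancel (s B HB) (path_inv s B HB).
Proof. by rewrite /path_inv; case: cid => t /= /(_ B HB) []. Qed.

Lemma path_invKr (A : comNzRingType) (w1 w2 : geomPt A) (s : path w1 w2) B HB :
  cancel (path_inv s B HB) (s B HB).
Proof. by rewrite /path_inv; case: cid => t /= /(_ B HB) []. Qed.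

Lemma path_inj (A : comNzRingType) (w1 w2 : geomPt A) (s : path w1 w2) B
  (HB : fet B) : injective (s B HB).
Proof. exact: can_inj (path_invK s HB). Qed.

(** * Zorn's lemma for families of subsets, and ultrafilters *)

Section Towers.
Variables (X : Type) (P : (X -> Prop) -> Prop).
Implicit Types S T : X -> Prop.

Definition subP S T := forall x, S x -> T x.

Lemma subP_anti S T : subP S T -> subP T S -> S = T.
Proof. by move=> a b; apply/funext => x; apply/propext; split; auto. Qed.

Variables (S0 : X -> Prop) (f : (X -> Prop) -> X -> Prop).
Hypothesis f_incr : forall S, subP S (f S).

Definition sup (F : (X -> Prop) -> Prop) x := S0 x \/ exists2 S, F S & S x.

(** The least family stable under [f] and under [sup]; the [sup] of the empty family is [S0], where
    the tower starts. That it is a chain is shown by the argument of Bourbaki and Witt, which avoids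
    ordinals. *)
Inductive tower : (X -> Prop) -> Prop :=
| tower_f S : tower S -> tower (f S)
| tower_sup F : (forall S, F S -> tower S) -> tower (sup F).

Lemma tower_S0 S : tower S -> subP S0 S.
Proof. by elim=> [{}S _ IH x /IH/f_incr|F _ _ x S0x] //; left. Qed.

(** Applying [f] strictly below an extreme [c] does not overshoot [c]. Induction on the tower shows
    that an extreme [c] is comparable with every member, and then that every member is extreme. *)
Let extreme c := forall S, tower S -> subP S c -> S <> c -> subP (f S) c.

Let extreme1 c : tower c -> extreme c ->
  forall S, tower S -> subP S c \/ subP (f c) S.
Proof.
move=> Tc Ec S; elim=> [{}S TS [Sc|cS]|F TF IH].
- have [->|ne] := pselect (S = c); first by right.
  by left; apply: Ec.
- by right=> x /cS/f_incr.
- have [[T FT cT]|no] := pselect (exists2 T, F T & subP (f c) T).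
    by right=> x /cT Tx; right; exists T.
  left=> x [/(tower_S0 Tc)//|[T FT Tx]]; have [//|cT] := IH T FT; first exact.
  by case: no; exists T.
Qed.

Let all_extreme c : tower c -> extreme c.
Proof.
elim=> [{}c Tc Ec S TS Sc ne|F TF IH S TS Sc ne].
  have [Sc'|cS] := extreme1 Tc Ec TS; last by case: ne; apply: subP_anti.
  have [->//|ne'] := pselect (S = c).
  by move=> x /(Ec S TS Sc' ne')/f_incr.
have [[c' Fc' ncS]|no] := pselect (exists2 c', F c' & ~ subP (f c') S); last first.
  case: ne; apply: subP_anti => // x [/(tower_S0 TS)//|[T FT Tx]].
  have [TS'|nTS] := pselect (subP (f T) S); first exact/TS'/f_incr.
  by case: no; exists T.
have c'sup : subP c' (sup F) by move=> x c'x; right; exists c'.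
have [Sc'|//] := extreme1 (TF _ Fc') (IH _ Fc') TS.
have [E|ne'] := pselect (S = c'); last by move=> x /(IH _ Fc' S TS Sc' ne')/c'sup.
have Tsup : tower (sup F) by apply: tower_sup.
have [supc|fc] := extreme1 (TF _ Fc') (IH _ Fc') Tsup.
  by case: ne; apply: subP_anti => //; rewrite E.
by rewrite E.
Qed.

Lemma tower_total S T : tower S -> tower T -> subP S T \/ subP T S.
Proof.
move=> TS TT; have [?|H] := extreme1 TT (all_extreme TT) TS; first by left.
by right=> x Tx; apply/H/f_incr.
Qed.

End Towers.

(** Without a maximal element, every good set has a strict enlargement, which [f] selects. The union
    of the whole tower lies in the tower, and so does its image under [f]; this image is then
    contained in the union, against strictness. *)
Lemma zorn_sup (X : Type) (P : (X -> Prop) -> Prop) (S0 : X -> Prop) :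
  (forall F : (X -> Prop) -> Prop, (forall S, F S -> P S /\ subP S0 S) ->
     (forall S T, F S -> F T -> subP S T \/ subP T S) -> P (sup S0 F)) ->
  exists M, [/\ P M, subP S0 M & forall S, P S -> subP M S -> S = M].
Proof.
move=> Psup; apply: contrapT => noM.
have ex S : exists T, subP S T /\ (P S -> subP S0 S -> P T /\ T <> S).
  have [[PS S0S]|nPS] := pselect (P S /\ subP S0 S); last first.
    by exists S; split=> // ? ?; case: nPS.
  apply: contrapT => noT; apply: noM; exists S; split=> // T PT ST.
  by apply: contrapT => neTS; apply: noT; exists T.
pose f S := projT1 (cid (ex S)).
have fP S : subP S (f S) /\ (P S -> subP S0 S -> P (f S) /\ f S <> S).
  exact: projT2 (cid (ex S)).
have fi S : subP S (f S) := (fP S).1.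
have TP S : tower S0 f S -> P S.
  elim=> [{}S TS PS|F TF PF]; first by have [] := (fP S).2 PS (tower_S0 fi TS).
  apply: Psup => [T FT|V W FV FW].
  - by split; [exact: PF | exact: (@tower_S0 _ S0 f fi _ (TF _ FT))].
  - exact: (@tower_total _ S0 f fi _ _ (TF _ FV) (TF _ FW)).
pose U := sup S0 (tower S0 f).
have TU : tower S0 f U by apply: tower_sup.
have [_] := (fP U).2 (TP _ TU) (@tower_S0 _ S0 f fi _ TU); apply.
apply: subP_anti; last exact: fi.
by move=> x fUx; right; exists (f U) => //; apply: tower_f.
Qed.

(* A filter base on [I] is given by a directed family of nonempty sets [cone a];
   the analogue in the MathComp-Analysis library lives in too small a universe. *)
Lemma ultra_ex (I J : Type) (cone : J -> I -> Prop) (j0 : J) :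
  (forall a, exists i, cone a i) ->
  (forall a b, exists c, forall i, cone c i -> cone a i /\ cone b i) ->
  exists U : (I -> Prop) -> Prop,
    [/\ forall S T, U S -> U T -> exists i, S i /\ T i,
        forall a, U (cone a), forall S T, U S -> subP S T -> U T &
        forall S T, U (fun i => S i \/ T i) -> U S \/ U T].
Proof.
move=> cone_ne cone_dir.
pose S0 (S : I -> Prop) := exists a, subP (cone a) S.
pose P (U : (I -> Prop) -> Prop) :=
  [/\ forall S, U S -> exists i, S i, forall S T, U S -> subP S T -> U T &
      forall S T, U S -> U T -> U (fun i => S i /\ T i)].
have PS0 : P S0.
  split=> [S [a aS]|S T [a aS] ST|S T [a aS] [b bT]].
  - by have [i /aS] := cone_ne a; exists i.
  - by exists a => i /aS/ST.
  - by have [c cab] := cone_dir a b; exists c => i /cab [/aS ? /bT].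
have [|U [[Une Uup Ucap] S0U Umax]] := @zorn_sup _ P S0.
  move=> F FP Ftot; split.
  - by move=> S [[a aS]|[V /FP[[Vne _ _] _]]]; [have [i /aS] := cone_ne a; exists i|exact: Vne].
  - move=> S T [S0S|[V FV VS]] ST; first by left; case: PS0 => _ + _; apply; eauto.
    by right; exists V => //; have [[_ + _] _] := FP V FV; apply; eauto.
  - move=> S T [S0S|[V FV VS]] [S0T|[W FW WT]].
    + by left; case: PS0 => _ _; apply.
    + by right; exists W => //; have [[_ _ +] sub] := FP W FW; apply=> //; apply: sub.
    + by right; exists V => //; have [[_ _ +] sub] := FP V FV; apply=> //; apply: sub.
    + have [VW|WV] := Ftot V W FV FW.
      * by right; exists W => //; have [[_ _ +] sub] := FP W FW; apply=> //; apply: VW.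
      * by right; exists V => //; have [[_ _ +] sub] := FP V FV; apply=> //; apply: WV.
(* If no member of [U] avoids [S], the sets containing the trace on [S] of some member form a proper
   filter [V] above [U]. By maximality it equals [U], and [S] belongs to it. *)
have ultra S : U S \/ U (fun i => ~ S i).
  have [[T UT TS]|no] := pselect (exists2 T, U T & forall i, T i -> ~ S i).
    by right; apply: Uup UT TS.
  left; pose V R := exists2 T, U T & forall i, T i -> S i -> R i.
  have VU : V = U.
    apply: Umax => [|R UR]; last by exists R.
    split.
    - move=> R [T UT TR]; apply: contrapT => nR; apply: no; exists T => // i Ti Si.
      by apply: nR; exists i; apply: TR.
    - by move=> R R' [T UT TR] RR'; exists T => // i Ti Si; apply/RR'/TR.
    - move=> R R' [T UT TR] [T' UT' TR'].
      by exists (fun i => T i /\ T' i) => [|i [Ti T'i] Si]; [apply: Ucap|auto].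
  rewrite -VU; exists (cone j0) => //; apply: S0U; exists j0; exact.
have cone_U a : U (cone a) by apply: S0U; exists a; exact.
exists U; split=> // [S T US UT|S T UST]; first exact: Une (Ucap _ _ US UT).
have [|nS] := ultra S; first by left.
right; apply: Uup (Ucap _ _ UST nS) _ => i [[Si|//]]; by move/(_ Si).
Qed.

Lemma ultra_fin (I : Type) (U : (I -> Prop) -> Prop) (m : nat)
  (S : 'I_m -> I -> Prop) :
  (forall T, U T -> exists i, T i) ->
  (forall T T', U (fun i => T i \/ T' i) -> U T \/ U T') ->
  (forall T T', U T -> subP T T' -> U T') ->
  U (fun i => exists k, S k i) -> exists k, U (S k).
Proof.
move=> Une Uor Uup; elim: m S => [|m IH] S US.
  by have [i [[]]] := Une _ US.
have [|Uk|/IH[k Uk]] := Uor (S ord0) (fun i => exists k, S (lift ord0 k) i).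
- apply: Uup US _ => i [k Ski]; case: (unliftP ord0 k) Ski => [j|] -> Ski.
    by right; exists j.
  by left.
- by exists ord0.
- by exists (lift ord0 k).
Qed.

(** * Finite etale algebras *)

Section LinearForms.
Variables (A : comNzRingType) (B : alg A) (f : B -> A).
Hypothesis lf : linear_form f.

Lemma lfD x y : f (x + y) = f x + f y. Proof. exact: lf.1. Qed.
Lemma lfZ a x : f (astr B a * x) = a * f x. Proof. exact: lf.2. Qed.
Lemma lf0 : f 0 = 0.
Proof. by rewrite -[0 in LHS](mul0r 0) -(rmorph0 (astr B)) lfZ mul0r. Qed.
Lemma lf_sum (I : Type) (r : seq I) (P : pred I) (F : I -> B) :
  f (\sum_(i <- r | P i) F i) = \sum_(i <- r | P i) f (F i).
Proof. by apply: (big_morph f lfD lf0). Qed.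
End LinearForms.

Definition dual_basis (A : comNzRingType) (B : alg A) (I : finType)
    (b : I -> B) (f : I -> B -> A) : Prop :=
  (forall i, linear_form (f i)) /\
  (forall x, x = \sum_i astr B (f i x) * b i).

(* [\sum_j u j (x) v j] is a separability idempotent of [B (x)_A B]; since [B] is
   projective, equality in the tensor product is tested by linear forms. *)
Definition sep_elt (A : comNzRingType) (B : alg A) (J : finType)
    (u v : J -> B) : Prop :=
  (forall f : B -> A, linear_form f -> forall x,
     \sum_j astr B (f (x * u j)) * v j = \sum_j astr B (f (u j)) * (x * v j)) /\
  \sum_j u j * v j = 1.

(** Projective and separable: an equational substitute for [fet], equivalent to it by [fetP], whose
    data can be transported along base change, towers and factors. *)
Definition fsep (A : comNzRingType) (B : alg A) : Prop :=
  (exists (I : finType) (b : I -> B) (f : I -> B -> A), dual_basis b f) /\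
  (exists (J : finType) (u v : J -> B), sep_elt u v).

Lemma linear_form_mul (A : comNzRingType) (B : alg A) (f : B -> A) (y : B) :
  linear_form f -> linear_form (fun x => f (x * y)).
Proof.
move=> lf; split=> [x z|a x]; first by rewrite mulrDl (lfD lf).
by rewrite -mulrA (lfZ lf).
Qed.

Lemma linear_form_sum (A : comNzRingType) (B : alg A) (I : finType)
  (f : I -> B -> A) :
  (forall i, linear_form (f i)) -> linear_form (fun x => \sum_i f i x).
Proof.
move=> lf; split=> [x z|a x].
  by rewrite -big_split; apply: eq_bigr => i _; rewrite (lfD (lf i)).
by rewrite mulr_sumr; apply: eq_bigr => i _; rewrite (lfZ (lf i)).
Qed.

(** Perfectness represents each coordinate form [f i] as the trace against some [y i]. Then [b] and
    [y] are dual bases for the trace form, and the sum of the b_i (x) y_i is the separability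
    idempotent. *)
Lemma fet_fsep (A : comNzRingType) (B : alg A) : fet B -> fsep B.
Proof.
move=> [k [b [f [lf bf perf]]]].
pose tr x := \sum_(i < k) f i (x * b i).
have ltr : linear_form tr.
  by apply: linear_form_sum => i; apply: linear_form_mul.
have lfM y : linear_form (fun x => tr (x * y)) by apply: linear_form_mul.
have inj y z : (forall x, tr (x * y) = tr (x * z)) -> y = z.
  move=> yz; have [t [_ tU]] := perf _ (lfM y).
  have ty : t = y by exact: tU.
  by rewrite -ty; apply: tU.
have exy i : exists y, forall x, f i x = tr (x * y).
  by have [y [Hy _]] := perf _ (lf i); exists y.
have {exy} [y Hy] := choice exy.
have expand z : z = \sum_i astr B (tr (z * b i)) * y i.
  apply: inj => x; rewrite mulr_sumr (lf_sum ltr).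
  under eq_bigr => i _ do rewrite mulrCA (lfZ ltr) -Hy.
  rewrite mulrC {1}[x]bf mulr_sumr (lf_sum ltr).
  by apply: eq_bigr => i _; rewrite mulrCA (lfZ ltr) mulrC.
split; first by exists 'I_k, b, f.
exists 'I_k, b, y; split=> [g lg x|].
  under eq_bigr => j _.
    rewrite {1}[x * b j]bf (lf_sum lg) rmorph_sum /= mulr_suml.
    over.
  rewrite exchange_big /=; apply: eq_bigr => i _.
  rewrite [x * y i]expand mulr_sumr; apply: eq_bigr => j _.
  rewrite (lfZ lg) rmorphM Hy mulrAC mulrC mulrAC mulrA mulrC mulrA.
  by congr (_ * _ * _); rewrite mulrAC.
apply: inj => x; rewrite mulr1 mulr_sumr (lf_sum ltr).
by apply: eq_bigr => i _; rewrite Hy mulrA.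
Qed.

(** A form [g] is represented by the sum of the g(u_j) v_j: balancing moves the argument x inside
    [g], and the trace collapses to the sum of the g(x u_j v_j), which is g(x). *)
Lemma fsep_fet (A : comNzRingType) (B : alg A) : fsep B -> fet B.
Proof.
move=> [[I [b [f [lf bf]]]] [J [u [v [bal uv1]]]]].
exists #|I|, (fun i => b (enum_val i)), (fun i => f (enum_val i)).
have reidx (M : nmodType) (F : I -> M) :
    \sum_(i < #|I|) F (enum_val i) = \sum_i F i.
  by rewrite (reindex _ (onW_bij _ (enum_val_bij I))).
split=> // [x|g lg]; first by rewrite (reidx _ (fun i => astr B (f i x) * b i)) -bf.
have trE (x y : B) : \sum_(i < #|I|) f (enum_val i) (x * y * b (enum_val i))
    = \sum_i f i (x * y * b i).
  exact: (reidx _ (fun i => f i (x * y * b i))).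
exists (\sum_j astr B (g (u j)) * v j); split=> [x|y Hy].
  have E i : f i (x * (\sum_j astr B (g (u j)) * v j) * b i)
      = \sum_j g (astr B (f i (v j)) * (x * u j * b i)).
    have -> : x * (\sum_j astr B (g (u j)) * v j) * b i
        = \sum_j astr B (g (u j)) * (x * b i * v j).
      rewrite mulr_sumr mulr_suml; apply: eq_bigr => j _.
      by rewrite mulrCA -!mulrA [v j * _]mulrC.
    rewrite -bal // (lf_sum (lf i)); apply: eq_bigr => j _.
    by rewrite (lfZ (lf i)) (lfZ lg) mulrC [x * b i * _]mulrAC.
  rewrite trE (eq_bigr _ (fun i _ => E i)) exchange_big /=.
  rewrite -{1}[x]mulr1 -uv1 mulr_sumr (lf_sum lg); apply: eq_bigr => j _.
  rewrite -(lf_sum lg) {1}[v j]bf mulrA mulr_sumr; congr g.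
  by apply: eq_bigr => i _; rewrite mulrCA.
under eq_bigr => j _ do rewrite Hy trE rmorph_sum /= mulr_suml.
rewrite exchange_big /=.
have E i : \sum_j astr B (f i (u j * y * b i)) * v j
    = \sum_j astr B (f i (u j)) * (y * b i * v j).
  by rewrite -bal //; apply: eq_bigr => j _; rewrite [y * b i * _]mulrC mulrA.
rewrite (eq_bigr _ (fun i _ => E i)) exchange_big /= -[RHS]mul1r -uv1 mulr_suml.
apply: eq_bigr => j _; rewrite [u j in RHS]bf !mulr_suml.
by apply: eq_bigr => i _; rewrite -!mulrA; congr (_ * _); ring.
Qed.

Lemma fetP (A : comNzRingType) (B : alg A) : fet B <-> fsep B.
Proof. by split; [apply: fet_fsep|apply: fsep_fet]. Qed.

(** The image of the separability idempotent under g (x) h. For algebra maps g and h it is the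
    function on Spec D equal to 1 where these two sections of the cover agree and to 0 elsewhere. *)
Definition eq_idem (A : comNzRingType) (B D : alg A) (J : finType)
  (u v : J -> B) (g h : B -> D) : D := \sum_j g (u j) * h (v j).

Section EqualizerIdempotent.
Variables (A : comNzRingType) (B D : alg A) (J : finType) (u v : J -> B).
Hypotheses (HB : fet B) (uvS : sep_elt u v).

Lemma eq_idemE (g h : hom B D) x :
  g x * eq_idem u v g h = h x * eq_idem u v g h.
Proof.
have [[I [b [f [lf bf]]]] _] := fet_fsep HB; have [bal uv1] := uvS.
have {1}-> : g x * eq_idem u v g h = \sum_j g (x * u j) * h (v j).
  by rewrite mulr_sumr; apply: eq_bigr => j _; rewrite mulrA rmorphM.
(* Balancing is known only against forms with values in A, so the products are first expanded along
   a dual basis of B. *)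
have expg y z : g y * h z = \sum_i g (b i) * h (astr B (f i y) * z).
  rewrite {1}[y]bf rmorph_sum /= mulr_suml; apply: eq_bigr => i _.
  by rewrite !rmorphM /= !hmapE; ring.
under eq_bigr => j _ do rewrite expg.
rewrite exchange_big /=.
under eq_bigr => i _ do rewrite -mulr_sumr -rmorph_sum bal // rmorph_sum mulr_sumr.
rewrite exchange_big /= mulr_sumr; apply: eq_bigr => j _.
rewrite expg mulr_sumr; apply: eq_bigr => i _.
by rewrite !rmorphM /=; ring.
Qed.

Lemma eq_idem_idem (g h : hom B D) :
  eq_idem u v g h * eq_idem u v g h = eq_idem u v g h.
Proof.
rewrite {1}/eq_idem mulr_suml; under eq_bigr => j _.
  rewrite mulrAC eq_idemE mulrAC -[h (u j) * _]rmorphM; over.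
by rewrite -mulr_suml -rmorph_sum uvS.2 rmorph1 mul1r.
Qed.

Lemma eq_idem1 (g : {rmorphism B -> D}) : eq_idem u v g g = 1.
Proof.
rewrite /eq_idem; under eq_bigr => j _ do rewrite -rmorphM.
by rewrite -rmorph_sum uvS.2 rmorph1.
Qed.
End EqualizerIdempotent.

(** Connectedness of Spec A; it is nonempty because 0 and 1 differ in a [comNzRingType]. *)
Definition conn (A : comNzRingType) : Prop :=
  forall e : A, e * e = e -> e = 0 \/ e = 1.

Lemma conn_idomain (A : idomainType) : conn A.
Proof.
move=> e ee; have /eqP : e * (e - 1) = 0 by rewrite mulrBr ee mulr1 subrr.
by rewrite mulf_eq0 subr_eq0 => /orP[/eqP|/eqP]; [left|right].
Qed.

(** Unique lifting: the idempotent measuring the agreement of [g] and [h] is 0 or 1 on the connected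
    D, and [q] sends it to 1. *)
Lemma hom_conn_eq (A : comNzRingType) (B D : alg A) (D' : comNzRingType)
  (g h : hom B D) (q : {rmorphism D -> D'}) :
  fet B -> conn D -> (forall x, q (g x) = q (h x)) -> g = h.
Proof.
move=> HB cD qgh; have [_ [J [u [v uvS]]]] := fet_fsep HB.
have [e0|e1] := cD _ (eq_idem_idem HB uvS g h).
  have /eqP := @eq_idem1 A B (Alg (q \o astr D : {rmorphism A -> D'})) J u v uvS
    (q \o hmap g : {rmorphism B -> D'}).
  rewrite /eq_idem /=; under eq_bigr => j _ do rewrite [X in _ * X]qgh -rmorphM.
  by rewrite -rmorph_sum [X in q X]e0 rmorph0 eq_sym oner_eq0.
by apply: hom_ext => x; have := eq_idemE HB uvS g h x; rewrite e1 !mulr1.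
Qed.

Lemma hom_conn_eqw (A : comNzRingType) (B D : alg A) (w : geomPt A)
  (g h : hom B D) (q : hom D w) :
  fet B -> conn D -> hcomp q g = hcomp q h -> g = h.
Proof.
move=> HB cD E; apply: (hom_conn_eq (q := hmap q) HB cD) => x.
exact: (f_equal (fun k : hom B w => k x) E).
Qed.

Lemma eq_idem_pt (A : comNzRingType) (B : alg A) (w : geomPt A) (J : finType)
  (u v : J -> B) (g h : hom B w) : fet B -> sep_elt u v ->
  eq_idem u v g h = (`[< g = h >])%:R.
Proof.
move=> HB uvS; have [->|ne] := asboolP; first by apply: (eq_idem1 uvS).
apply/eqP/negPn/negP => nz; apply: ne; apply: hom_ext => x.
exact: (mulIf (x := eq_idem u v g h : gfield w) nz) (eq_idemE HB uvS g h x).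
Qed.

(** Distinct points are orthogonal for the separability idempotent. Their values on [u] and on [v]
    thus form two matrices with product 1, which bounds their number by the number of terms of the
    idempotent. *)
Lemma fibre_bound (A : comNzRingType) (B : alg A) (w : geomPt A) :
  fet B -> exists n, forall m (h : 'I_m -> hom B w), injective h -> (m <= n)%N.
Proof.
move=> HB; have [_ [J [u [v uvS]]]] := fet_fsep HB.
exists #|J| => m h h_inj.
pose U := \matrix_(i < m, j < #|J|) h i (u (enum_val j)).
pose V := \matrix_(j < #|J|, i < m) h i (v (enum_val j)).
suff : U *m V = 1%:M by exact: mulmx1_min.
apply/matrixP => i l; rewrite !mxE.
have -> : \sum_j U i j * V j l = eq_idem u v (h i) (h l).
  rewrite /eq_idem [RHS](reindex _ (onW_bij _ (enum_val_bij J))) /=.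
  by apply: eq_bigr => j _; rewrite !mxE.
rewrite (eq_idem_pt _ _ HB uvS); congr (nat_of_bool _)%:R.
by apply/asboolP/eqP => [/h_inj|->].
Qed.

Definition finT (X : Type) := exists m (h : 'I_m -> X), bijective h.

Lemma inj_bij_ord (X : Type) m (h : 'I_m -> X) :
  injective h -> (forall x, exists i, h i = x) -> bijective h.
Proof.
move=> hi /choice [g hg]; exists g => // i; exact/hi/hg.
Qed.

Lemma bounded_finT (X : Type) n :
  (forall m (h : 'I_m -> X), injective h -> (m <= n)%N) -> finT X.
Proof.
move=> bnd; pose S m := `[< exists h : 'I_m -> X, injective h >].
have S0 : exists m, S m.
  have f0 : 'I_0 -> X by case.
  by exists 0%N; apply/asboolP; exists f0; case.
have Sn m : S m -> (m <= n)%N by move/asboolP=> [h /bnd].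
case: (ex_maxnP S0 Sn) => m /asboolP [h hi] mmax; exists m, h.
apply: inj_bij_ord => // x; apply: contrapT => nx.
suff /mmax : S m.+1 by rewrite ltnn.
apply/asboolP; exists (fun i => if unlift ord0 i is Some j then h j else x).
move=> i j; case: unliftP => [i'|] ->; case: unliftP => [j'|] -> //.
- by move/hi->.
- by move=> E; case: nx; exists i'.
- by move=> E; case: nx; exists j'.
Qed.

Lemma fibre_finT (A : comNzRingType) (B : alg A) (w : geomPt A) :
  fet B -> finT (hom B w).
Proof. by case/(fibre_bound w) => n /bounded_finT. Qed.

Lemma finT_inj_le (X Y : Type) m (h : 'I_m -> X) n (k : 'I_n -> Y) (f : X -> Y) :
  bijective h -> bijective k -> injective f -> (m <= n)%N.
Proof.
move=> [h' hK _] [k' _ kK] fi.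
have inj : injective (fun i => k' (f (h i))).
  by move=> i j /(can_inj kK)/fi/(can_inj hK).
by have := leq_card _ inj; rewrite !card_ord.
Qed.

(** Transports between fibres are first obtained as injections only; an injection in each direction
    compares the cardinals. *)
Lemma finT_inj_bij (X Y : Type) (f : X -> Y) (g : Y -> X) :
  finT X -> finT Y -> injective f -> injective g -> bijective f.
Proof.
move=> [m [h hb]] [n [k kb]] fi gi.
have mn : m = n.
  by apply/eqP; rewrite eqn_leq (finT_inj_le hb kb fi) (finT_inj_le kb hb gi).
subst n; case: hb kb => [h' hK h'K] [k' kK k'K].
have Fi : injective (fun i => k' (f (h i))).
  by move=> i j /(can_inj k'K)/fi/(can_inj hK).
have [F' FK F'K] := injF_bij Fi.
exists (fun y => h (F' (k' y))) => [x|y].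
  by rewrite -{1}[x]h'K FK h'K.
by apply: (can_inj k'K); rewrite F'K.
Qed.

Lemma finT_self_bij (X : Type) (f : X -> X) : finT X -> injective f -> bijective f.
Proof. by move=> HX fi; apply: (finT_inj_bij (g := id)). Qed.

(** * Projectors, the trace ideal, and points of fibres *)

Lemma fet_dual (A : comNzRingType) (B : alg A) : fet B ->
  exists (k : nat) (b : 'I_k -> B) (f : 'I_k -> B -> A), dual_basis b f.
Proof. by case=> k [b [f [lf bf _]]]; exists k, b, f. Qed.

(** The entries of 1 - M and of 1 are congruent modulo J, hence so are the products in the
    expansions of the two determinants. *)
Lemma det_sub1_ideal (A : comNzRingType) (J : A -> Prop) k (M : 'M[A]_k) :
  J 0 -> (forall x y, J x -> J y -> J (x + y)) -> (forall a x, J x -> J (a * x)) ->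
  (forall i j, J (M i j)) -> J (1 - \det (1%:M - M)).
Proof.
move=> J0 JD JM JMij.
have JB x y : J x -> J y -> J (x - y).
  by move=> Jx Jy; rewrite -[y]mul1r -mulNr; apply: JD => //; apply: JM.
have Jprod (a c : 'I_k -> A) : (forall i, J (a i - c i)) ->
    J (\prod_i a i - \prod_i c i).
  move=> Jac; apply: (big_ind2 (fun x y => J (x - y))) => [|x x' y y' Jx Jy|//].
    by rewrite subrr.
  have -> : x * y - x' * y' = y * (x - x') + x' * (y - y') by ring.
  by apply: JD; apply: JM.
rewrite -{1}(det1 A k) /determinant -sumrB; elim/big_ind: _ => // s _.
rewrite -mulrBr; apply: JM; apply: Jprod => i.
by rewrite !mxE opprB addrCA subrr addr0.
Qed.

Section TraceIdeal.
Variables (A : comNzRingType) (B : alg A) (k : nat).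
Variables (b : 'I_k -> B) (f : 'I_k -> B -> A).
Hypothesis bf : dual_basis b f.

(** Multiplication by x on B, regarded as a direct summand of A^k through the dual basis. In
    particular [dual_mx 1] is the projector onto this summand rather than the identity matrix. *)
Definition dual_mx (x : B) : 'M[A]_k := \matrix_(i, j) f j (x * b i).

Lemma dual_mxM x y : dual_mx x *m dual_mx y = dual_mx (x * y).
Proof.
apply/matrixP => i l; rewrite !mxE.
have [lf be] := bf.
rewrite mulrAC {1}[x * b i]be mulr_suml (lf_sum (lf l)); apply: eq_bigr => j _.
by rewrite !mxE -mulrA (lfZ (lf l)) [b j * y]mulrC.
Qed.

Lemma dual_mxZ a x : dual_mx (astr B a * x) = a *: dual_mx x.
Proof. by apply/matrixP => i j; rewrite !mxE -mulrA (lfZ (bf.1 j)). Qed.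

Lemma dual_mx1_neq0 : dual_mx 1 <> 0.
Proof.
move=> e0; have /eqP[] := oner_neq0 B.
have b0 j : b j = 0.
  rewrite (bf.2 (b j)) big1 // => i _.
  by have /matrixP/(_ j i) := e0; rewrite !mxE mul1r => ->; rewrite rmorph0 mul0r.
by rewrite (bf.2 1) big1 // => i _; rewrite b0 mulr0.
Qed.

(** The complementary projector 1 - e has an idempotent determinant, so it is 0 or 1; the value 1
    would make 1 - e invertible and e = 0. *)
Lemma det_dual : conn A -> \det (1%:M - dual_mx 1) = 0.
Proof.
move=> cA; set e := dual_mx 1; have ee : e *m e = e by rewrite dual_mxM mulr1.
have idm : (1%:M - e) *m (1%:M - e) = 1%:M - e.
  by rewrite mulmxBl mulmxBr !mul1mx mulmxBr mulmx1 ee subrr subr0.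
have [|//|d1] := cA (\det (1%:M - e)); first by rewrite -det_mulmx idm.
case: dual_mx1_neq0; rewrite -/e -[e]mul1mx -d1 -mul_adj_mx.
by rewrite -mulmxA mulmxBl mul1mx ee subrr mulmx0.
Qed.

(** Modulo the ideal of the sums of values of the coordinate forms, the projector e vanishes and
    det(1 - e) becomes 1. As this determinant is 0, the ideal contains 1. *)
Lemma trace_ideal1 : conn A -> exists y : 'I_k -> B, \sum_i f i (y i) = 1.
Proof.
move=> cA; have := @det_sub1_ideal A
  (fun a => exists y : 'I_k -> B, \sum_i f i (y i) = a) k (dual_mx 1).
rewrite det_dual // subr0; apply.
- by exists (fun=> 0); rewrite big1 // => i _; rewrite (lf0 (bf.1 i)).
- move=> _ _ [y <-] [z <-]; exists (fun i => y i + z i).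
  by rewrite -big_split; apply: eq_bigr => i _; rewrite (lfD (bf.1 i)).
- move=> a _ [y <-]; exists (fun i => astr B a * y i).
  by rewrite mulr_sumr; apply: eq_bigr => i _; rewrite (lfZ (bf.1 i)).
- move=> i j; exists (fun l => if l == j then b i else 0); rewrite mxE mul1r.
  rewrite (bigD1 j) //= eqxx big1 ?addr0 // => l /negPf ->.
  by rewrite (lf0 (bf.1 l)).
Qed.

Lemma map_dual_mx1_neq0 (A' : comNzRingType) (q : {rmorphism A -> A'}) :
  conn A -> map_mx q (dual_mx 1) <> 0.
Proof.
move=> cA e0; have := f_equal q (det_dual cA); rewrite -det_map_mx map_mxB e0.
by rewrite map_mx1 subr0 det1 rmorph0 => /eqP; rewrite oner_eq0.
Qed.
End TraceIdeal.

Lemma fet_trace1 (A : comNzRingType) (B : alg A) : conn A -> fet B ->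
  exists (I : finType) (f : I -> B -> A) (y : I -> B),
    (forall i, linear_form (f i)) /\ \sum_i f i (y i) = 1.
Proof.
move=> cA /fet_dual[k [b [f bf]]]; have [y y1] := trace_ideal1 bf cA.
by exists 'I_k, f, y; split=> //; exact: bf.1.
Qed.

Lemma fet_inj (A : comNzRingType) (B : alg A) : conn A -> fet B ->
  injective (astr B).
Proof.
move=> cA /(fet_trace1 cA)[I [f [y [lf y1]]]].
have inj0 a : astr B a = 0 -> a = 0.
  move=> a0; rewrite -[a]mulr1 -y1 mulr_sumr big1 // => i _.
  by rewrite -(lfZ (lf i)) a0 mul0r (lf0 (lf i)).
by move=> a c /eqP; rewrite -subr_eq0 -rmorphB => /eqP/inj0/eqP; rewrite subr_eq0 => /eqP.
Qed.

(** By Cayley-Hamilton, the linear factors of the characteristic polynomial kill [v] when applied in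
    turn; the last nonzero vector is an eigenvector. [Z] is the product of the factors applied, and
    its commutation property preserves the eigenvectors of other commuting matrices in
    [common_eigen]. *)
Lemma eigen_step (F : closedFieldType) k (M : 'M[F]_k) (v : 'rV[F]_k) :
  v != 0 -> exists (a : F) (Z : 'M[F]_k), [/\ v *m Z != 0,
    v *m Z *m M = a *: (v *m Z) & forall N, M *m N = N *m M -> Z *m N = N *m Z].
Proof.
case: k M v => [|k] M v v0; first by rewrite thinmx0 eqxx in v0.
have [r Hr] := closed_field_poly_normal (char_poly M).
have : v *m \prod_(a <- r) (M - a%:M) = 0.
  have := Cayley_Hamilton M; rewrite Hr (monicP (char_poly_monic M)) scale1r.
  rewrite rmorph_prod /= => E.
  have -> : \prod_(a <- r) (M - a%:M) = 0; last by rewrite mulmx0.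
  rewrite -E; apply: eq_bigr => a _.
  by rewrite rmorphB /= horner_mx_X horner_mx_C.
elim: r v v0 {Hr} => [|a r IH] v v0; first by rewrite big_nil mulmx1 => /eqP; rewrite (negPf v0).
rewrite big_cons mulmxA.
have [va0 _|va] := eqVneq (v *m (M - a%:M)) 0.
  exists a, 1%:M; rewrite mulmx1; split=> // [|N _]; last by rewrite mul1mx mulmx1.
  by apply/eqP; rewrite -subr_eq0 -mul_mx_scalar -mulmxBr va0.
move=> /(IH _ va)[c [Z [vZ E CZ]]]; exists c, ((M - a%:M) *m Z); rewrite !mulmxA; split=> // N MN.
rewrite -mulmxA CZ // !mulmxA; congr (_ *m Z).
by rewrite mulmxBl mulmxBr MN scalar_mxC.
Qed.

Lemma common_eigen (F : closedFieldType) k (v : 'rV[F]_k) m (M : 'I_m -> 'M[F]_k) :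
  v != 0 -> (forall i j, M i *m M j = M j *m M i) ->
  exists (a : 'I_m -> F) (Z : 'M[F]_k), [/\ v *m Z != 0,
    forall i, v *m Z *m M i = a i *: (v *m Z) &
    forall N, (forall i, M i *m N = N *m M i) -> Z *m N = N *m Z].
Proof.
elim: m M => [|m IH] M v0 MM.
  by exists (fun=> 0), 1%:M; rewrite mulmx1; split=> // [[]|N _] //; rewrite mul1mx mulmx1.
have [//|//|a [Z [vZ E CZ]]] := IH (fun i => M (lift ord0 i)).
have [c [Y [vZY Ec CY]]] := eigen_step (M ord0) vZ.
exists (fun i => if unlift ord0 i is Some j then a j else c), (Z *m Y).
rewrite mulmxA; split=> // [i|N MN].
  case: unliftP => [j|] -> //.
  by rewrite -mulmxA CY; [rewrite mulmxA E -scalemxAl|exact: MM].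
by rewrite -mulmxA CY // !mulmxA CZ // => i; apply: MN.
Qed.

(** The multiplications by the b_j become commuting matrices over the field of [w], with a common
    eigenvector in the image of the projector, which is nonzero by [map_dual_mx1_neq0]. The
    eigenvalues form an algebra homomorphism from B. *)
Lemma fibre_ne (A : comNzRingType) (B : alg A) (w : geomPt A) :
  conn A -> fet B -> exists h : hom B w, True.
Proof.
move=> cA /fet_dual[k [b [f bf]]].
pose rho x : 'M[gfield w]_k := map_mx (gmap w) (dual_mx b f x).
have rhoM x y : rho x *m rho y = rho (x * y) by rewrite -map_mxM dual_mxM.
have rhoC x y : rho x *m rho y = rho y *m rho x by rewrite !rhoM mulrC.
have e0 : rho 1 != 0 by apply/eqP; exact: (map_dual_mx1_neq0 bf cA).
have [i ei0] : exists i, row i (rho 1) != 0.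
  apply: contrapT => no; move/eqP: e0; apply; apply/row_matrixP => i.
  by rewrite row0; apply/eqP/negPn/negP => ?; apply: no; exists i.
set v := row i (rho 1) in ei0.
have v1 : v *m rho 1 = v by rewrite -row_mul rhoM mulr1.
have [a [Z [vZ E CZ]]] := common_eigen (M := fun i => rho (b i)) ei0 (fun _ _ => rhoC _ _).
set u := v *m Z in vZ E.
have u1 : u *m rho 1 = u by rewrite /u -mulmxA CZ ?mulmxA ?v1 // => j; apply: rhoC.
have rhoE x : rho x = \sum_j gmap w (f j x) *: rho (b j).
  rewrite {1}[x]bf.2; apply/matrixP => l m; rewrite summxE /rho !mxE.
  rewrite mulr_suml (lf_sum (bf.1 m)) rmorph_sum; apply: eq_bigr => j _.
  by rewrite !mxE -mulrA (lfZ (bf.1 m)) rmorphM.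
pose lam x := \sum_j gmap w (f j x) * a j.
have lamE x : u *m rho x = lam x *: u.
  rewrite rhoE mulmx_sumr /lam scaler_suml; apply: eq_bigr => j _.
  by rewrite -scalemxAr E scalerA.
have uI c d : c *: u = d *: u -> c = d.
  move/eqP; rewrite -subr_eq0 -scalerBl scaler_eq0 (negPf vZ) orbF subr_eq0.
  by move/eqP.
have lam_add x y : lam (x + y) = lam x + lam y.
  rewrite /lam -big_split; apply: eq_bigr => j _.
  by rewrite (lfD (bf.1 j)) rmorphD mulrDl.
have lam1 : lam 1 = 1 by apply: uI; rewrite -lamE u1 scale1r.
have lamM x y : lam (x * y) = lam x * lam y.
  by apply: uI; rewrite -lamE -rhoM mulmxA lamE -scalemxAl lamE scalerA.
have lamA s : lam (astr B s) = gmap w s.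
  apply: uI; rewrite -lamE -[astr B s]mulr1 /rho (dual_mxZ bf) map_mxZ -scalemxAr.
  by rewrite -/(rho 1) u1.
have zm : zmod_morphism lam.
  have lamN y : lam (- y) = - lam y.
    apply/eqP; rewrite -subr_eq0 opprK -lam_add addNr /lam big1 // => j _.
    by rewrite (lf0 (bf.1 j)) rmorph0 mul0r.
  by move=> x y; rewrite lam_add lamN.
pose M1 := GRing.isZmodMorphism.Build B (gfield w) lam zm.
pose M2 := GRing.isMonoidMorphism.Build B (gfield w) lam (conj lam1 lamM).
pose lamR : {rmorphism B -> gfield w} := HB.pack lam M1 M2.
by exists (@Hom A B w lamR lamA).
Qed.

Lemma mk_hom (S : comNzRingType) (A B : alg S) (f : A -> B) :
  (forall x y, f (x + y) = f x + f y) -> f 1 = 1 ->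
  (forall x y, f (x * y) = f x * f y) ->
  (forall s, f (astr A s) = astr B s) -> exists h : hom A B, forall x, h x = f x.
Proof.
move=> fD f1 fM fS.
have f0 : f 0 = 0 by apply: (@addrI _ (f 0)); rewrite -fD !addr0.
have fB : zmod_morphism f.
  by move=> x y; apply: (@addIr _ (f y)); rewrite -fD !subrK.
pose M1 := GRing.isZmodMorphism.Build A B f fB.
pose M2 := GRing.isMonoidMorphism.Build A B f (conj f1 fM).
by exists (@Hom S A B (HB.pack f M1 M2 : {rmorphism A -> B}) fS).
Qed.

Lemma surj_factor (A : comNzRingType) (B C T : alg A) (q : hom B C)
  (g : hom B T) : (forall c, exists x, q x = c) ->
  (forall x, q x = 0 -> g x = 0) -> exists g' : hom C T, hcomp g' q = g.
Proof.
move=> /choice[s qs] qg.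
have E x y : q x = q y -> g x = g y.
  move=> qxy; apply/eqP; rewrite -subr_eq0 -rmorphB qg // rmorphB qxy subrr //.
have [||||h hE] := @mk_hom A C T (fun c => g (s c)).
- by move=> x y; rewrite -rmorphD; apply: E; rewrite rmorphD !qs.
- by rewrite -(rmorph1 (hmap g)); apply: E; rewrite qs rmorph1.
- by move=> x y; rewrite -rmorphM; apply: E; rewrite rmorphM !qs.
- by move=> a; rewrite -(hmapE g); apply: E; rewrite qs hmapE.
by exists h; apply: hom_ext => x /=; rewrite hE; apply: E; rewrite qs.
Qed.

Lemma fet_retract (A : comNzRingType) (B C : alg A) (q : hom B C) (t : C -> B) :
  (forall x y, t (x + y) = t x + t y) ->
  (forall a x, t (astr C a * x) = astr B a * t x) -> cancel t q ->
  fet B -> fet C.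
Proof.
move=> tD tZ tK /fetP[[I [b [f [lf bf]]]] [J [u [v [bal uv1]]]]]; apply/fetP; split.
  exists I, (fun i => q (b i)), (fun i c => f i (t c)); split=> [i|c].
    by split=> [x y|a x]; rewrite ?tD ?tZ ?(lfD (lf i)) ?(lfZ (lf i)).
  rewrite -{1}[c]tK [t c in LHS]bf rmorph_sum; apply: eq_bigr => i _.
  by rewrite rmorphM hmapE.
exists J, (fun j => q (u j)), (fun j => q (v j)); split=> [g lg x|]; last first.
  under eq_bigr => j _ do rewrite -rmorphM.
  by rewrite -rmorph_sum uv1 rmorph1.
have lgq : linear_form (fun y => g (q y)).
  by split=> [y z|a y]; rewrite ?rmorphD ?rmorphM ?hmapE ?(lfD lg) ?(lfZ lg).
have := f_equal (hmap q) (bal _ lgq (t x)).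
rewrite !rmorph_sum; under eq_bigr => j _ do rewrite !rmorphM tK hmapE.
by move=> ->; apply: eq_bigr => j _; rewrite !rmorphM tK hmapE.
Qed.

Lemma factor_ring (B : comNzRingType) (e : B) : e * e = e -> e != 0 ->
  exists (C : comNzRingType) (q : {rmorphism B -> C}) (s : C -> B),
    [/\ forall x y, s (x + y) = s x + s y, forall x y, s (x * y) = s x * s y,
        cancel s q & forall x, s (q x) = x * e].
Proof.
move=> ee e0; pose T := {x : B | x * e == x}.
have in_e x : x * e * e == x * e by rewrite -mulrA ee.
pose mk x : T := exist _ (x * e) (in_e x).
have svE (x : T) : sval x * e = sval x by apply/eqP; case: x.
have mkE (x : T) : mk (sval x) = x by apply: val_inj; rewrite /= svE.
pose add (x y : T) := mk (sval x + sval y).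
pose opp (x : T) := mk (- sval x).
pose mul (x y : T) := mk (sval x * sval y).
have sv_mk x : sval (mk x) = x * e by [].
have addA : associative add.
  by move=> x y z; apply: val_inj; rewrite /= !mulrDl !svE addrA.
have addC : commutative add by move=> x y; apply: val_inj; rewrite /= addrC.
have add0 : left_id (mk 0) add.
  by move=> x; apply: val_inj; rewrite /= mul0r add0r svE.
have addN : left_inverse (mk 0) opp add.
  by move=> x; apply: val_inj; rewrite /= mulNr svE addNr.
pose M1 := GRing.isZmodule.Build T addA addC add0 addN.
pose T1 : zmodType := HB.pack T M1.
have mulA : associative (mul : T1 -> T1 -> T1).
  by move=> x y z; apply: val_inj; rewrite /=; ring.
have mulC : commutative (mul : T1 -> T1 -> T1).
  by move=> x y; apply: val_inj; rewrite /= [sval x * _]mulrC.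
have mul1 : left_id (mk 1 : T1) mul.
  by move=> x; apply: val_inj; rewrite /= mul1r [e * _]mulrC !svE.
have mulD : left_distributive (mul : T1 -> T1 -> T1) +%R.
  by move=> x y z; apply: val_inj; rewrite /=; ring.
have one0 : (mk 1 : T1) != 0.
  by apply/eqP => /(f_equal sval); rewrite /= mul1r mul0r => /eqP; rewrite (negPf e0).
pose M2 := GRing.Zmodule_isComNzRing.Build T1 mulA mulC mul1 mulD one0.
pose C : comNzRingType := HB.pack T T1 M2.
have qB : zmod_morphism (mk : B -> C).
  move=> x y; apply: val_inj; rewrite /= mulrBl mulrDl -mulrA ee.
  by rewrite mulNr -mulrA ee mulNr -mulrA ee.
have q1M : monoid_morphism (mk : B -> C).
  split=> // x y; apply: val_inj; rewrite /=.
  have -> : x * e * (y * e) * e = x * y * (e * e * e) by ring.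
  by rewrite !ee.
pose Q1 := GRing.isZmodMorphism.Build B C mk qB.
pose Q2 := GRing.isMonoidMorphism.Build B C mk q1M.
exists C, (HB.pack mk Q1 Q2 : {rmorphism B -> C}), (fun x : C => sval x); split=> //.
- by move=> x y; rewrite /= mulrDl !svE.
- by move=> x y; rewrite /= -mulrA svE.
Qed.

Lemma fet_factor (A : comNzRingType) (B : alg A) (e : B) :
  fet B -> e * e = e -> e != 0 -> exists (C : alg A) (q : hom B C),
    [/\ fet C, forall c, exists x, q x = c & forall x, q x = 0 <-> x * e = 0].
Proof.
move=> HB ee e0; have [C [q [s [sD sM sK sq]]]] := factor_ring ee e0.
pose C' : alg A := Alg (q \o astr B : {rmorphism A -> C}).
pose q' : hom B C' := @Hom A B C' q (fun=> erefl).
have qs (c : C) : q (s c) = c := sK c.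
exists C', q'; split=> [|c|x].
- apply: (@fet_retract A B C' q' s) => // a x.
  by rewrite sM /= sq -mulrA [e * _]mulrC -{1}[x]sK sq -mulrA ee -sq sK.
- by exists (s c).
- split=> [qx0|xe0]; first by rewrite -sq [q x]qx0; apply: (addrI (s 0)); rewrite -sD !addr0.
  by rewrite /= -[q x]sK sq xe0 rmorph0.
Qed.

Lemma factor_idem1 (A : comNzRingType) (B C : alg A) (e : B) (q : hom B C) :
  e * e = e -> (forall x, q x = 0 <-> x * e = 0) -> q e = 1.
Proof.
move=> ee qe; apply/eqP; rewrite -subr_eq0 -(rmorph1 (hmap q)) -rmorphB.
by apply/eqP/qe; rewrite mulrBl ee mul1r subrr.
Qed.

Lemma factor_lift (A : comNzRingType) (B C T : alg A) (e : B) (q : hom B C)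
  (g : hom B T) : (forall c, exists x, q x = c) ->
  (forall x, q x = 0 <-> x * e = 0) -> g e = 1 ->
  exists g' : hom C T, hcomp g' q = g.
Proof.
move=> qs qe ge; apply: surj_factor => // x /qe xe0.
by rewrite -[g x]mulr1 -ge -rmorphM xe0 rmorph0.
Qed.

(** * Base change, composition and cancellation of finite etale algebras *)

Section Pushout.
Variables (A A' : comNzRingType) (phi : {rmorphism A -> A'}).

(** The base change of B to A', that is B (x)_A A', specified by its universal property alone. *)
Definition is_pushout (B : alg A) (B' : alg A') (i : hom B (resAlg phi B')) :=
  forall (T : alg A') (g : hom B (resAlg phi T)),
    exists! u : hom B' T, hcomp (resHom phi u) i = g.

Lemma pushout_lift (B : alg A) (B' : alg A') (i : hom B (resAlg phi B')) :
  is_pushout i -> forall (T : alg A') (g : hom B (resAlg phi T)),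
    exists u : hom B' T, hcomp (resHom phi u) i = g.
Proof. by move=> Hi T g; have [u [ug _]] := Hi T g; exists u. Qed.

Lemma pushout_uniq (B : alg A) (B' : alg A') (i : hom B (resAlg phi B')) :
  is_pushout i -> forall (T : alg A') (u v : hom B' T),
    hcomp (resHom phi u) i = hcomp (resHom phi v) i -> u = v.
Proof.
move=> Hi T u v uv; have [w [_ wU]] := Hi T (hcomp (resHom phi v) i).
by rewrite -(wU _ uv) -(wU v erefl).
Qed.

(** The point at issue is balancing: a form on B' restricts along [i] to a form with values in A',
    while balancing on B is known for values in A. Expanding along the dual basis of B reduces the
    former to the latter. *)
Lemma fet_pushout_basis (B : alg A) (B' : alg A') (i : hom B (resAlg phi B'))
  (I : finType) (b : I -> B) (f : I -> B -> A) (f' : I -> B' -> A') :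
  dual_basis b f -> (exists (J : finType) (u v : J -> B), sep_elt u v) ->
  (forall j, linear_form (f' j)) ->
  (forall X, X = \sum_j astr B' (f' j X) * i (b j)) -> fet B'.
Proof.
move=> [lf bf] [J [u [v [bal uv1]]]] lf' bf'; apply/fetP; split.
  by exists I, (fun j => i (b j)), f'.
have iS s : i (astr B s) = astr B' (phi s) by rewrite (hmapE i).
exists J, (fun j => i (u j)), (fun j => i (v j)); split=> [g lg X|]; last first.
  under eq_bigr => j _ do rewrite -rmorphM.
  by rewrite -rmorph_sum uv1 rmorph1.
pose G x := \sum_j astr B' (g (i (x * u j))) * i (v j).
have key x : G x = \sum_j astr B' (g (i (u j))) * (i x * i (v j)).
  have E y z : astr B' (g (i y)) * i z =
      \sum_l astr B' (g (i (b l))) * i (astr B (f l y) * z).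
    rewrite {1}[y]bf rmorph_sum (lf_sum lg) rmorph_sum mulr_suml.
    apply: eq_bigr => l _; rewrite !rmorphM /= iS (lfZ lg) rmorphM.
    by rewrite mulrCA mulrA.
  rewrite /G; under eq_bigr => j _ do rewrite E.
  under [RHS]eq_bigr => j _ do rewrite -rmorphM E.
  rewrite exchange_big [RHS]exchange_big; apply: eq_bigr => l _.
  by rewrite -!mulr_sumr -!rmorph_sum bal.
under eq_bigr => j _.
  rewrite {1}[X]bf' mulr_suml (lf_sum lg) rmorph_sum mulr_suml.
  under eq_bigr => l _ do rewrite -mulrA (lfZ lg) rmorphM -mulrA -rmorphM.
  over.
rewrite exchange_big /=.
under eq_bigr => l _ do rewrite -mulr_sumr -/(G (b l)) key mulr_sumr.
rewrite exchange_big /=; apply: eq_bigr => j _.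
rewrite {2}[X]bf' mulr_suml mulr_sumr; apply: eq_bigr => l _.
by rewrite !mulrA [astr _ _ * astr _ _]mulrC.
Qed.

(** The base change is realised on the image of the projector [dual_mx 1] in A'^k. The map [g0] to
    some A'-algebra witnesses that 1 and 0 differ there; the extension of linear forms serves
    descent. *)
Lemma pushout_ex (B : alg A) (T0 : alg A') (g0 : hom B (resAlg phi T0)) :
  fet B -> exists (B' : alg A') (i : hom B (resAlg phi B')),
    [/\ fet B', is_pushout i & forall g : B -> A, linear_form g ->
      exists2 g' : B' -> A', linear_form g' & forall x, g' (i x) = phi (g x)].
Proof.
move=> HB; have [k [b [f bf]]] := fet_dual HB.
have [lf be] := bf.
pose D x : 'M[A']_k := map_mx phi (dual_mx b f x).
have DM x y : D x *m D y = D (x * y) by rewrite -map_mxM (dual_mxM bf).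
pose io (x : B) : 'rV[A']_k := \row_j phi (f j x).
have ioD x y : io x *m D y = io (x * y).
  apply/rowP => j; rewrite !mxE {2}[x]be mulr_suml (lf_sum (lf j)) rmorph_sum.
  by apply: eq_bigr => l _; rewrite !mxE -mulrA (lfZ (lf j)) rmorphM [y * _]mulrC.
pose T := {v : 'rV[A']_k | v *m D 1 == v}.
have in_e (v : 'rV[A']_k) : v *m D 1 *m D 1 == v *m D 1 by rewrite -mulmxA DM mulr1.
pose mk (v : 'rV[A']_k) : T := exist _ (v *m D 1) (in_e v).
have svE (x : T) : sval x *m D 1 = sval x by apply/eqP; case: x.
have Tinj (x y : T) : sval x = sval y -> x = y by move/val_inj.
(* The matrix of multiplication by the element with coordinates w; it defines the product. *)
pose R (w : 'rV[A']_k) := \sum_j w 0 j *: D (b j).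
have RD v w : R (v + w) = R v + R w.
  by rewrite -big_split; apply: eq_bigr => j _; rewrite mxE scalerDl.
have RZ a w : R (a *: w) = a *: R w.
  by rewrite scaler_sumr; apply: eq_bigr => j _; rewrite mxE scalerA.
have Rio x : R (io x) = D x.
  rewrite {2}[x]be; apply/matrixP => l m; rewrite summxE !mxE mulr_suml.
  rewrite (lf_sum (lf m)) rmorph_sum; apply: eq_bigr => j _.
  by rewrite !mxE -mulrA (lfZ (lf m)) rmorphM.
have span v : v *m D 1 = \sum_j v 0 j *: io (b j).
  apply/rowP => j; rewrite mxE summxE; apply: eq_bigr => l _.
  by rewrite !mxE mul1r.
have R1 v w : v *m D 1 *m R w = \sum_j \sum_l (v 0 j * w 0 l) *: io (b j * b l).
  rewrite span mulmx_suml; apply: eq_bigr => j _; rewrite mulmx_sumr.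
  by apply: eq_bigr => l _; rewrite -scalemxAl -scalemxAr scalerA ioD.
have RE (x : T) v : sval x *m R v = \sum_j \sum_l (sval x 0 j * v 0 l) *: io (b j * b l).
  by rewrite -{1}svE R1.
have mulC' (x y : T) : sval x *m R (sval y) = sval y *m R (sval x).
  rewrite !RE exchange_big; apply: eq_bigr => l _; apply: eq_bigr => j _.
  by rewrite mulrC [b j * _]mulrC.
have RC v : R v *m D 1 = R v.
  rewrite mulmx_suml; apply: eq_bigr => j _.
  by rewrite -scalemxAl DM mulr1.
pose add (x y : T) := mk (sval x + sval y).
pose opp (x : T) := mk (- sval x).
pose mul (x y : T) := mk (sval x *m R (sval y)).
have addE x y : sval (add x y) = sval x + sval y by rewrite /= mulmxDl !svE.
have mulE x y : sval (mul x y) = sval x *m R (sval y).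
  by rewrite /= -mulmxA RC.
have addA : associative add.
  by move=> x y z; apply: Tinj; rewrite !addE addrA.
have addC : commutative add by move=> x y; apply: Tinj; rewrite /= addrC.
have add0 : left_id (mk 0) add.
  by move=> x; apply: Tinj; rewrite /= mul0mx add0r svE.
have addN : left_inverse (mk 0) opp add.
  by move=> x; apply: Tinj; rewrite /= mulNmx svE addNr.
pose M1 := GRing.isZmodule.Build T addA addC add0 addN.
pose T1 : zmodType := HB.pack T M1.
have RM x y : R (sval (mul x y)) = R (sval x) *m R (sval y).
  rewrite mulE RE.
  have -> : R (\sum_j \sum_l (sval x 0 j * sval y 0 l) *: io (b j * b l)) =
     \sum_j \sum_l (sval x 0 j * sval y 0 l) *: D (b j * b l).
    have R0 : R 0 = 0 by rewrite -(scale0r 0) RZ scale0r.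
    rewrite (big_morph R RD R0); apply: eq_bigr => j _.
    rewrite (big_morph R RD R0); apply: eq_bigr => l _.
    by rewrite RZ Rio.
  rewrite mulmx_suml; apply: eq_bigr => j _; rewrite mulmx_sumr.
  by apply: eq_bigr => l _; rewrite -scalemxAl -scalemxAr scalerA DM.
have mulA : associative (mul : T1 -> T1 -> T1).
  by move=> x y z; apply: Tinj; rewrite mulE RM mulE mulE mulmxA.
have mulC : commutative (mul : T1 -> T1 -> T1).
  by move=> x y; apply: Tinj; rewrite !mulE mulC'.
have ioE x : sval (mk (io x)) = io x by rewrite /= ioD mulr1.
have mul1 : left_id (mk (io 1) : T1) mul.
  move=> x; apply: Tinj; rewrite mulE mulC' ioE Rio; exact: svE.
have mulD : left_distributive (mul : T1 -> T1 -> T1) +%R.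
  move=> x y z; apply: Tinj.
  by rewrite mulE [in RHS]addE !mulE -mulmxDl addE.
have one0 : (mk (io 1) : T1) != 0.
  apply/eqP => /(f_equal sval); rewrite ioE /= mul0mx => io0.
  have := f_equal (fun v : 'rV_k => \sum_j astr T0 (v 0 j) * g0 (b j)) io0.
  have -> : \sum_j astr T0 (io 1 0 j) * g0 (b j) = 1.
    rewrite -(rmorph1 (hmap g0)) [1 in RHS]be rmorph_sum; apply: eq_bigr => j _.
    by rewrite mxE rmorphM hmapE.
  rewrite big1 => [/eqP|j _]; first by rewrite oner_eq0.
  by rewrite mxE rmorph0 mul0r.
pose M2 := GRing.Zmodule_isComNzRing.Build T1 mulA mulC mul1 mulD one0.
pose C : comNzRingType := HB.pack T T1 M2.
have svD (x y : C) : sval (x + y) = sval x + sval y by exact: addE.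
have svM (x y : C) : sval (x * y) = sval x *m R (sval y) by exact: mulE.
have mkK x : sval (mk (io x)) = io x := ioE x.
pose q a : C := mk (a *: io 1).
have svq a : sval (q a) = a *: io 1 by rewrite /= -scalemxAl ioD mulr1.
have qM a (x : C) : sval (q a * x) = a *: sval x.
  by rewrite svM mulC' svq RZ Rio -scalemxAr svE.
have qB : zmod_morphism q.
  move=> a c; apply/eqP; rewrite eq_sym subr_eq; apply/eqP; apply: Tinj.
  by rewrite svD !svq -scalerDl subrK.
have q1M : monoid_morphism q.
  split=> [|a c]; apply: Tinj; first by rewrite svq scale1r -ioE.
  by rewrite qM !svq scalerA.
pose Q1 := GRing.isZmodMorphism.Build A' C q qB.
pose Q2 := GRing.isMonoidMorphism.Build A' C q q1M.
pose B' : alg A' := Alg (HB.pack q Q1 Q2 : {rmorphism A' -> C}).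
have [||||i iE] := @mk_hom A B (resAlg phi B') (fun x => mk (io x)).
- move=> x y; apply: Tinj; rewrite svD !ioE.
  by apply/rowP => j; rewrite !mxE (lfD (lf j)) rmorphD.
- by [].
- by move=> x y; apply: Tinj; rewrite svM !ioE Rio ioD.
- move=> s; apply: Tinj; rewrite svq ioE; apply/rowP => j.
  by rewrite !mxE -[astr B s]mulr1 (lfZ (lf j)) rmorphM.
have sv_sum (F : 'I_k -> C) : sval (\sum_j F j) = \sum_j sval (F j).
  apply: (big_morph (fun x : C => sval x)) => //.
  by rewrite /= mul0mx.
have expand (X : B') : X = \sum_j astr B' (sval (X : C) 0 j) * i (b j).
  apply: Tinj; rewrite sv_sum -[LHS]svE span; apply: eq_bigr => j _.
  by rewrite qM iE ioE.
exists B', i; split.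
- apply: (fet_pushout_basis (i := i) (b := b) (f := f)
    (f' := fun j (X : B') => sval (X : C) 0 j) bf) => //.
  + by case: (fet_fsep HB).
  + by move=> j; split=> [x y|a x]; rewrite ?svD ?qM mxE.
- move=> T' g; pose U (v : 'rV[A']_k) := \sum_j astr T' (v 0 j) * g (b j).
have UD v w : U (v + w) = U v + U w.
  by rewrite -big_split; apply: eq_bigr => j _; rewrite mxE rmorphD mulrDl.
have UZ a v : U (a *: v) = astr T' a * U v.
  by rewrite mulr_sumr; apply: eq_bigr => j _; rewrite mxE rmorphM mulrA.
have U0 : U 0 = 0 by rewrite -(scale0r 0) UZ rmorph0 mul0r.
have Uio x : U (io x) = g x.
  rewrite [x in RHS]be rmorph_sum; apply: eq_bigr => j _.
  by rewrite mxE rmorphM hmapE.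
have [||||u uE] := @mk_hom A' B' T' (fun x => U (sval (x : C))).
- by move=> x y; rewrite svD UD.
- by rewrite ioE Uio rmorph1.
- move=> x y; rewrite svM RE (big_morph U UD U0) [in RHS]/U mulr_suml.
  apply: eq_bigr => j _; rewrite (big_morph U UD U0) mulr_sumr.
  apply: eq_bigr => l _; rewrite UZ Uio !rmorphM -!mulrA; congr (_ * _).
  by rewrite [in RHS]mulrCA.
- by move=> s; rewrite svq UZ Uio rmorph1 mulr1.
have uig : hcomp (resHom phi u) i = g.
  by apply: hom_ext => x /=; rewrite uE iE ioE Uio.
exists u; split=> // u' u'ig; apply: hom_ext => X.
rewrite [X]expand !rmorph_sum; apply: eq_bigr => j _.
rewrite !rmorphM !hmapE; congr (_ * _).
have := f_equal (fun h : hom B (resAlg phi T') => h (b j)) uig.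
by rewrite -u'ig.
- move=> g lg; exists (fun X : B' => \sum_j sval (X : C) 0 j * phi (g (b j))).
    split=> [x y|a x].
      by rewrite -big_split; apply: eq_bigr => j _; rewrite svD mxE mulrDl.
    by rewrite mulr_sumr; apply: eq_bigr => j _; rewrite qM mxE mulrA.
  move=> x; rewrite iE ioE [x in RHS]be (lf_sum lg) rmorph_sum; apply: eq_bigr => j _.
  by rewrite mxE (lfZ lg) rmorphM.
Qed.

Lemma pushout_fet (B : alg A) (B' : alg A') (i : hom B (resAlg phi B')) :
  fet B -> is_pushout i -> fet B'.
Proof.
move=> HB Hi; have [P [j [HP Hj _]]] := pushout_ex i HB.
have [u ui] := pushout_lift Hi j; have [v vj] := pushout_lift Hj i.
apply: (@fet_retract A' P B' v u) => // [x y|a x|x].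
- by rewrite rmorphD.
- by rewrite rmorphM hmapE.
have : hcomp v u = hid B'.
  apply: (pushout_uniq Hi); apply: hom_ext => y /=.
  have := f_equal (fun h : hom B (resAlg phi P) => h y) ui; rewrite /= => ->.
  by have := f_equal (fun h : hom B (resAlg phi B') => h y) vj.
by move/(f_equal (fun h : hom B' B' => h x)).
Qed.

End Pushout.

Lemma fet_triv (A : comNzRingType) : fet (triv A).
Proof.
have U (M : nmodType) (F : unit -> M) : \sum_i F i = F tt.
  by rewrite (big_pred1 tt) // => -[].
apply/fetP; split.
  exists unit, (fun=> 1), (fun _ x => x); split=> [_|x]; first by split.
  by rewrite U /= mulr1.
exists unit, (fun=> 1), (fun=> 1); split=> [f lf x|]; rewrite !U ?mulr1 //=.
by rewrite -[x in LHS]mulr1 (lfZ lf) mulrC.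
Qed.

Lemma fet_comp (A : comNzRingType) (B : alg A) (C : alg B) :
  fet B -> fet C -> fet (resAlg (astr B) C).
Proof.
move=> /fetP[[I [b [f [lf bf]]]] [J [u [v [bal uv1]]]]].
move=> /fetP[[I' [b' [f' [lf' bf']]]] [J' [u' [v' [bal' uv1']]]]].
apply/fetP; split.
  exists (I * I')%type, (fun ij => astr C (b ij.1) * b' ij.2),
    (fun ij x => f ij.1 (f' ij.2 x)); split=> [[i i']|x] /=.
    split=> [x y|a x] /=; first by rewrite (lfD (lf' i')) (lfD (lf i)).
    by rewrite (lfZ (lf' i')) (lfZ (lf i)).
  rewrite -(pair_bigA _ (fun i i' => astr C (astr B (f i (f' i' x))) *
    (astr C (b i) * b' i'))) exchange_big /= {1}[x]bf'; apply: eq_bigr => i' _.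
  rewrite {1}[f' i' x]bf rmorph_sum mulr_suml; apply: eq_bigr => i _.
  by rewrite rmorphM mulrA.
exists (J * J')%type, (fun ij => astr C (u ij.1) * u' ij.2),
   (fun ij => astr C (v ij.1) * v' ij.2); split=> [g lg x|] /=; last first.
  rewrite -(pair_bigA _ (fun i i' => astr C (u i) * u' i' * (astr C (v i) * v' i'))).
  rewrite /= exchange_big /= -[RHS]uv1'; apply: eq_bigr => i' _.
  under eq_bigr => i _ do rewrite mulrACA -rmorphM.
  by rewrite -mulr_suml -rmorph_sum uv1 rmorph1 mul1r.
(* Balancing of C over B asks for a B-linear form with values in B; averaging the A-linear [g] with
   the separability idempotent of B produces one. *)
pose P y := \sum_j astr B (g (astr C (u j) * y)) * v j.
have lP : linear_form P.
  split=> [y z|c y].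
    rewrite -big_split; apply: eq_bigr => j _.
    by rewrite mulrDr (lfD lg) rmorphD mulrDl.
  have lgy : linear_form (fun s => g (astr C s * y)).
    split=> [s t|s t]; first by rewrite rmorphD mulrDl (lfD lg).
    by rewrite rmorphM -mulrA; exact: (lfZ lg).
  have := bal _ lgy c; rewrite mulr_sumr => E.
  transitivity (\sum_j astr B (g (astr C (c * u j) * y)) * v j).
    by apply: eq_bigr => j _; rewrite rmorphM [astr C c * astr C _]mulrC mulrA.
  by rewrite E; apply: eq_bigr => j _; rewrite mulrCA.
transitivity (\sum_l astr C (P (x * u' l)) * v' l).
  rewrite -(pair_bigA _ (fun i i' => astr C (astr B (g (x * (astr C (u i) * u' i'))))
     * (astr C (v i) * v' i'))) exchange_big /=.
  apply: eq_bigr => l _; rewrite rmorph_sum mulr_suml; apply: eq_bigr => j _.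
  by rewrite rmorphM mulrA [x * (_ * _)]mulrCA.
rewrite (bal' _ lP) -(pair_bigA _ (fun i i' => astr C (astr B (g (astr C (u i) * u' i')))
     * (x * (astr C (v i) * v' i')))) exchange_big /=.
apply: eq_bigr => l _; rewrite rmorph_sum mulr_suml; apply: eq_bigr => j _.
by rewrite rmorphM /=; ring.
Qed.

(** A separability idempotent of C over A also works over B. For projectivity, a coordinate form f'
    of C over A becomes B-linear as x |-> \sum_j f'(x u_j) v_j, with the idempotent of B over A. *)
Lemma fet_cancel (A : comNzRingType) (B C : alg A) (g : hom B C) :
  fet B -> fet C -> fet (Alg (hmap g)).
Proof.
move=> /fetP[[I [b [f [lf bf]]]] [J [u [v [bal uv1]]]]].
move=> /fetP[[I' [b' [f' [lf' bf']]]] [J' [u' [v' [bal' uv1']]]]].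
apply/fetP; split; last first.
  exists J', u', v'; split=> // h lh x.
  have lfl i : @linear_form A C (fun y => f i (h y)).
    split=> [y z|a y]; first by rewrite (lfD lh) (lfD (lf i)).
    by rewrite -(hmapE g) (lfZ lh) (lfZ (lf i)).
  have E (y z : C) : g (h y) * z = \sum_i g (b i) * (astr C (f i (h y)) * z).
    rewrite {1}[h y]bf rmorph_sum mulr_suml; apply: eq_bigr => i _.
    by rewrite rmorphM /= hmapE mulrCA mulrA.
  under eq_bigr => j _ do rewrite E.
  under [RHS]eq_bigr => j _ do rewrite /= E.
  rewrite exchange_big [RHS]exchange_big; apply: eq_bigr => i _ /=.
  by rewrite -!mulr_sumr (bal' _ (lfl i) x).
exists I', b', (fun i x => \sum_j astr B (f' i (x * g (u j))) * v j); split=> [i|x].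
  have lfx x : @linear_form A B (fun s => f' i (x * g s)).
    split=> [s t|s t]; first by rewrite rmorphD mulrDr (lfD (lf' i)).
    by rewrite rmorphM hmapE mulrCA (lfZ (lf' i)).
  split=> [x y|c x].
    rewrite -big_split; apply: eq_bigr => j _.
    by rewrite mulrDl (lfD (lf' i)) rmorphD mulrDl.
  rewrite mulr_sumr; have E := bal _ (lfx x) c.
  transitivity (\sum_j astr B (f' i (x * g (c * u j))) * v j).
    by apply: eq_bigr => j _; rewrite rmorphM /= mulrCA mulrA.
  by rewrite E; apply: eq_bigr => j _; rewrite mulrCA.
under eq_bigr => i _ do rewrite /= rmorph_sum mulr_suml.
rewrite exchange_big /= -{1}[x]mulr1 -(rmorph1 (hmap g)) -uv1 rmorph_sum mulr_sumr.
apply: eq_bigr => j _; rewrite rmorphM mulrA {1}[x * _]bf' mulr_suml.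
by apply: eq_bigr => i _; rewrite rmorphM /= hmapE mulrAC.
Qed.

(** * Connected covers and paths *)

Lemma idem_opp (R : comNzRingType) (e : R) : e * e = e -> (1 - e) * (1 - e) = 1 - e.
Proof. by move=> ee; rewrite mulrBr mulr1 mulrBl mul1r ee subrr subr0. Qed.

Lemma surj_epi (A : comNzRingType) (B C T : alg A) (q : hom B C) (u v : hom C T) :
  (forall c, exists x, q x = c) -> hcomp u q = hcomp v q -> u = v.
Proof.
move=> qs uv; apply: hom_ext => c; have [x <-] := qs c.
exact: (f_equal (fun h : hom B T => h x) uv).
Qed.

Section Components.
Variables (A : comNzRingType) (w : geomPt A).
Hypothesis cA : conn A.

Let fibre_le (B : alg A) n := forall m (h : 'I_m -> hom B w), injective h -> (m <= n)%N.

(** The complementary factor is nonzero, so it has a point above [w], which the proper factor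
    misses. This drives the inductions on the size of the fibre. *)
Let factor_fibre (B C : alg A) (e : B) (q : hom B C) n :
  fet B -> e * e = e -> e <> 1 -> (forall c, exists x, q x = c) ->
  (forall x, q x = 0 <-> x * e = 0) -> fibre_le B n.+1 -> fibre_le C n.
Proof.
move=> HB ee e1 qs qe Bn m h hi.
have e1' : 1 - e != 0 by rewrite subr_eq0; apply/eqP => /esym.
have [C1 [q1 [HC1 q1s q1e]]] := fet_factor HB (idem_opp ee) e1'.
have [c1 _] := fibre_ne w cA HC1.
have c1e : hcomp c1 q1 e = 0.
  rewrite /=; have -> : q1 e = 0 by apply/q1e; rewrite mulrBr mulr1 ee subrr.
  by rewrite rmorph0.
have he i : hcomp (h i) q e = 1 by rewrite /= (factor_idem1 ee qe) rmorph1.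
rewrite -ltnS; apply: (Bn m.+1
  (fun i => if unlift ord0 i is Some j then hcomp (h j) q else hcomp c1 q1)).
move=> i j; case: unliftP => [i'|] ->; case: unliftP => [j'|] -> //.
- by move/(surj_epi qs)/hi->.
- move/(f_equal (fun g : hom B w => g e)); rewrite he c1e => /eqP.
  by rewrite oner_eq0.
- move/(f_equal (fun g : hom B w => g e)); rewrite he c1e => /esym/eqP.
  by rewrite oner_eq0.
Qed.

Let nconn (B : alg A) : ~ conn B -> exists e : B, [/\ e * e = e, e <> 0 & e <> 1].
Proof.
move=> nc; apply: contrapT => no; apply: nc => e ee.
have [|e0] := pselect (e = 0); first by left.
by have [|e1] := pselect (e = 1); [right|case: no; exists e].
Qed.

Lemma component (B : alg A) (h : hom B w) : fet B ->
  exists (C : alg A) (q : hom B C) (c : hom C w),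
    [/\ fet C, conn C & hcomp c q = h].
Proof.
move=> HB; have [n] := fibre_bound w HB; elim: n B h HB => [|n IH] B h HB Bn.
  suff : (1 <= 0)%N by [].
  by apply: (Bn 1%N (fun=> h)) => i j _; rewrite !ord1.
have [cB|/nconn[e [ee e0 e1]]] := pselect (conn B).
  by exists B, (hid B), h; rewrite hcomp1.
have split_e (e' : B) : e' * e' = e' -> e' <> 1 -> h e' = 1 ->
    exists (C : alg A) (q : hom B C) (c : hom C w),
    [/\ fet C, conn C & hcomp c q = h].
  move=> ee' e1' he'.
  have e0' : e' != 0.
    by apply/eqP => e'0; move/eqP: he'; rewrite e'0 rmorph0 eq_sym oner_eq0.
  have [C1 [q1 [HC1 q1s q1e]]] := fet_factor HB ee' e0'.
  have [c1 c1h] := factor_lift q1s q1e he'.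
  have [C [q [c [HC cC cq]]]] := IH C1 c1 HC1 (factor_fibre HB ee' e1' q1s q1e Bn).
  by exists C, (hcomp q q1), c; rewrite hcompA cq.
have /orP[/eqP he|/eqP he] : (h e == 0) || (h e == 1).
  rewrite -[_ == 1]subr_eq0 -mulf_eq0 mulrBr mulr1 -rmorphM ee subrr //.
  apply: (split_e (1 - e)); rewrite ?idem_opp // ?rmorphB ?rmorph1 ?he ?subr0 //.
  by move=> H; apply: e0; rewrite -[e](subKr 1) H subrr.
exact: split_e ee e1 he.
Qed.

(** A nontrivial idempotent splits B into two factors with smaller fibres, so connected factors are
    reached after finitely many splittings. *)
Lemma zero_test (B : alg A) (x : B) : fet B ->
  (forall (C : alg A) (q : hom B C), fet C -> conn C -> q x = 0) -> x = 0.
Proof.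
move=> HB; have [n] := fibre_bound w HB; elim: n B x HB => [|n IH] B x HB Bn xq.
  have [h _] := fibre_ne w cA HB.
  suff : (1 <= 0)%N by [].
  by apply: (Bn 1%N (fun=> h)) => i j _; rewrite !ord1.
have [cB|/nconn[e [ee e0 e1]]] := pselect (conn B).
  exact: (xq B (hid B)).
have split_e (e' : B) : e' * e' = e' -> e' <> 0 -> e' <> 1 -> x * e' = 0.
  move=> ee' /eqP e0' e1'.
  have [C1 [q1 [HC1 q1s q1e]]] := fet_factor HB ee' e0'.
  apply/q1e/(IH C1 _ HC1 (factor_fibre HB ee' e1' q1s q1e Bn)) => C q HC cC.
  exact: (xq C (hcomp q q1)).
rewrite -[x]mulr1 -[1](subrK e) mulrDr split_e ?idem_opp // ?add0r ?split_e //.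
  by move/eqP; rewrite subr_eq0 => /eqP/esym.
by move=> H; apply: e0; rewrite -[e](subKr 1) H subrr.
Qed.

(** E is the component through the point (h1, h2) of the fibre product of the two covers. This
    product is the base change of B2 along A -> B1, and [h2] witnesses that it is nonzero. *)
Lemma dominate (B1 B2 : alg A) (h1 : hom B1 w) (h2 : hom B2 w) :
  fet B1 -> fet B2 -> exists (E : alg A) (g1 : hom B1 E) (g2 : hom B2 E) (x : hom E w),
    [/\ fet E, conn E, hcomp x g1 = h1 & hcomp x g2 = h2].
Proof.
move=> HB1 HB2.
pose w1 : alg B1 := Alg (hmap h1).
have [||h2' h2'E] := @mk_hom A B2 (resAlg (astr B1) w1) h2 (rmorphD _) (rmorph1 _).
- exact: rmorphM.
- by move=> s; rewrite /= hmapE hmapE.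
have [P [i [HP Pi _]]] := pushout_ex h2' HB2.
have [u ui] := pushout_lift Pi h2'.
have [||g1 g1E] := @mk_hom A B1 (resAlg (astr B1) P) (astr P) (rmorphD _) (rmorph1 _).
- exact: rmorphM.
- by [].
have [||x xE] := @mk_hom A (resAlg (astr B1) P) w u (rmorphD _) (rmorph1 _).
- exact: rmorphM.
- by move=> s; rewrite /= hmapE /= hmapE.
have [E [q [y [HE cE yq]]]] := component x (fet_comp HB1 HP).
exists E, (hcomp q g1), (hcomp q i), y; split=> //; rewrite hcompA yq.
  by apply: hom_ext => s /=; rewrite xE g1E hmapE.
apply: hom_ext => s /=; rewrite xE -h2'E.
exact: (f_equal (fun h : hom B2 (resAlg (astr B1) w1) => h s) ui).
Qed.

End Components.

(** * Existence of paths by ultraproducts *)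

Section Paths.
Variables (A : comNzRingType) (w1 w2 : geomPt A).
Hypothesis cA : conn A.
Variables (B0 : alg A) (h1 : hom B0 w1) (h2 : hom B0 w2).
Hypotheses (HB0 : fet B0) (cB0 : conn B0).

(** The connected covers of A pointed above [w1] and dominating (B0, h1): the index type of the
    ultraproduct. *)
Record cover := Cover {
  cov :> alg A;
  cov_pt : hom cov w1;
  cov_map : hom B0 cov;
  covP : [/\ fet cov, conn cov & hcomp cov_pt cov_map = h1] }.

(** E is finite etale over the connected B0 by [fet_cancel], so it has a point above [h2]. *)
Let cov_z (E : cover) : exists z : hom E w2, hcomp z (cov_map E) = h2.
Proof.
have [HE cE _] := covP E.
pose w2' : geomPt B0 := GeomPt (hmap h2).
have [z _] := fibre_ne w2' cB0 (fet_cancel (cov_map E) HB0 HE).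
have [||z' z'E] := @mk_hom A E w2 z (rmorphD _) (rmorph1 _).
- exact: rmorphM.
- move=> s; rewrite -(hmapE (cov_map E)) -[astr w2 s](hmapE h2).
  exact: (hmapE z).
exists z'; apply: hom_ext => s /=; rewrite z'E; exact: (hmapE z).
Qed.

Record pointed := Pointed {
  pobj :> alg A;
  ppt : hom pobj w1;
  pfet : fet pobj }.

Let cone (C : pointed) (E : cover) := exists k : hom C E, hcomp (cov_pt E) k = ppt C.

(** When E dominates (B, h), the point h is a map k : B -> E followed by the base point of E; its
    candidate image is k followed by the chosen point [z E]. As E varies, an ultrafilter containing
    all cones selects one of the finitely many candidates. *)
Lemma weak_path_ex : exists t : forall B : alg A, fet B -> hom B w1 -> hom B w2,
  [/\ forall (B C : alg A) (HB : fet B) (HC : fet C) (g : hom B C) (h : hom C w1),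
        t B HB (hcomp h g) = hcomp (t C HC h) g,
      forall (B : alg A) (HB : fet B), injective (t B HB) &
      t B0 HB0 h1 = h2].
Proof.
pose z E := projT1 (cid (cov_z E)).
have zE E : hcomp (z E) (cov_map E) = h2 := projT2 (cid (cov_z E)).
have cone_ne C : exists E, cone C E.
  have [E [g1 [g2 [x [HE cE xg1 xg2]]]]] := dominate cA (ppt C) h1 (pfet C) HB0.
  by exists (Cover (And3 HE cE xg2)), g1.
have cone_dir C1 C2 : exists C, forall E, cone C E -> cone C1 E /\ cone C2 E.
  have [E [g1 [g2 [x [HE cE xg1 xg2]]]]] := dominate cA (ppt C1) (ppt C2) (pfet C1) (pfet C2).
  exists (Pointed x HE) => F [k /= kx]; split.
    by exists (hcomp k g1); rewrite hcompA kx.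
  by exists (hcomp k g2); rewrite hcompA kx.
have [U [Ucap Ucone Uup Uor]] := ultra_ex (Pointed h1 HB0) cone_ne cone_dir.
pose hit (B : alg A) (h : hom B w1) (x : hom B w2) (E : cover) :=
  exists k : hom B E, hcomp (cov_pt E) k = h /\ hcomp (z E) k = x.
have kuniq (B : alg A) (HB : fet B) (E : cover) (k k' : hom B E) :
    hcomp (cov_pt E) k = hcomp (cov_pt E) k' -> k = k'.
  by move=> kk; case: (covP E) => HE cE _; apply: hom_conn_eqw kk.
have ex (B : alg A) (HB : fet B) (h : hom B w1) : exists x, U (hit B h x).
  have [m [p [p' pK p'K]]] := fibre_finT w2 HB.
  have [||||i Ui] := @ultra_fin _ U m (fun i => hit B h (p i)); last by exists (p i).
  - by move=> T UT; have [i [Ti _]] := Ucap _ _ UT UT; exists i.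
  - exact: Uor.
  - exact: Uup.
  - apply: Uup (Ucone (Pointed h HB)) _ => E [k /= kh].
    by exists (p' (hcomp (z E) k)), k; rewrite p'K.
have un (B : alg A) (HB : fet B) (h : hom B w1) x y :
    U (hit B h x) -> U (hit B h y) -> x = y.
  move=> Ux Uy; have [E [[k [kh <-]] [k' [k'h <-]]]] := Ucap _ _ Ux Uy.
  by rewrite (kuniq _ HB E k k') // kh k'h.
pose t B HB h := projT1 (cid (ex B HB h)).
have tP B HB h : U (hit B h (t B HB h)) := projT2 (cid (ex B HB h)).
exists t; split.
- move=> B C HB HC g h; apply: (un B HB (hcomp h g)) => //.
  apply: Uup (tP C HC h) _ => E [k [kh kz]].
  by exists (hcomp k g); rewrite !hcompA kh kz.
- move=> B HB h h' tt.
  have := tP B HB h; rewrite tt => Uh.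
  have [E [[k [kh kz]] [k' [k'h k'z]]]] := Ucap _ _ Uh (tP B HB h').
  have [HE cE _] := covP E.
  have kk : k = k' by apply: (hom_conn_eqw (q := z E) HB cE); rewrite kz k'z.
  by rewrite -kh kk.
- apply: (un B0 HB0 h1) => //; apply: Uup (Ucone (Pointed h1 HB0)) _ => E _.
  by exists (cov_map E); rewrite zE; case: (covP E).
Qed.

End Paths.

(** The ultraproduct gives injective transports from [w1] to [w2] and back; as the fibres are
    finite, they are bijective. *)
Lemma path_ex (A : comNzRingType) (w1 w2 : geomPt A) (B : alg A) (HB : fet B)
  (h1 : hom B w1) (h2 : hom B w2) : conn A -> conn B ->
  exists t : path w1 w2, t B HB h1 = h2.
Proof.
move=> cA cB; have [t [tn ti th]] := weak_path_ex cA h1 h2 HB cB.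
have [t' [_ ti' _]] := weak_path_ex cA h2 h1 HB cB.
have tb C (HC : fet C) : bijective (t C HC).
  by apply: (finT_inj_bij (fibre_finT w1 HC) (fibre_finT w2 HC) (ti C HC) (ti' C HC)).
by exists (Path tn tb).
Qed.

Lemma path_exists (A : comNzRingType) (w1 w2 : geomPt A) : conn A ->
  exists t : path w1 w2, True.
Proof.
move=> cA; have h (w : geomPt A) : hom (triv A) w.
  exact: (@Hom A (triv A) w (gmap w) (fun=> erefl)).
by have [t _] := path_ex (fet_triv A) (h w1) (h w2) cA cA; exists t.
Qed.

(** * Torsors under finite abelian groups *)

Section PushPath.
Variables (A A' : comNzRingType) (phi : {rmorphism A -> A'}) (w' : geomPt A').
Variable s' : path w' w'.

Let moves (B : alg A) (h k : hom B (geomIm phi w')) :=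
  exists (B' : alg A') (HB' : fet B') (g : hom B (resAlg phi B')) (h' : hom B' w'),
    hcomp (resHom phi h') g = h /\ k = hcomp (resHom phi (s' B' HB' h')) g.

(** This is the functoriality of pi_1. A point above the image of [w'] factors through the base
    change of B to A', where [s'] acts. [moves] records the result for any factorisation, and the
    universal property shows that it depends on the point alone. *)
Lemma push_path_ex : exists s : path (geomIm phi w') (geomIm phi w'),
  forall (B : alg A) (HB : fet B) (B' : alg A') (HB' : fet B')
    (g : hom B (resAlg phi B')) (h' : hom B' w'),
    s B HB (hcomp (resHom phi h') g) = hcomp (resHom phi (s' B' HB' h')) g.
Proof.
have univ (B : alg A) (HB : fet B) (P : alg A') (HP : fet P)
    (i : hom B (resAlg phi P)) (Pi : is_pushout i) (l : hom P w') k :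
    moves (hcomp (resHom phi l) i) k -> k = hcomp (resHom phi (s' P HP l)) i.
  move=> [B' [HB' [g [h' [E ->]]]]].
  have [u ug] := pushout_lift Pi g.
  have -> : l = hcomp h' u.
    apply: (pushout_uniq Pi); rewrite -E -ug; exact: hom_ext.
  by rewrite (pfun_nat s' HP HB') -ug; apply: hom_ext.
have ex (B : alg A) (HB : fet B) (h : hom B (geomIm phi w')) : exists k, moves h k.
  have [P [i [HP Pi _]]] := pushout_ex (T0 := w') h HB.
  have [l <-] := pushout_lift Pi (h : hom B (resAlg phi w')).
  by exists (hcomp (resHom phi (s' P HP l)) i), P, HP, i, l.
pose t B HB h := projT1 (cid (ex B HB h)).
have tP B HB h : moves h (t B HB h) := projT2 (cid (ex B HB h)).
have uniq (B : alg A) (HB : fet B) (h k k' : hom B (geomIm phi w')) :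
    moves h k -> moves h k' -> k = k'.
  have [P [i [HP Pi _]]] := pushout_ex (T0 := w') h HB.
  have [l <-] := pushout_lift Pi (h : hom B (resAlg phi w')).
  by move=> /(univ B HB P HP i Pi) -> /(univ B HB P HP i Pi) ->.
have tn (B C : alg A) (HB : fet B) (HC : fet C) (g : hom B C)
    (h : hom C (geomIm phi w')) : t B HB (hcomp h g) = hcomp (t C HC h) g.
  apply: (uniq B HB (hcomp h g)) => //.
  have [B' [HB' [j [l [E ->]]]]] := tP C HC h.
  by exists B', HB', (hcomp j g), l; rewrite -E; split; apply: hom_ext.
have ti (B : alg A) (HB : fet B) : injective (t B HB).
  move=> h1 h2; have [P [i [HP Pi _]]] := pushout_ex (T0 := w') h1 HB.
  have [l1 E1] := pushout_lift Pi (h1 : hom B (resAlg phi w')).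
  have [l2 E2] := pushout_lift Pi (h2 : hom B (resAlg phi w')).
  have tE (l : hom P w') : t B HB (hcomp (resHom phi l) i) = hcomp (resHom phi (s' P HP l)) i.
    by apply: univ => //; apply: tP.
  rewrite -E1 -E2 !tE => E; have ss := pushout_uniq (T := w') Pi E.
  by rewrite (path_inj ss).
have tb (B : alg A) (HB : fet B) : bijective (t B HB).
  exact: (finT_self_bij (fibre_finT (geomIm phi w') HB) (ti B HB)).
exists (Path tn tb) => B HB B' HB' g h' /=.
apply: (uniq B HB (hcomp (resHom phi h') g)) => //.
by exists B', HB', g, h'.
Qed.
End PushPath.

Section Torsors.
Variables (Gam : finType) (gadd : Gam -> Gam -> Gam).

(** Simple transitivity is expressed on geometric fibres. As [gadd] is a bare binary operation here,
    commutativity is imposed on the action itself. *)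
Record torsor (A : comNzRingType) (B : alg A) (act : Gam -> hom B B) : Prop := Torsor {
  tor_fet : fet B;
  torD : forall c d, hcomp (act c) (act d) = act (gadd c d);
  torC : forall c d, hcomp (act c) (act d) = hcomp (act d) (act c);
  tor_st : forall (w : geomPt A) (h h' : hom B w), exists! c, h' = hcomp h (act c) }.

Lemma tor_ex (A : comNzRingType) (B : alg A) (act : Gam -> hom B B) (w : geomPt A)
  (h h' : hom B w) : torsor act -> exists c, h' = hcomp h (act c).
Proof. by move=> TB; have [c [Hc _]] := tor_st TB h h'; exists c. Qed.

Lemma tor_inj (A : comNzRingType) (B : alg A) (act : Gam -> hom B B) (w : geomPt A)
  (h : hom B w) c d : torsor act -> hcomp h (act c) = hcomp h (act d) -> c = d.
Proof.
move=> TB E; have [e [_ eU]] := tor_st TB h (hcomp h (act c)).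
by rewrite -(eU c erefl) (eU d E).
Qed.

Lemma torsor_pushout (A A' : comNzRingType) (phi : {rmorphism A -> A'})
  (B : alg A) (B' : alg A') (i : hom B (resAlg phi B')) (act : Gam -> hom B B) :
  torsor act -> is_pushout i -> exists act' : Gam -> hom B' B',
    torsor act' /\ forall c, hcomp (resHom phi (act' c)) i = hcomp i (act c).
Proof.
move=> TB Pi.
have /choice[act' aE] c := pushout_lift Pi (hcomp i (act c)).
have aE2 c d : hcomp (resHom phi (hcomp (act' c) (act' d))) i = hcomp i (hcomp (act c) (act d)).
  by rewrite hcompA -aE -hcompA -aE; apply: hom_ext.
exists act'; split=> //; split.
- exact: pushout_fet (tor_fet TB) Pi.
- by move=> c d; apply: (pushout_uniq Pi); rewrite aE2 aE (torD TB).
- by move=> c d; apply: (pushout_uniq Pi); rewrite !aE2 (torC TB).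
- move=> w' h h'.
  have E c : hcomp (resHom phi (hcomp h (act' c))) i
      = hcomp (hcomp (resHom phi h) i) (act c) :> hom B (resAlg phi w').
    by rewrite -hcompA -aE; apply: hom_ext.
  have [c [Hc cU]] := tor_st TB (w := geomIm phi w')
    (hcomp (resHom phi h) i) (hcomp (resHom phi h') i).
  exists c; split; first by apply: (pushout_uniq Pi); rewrite E.
  by move=> d hd; apply: cU; rewrite hd; exact: E.
Qed.

Variables (l : nat) (Q : padicClosure l).

Definition is_char (chi : Gam -> Q) : Prop :=
  (forall c, chi c != 0) /\ forall c d, chi (gadd c d) = chi c * chi d.

(** [L] is the local system obtained from the torsor by the character [chi]: a loop that translates
    a point of the fibre by [c] acts on [L] as chi(c). *)
Definition char_of (A : comNzRingType) (w : geomPt A) (B : alg A)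
    (act : Gam -> hom B B) (L : locsys Q w) (chi : Gam -> Q) : Prop :=
  forall (HB : fet B) (s : path w w) (h : hom B w) c,
    s B HB h = hcomp h (act c) -> L s = chi c.

Section OneTorsor.
Variables (A : comNzRingType) (w : geomPt A) (B : alg A) (act : Gam -> hom B B).
Hypotheses (cA : conn A) (TB : torsor act).
Let HB := tor_fet TB.

(** Any other point is a translate h d; the loop is natural for [act d], and [act d] commutes with
    [act c]. *)
Lemma path_torsor (s : path w w) (h h' : hom B w) c :
  s B HB h = hcomp h (act c) -> s B HB h' = hcomp h' (act c).
Proof.
move=> sh; have [d ->] := tor_ex h h' TB.
by rewrite (pfun_nat s HB HB) sh -!hcompA (torC TB).
Qed.

Lemma locsys_of_char (chi : Gam -> Q) : is_char chi ->
  exists L : locsys Q w, char_of act L chi.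
Proof.
move=> [chi0 chiM]; have [h0 _] := fibre_ne w cA HB.
have ex (s : path w w) : exists c, s B HB h0 = hcomp h0 (act c).
  exact: tor_ex.
pose L s := chi (projT1 (cid (ex s))).
have LE (s : path w w) h c : s B HB h = hcomp h (act c) -> L s = chi c.
  move=> /(path_torsor h0) E; rewrite /L; case: cid => d /=.
  by rewrite E => /(tor_inj TB) ->.
have L0 s : L s != 0 by exact: chi0.
have LM (s t r : path w w) :
   (forall (B : alg A) (HB : fet B) h, r B HB h = s B HB (t B HB h)) -> L r = L s * L t.
  move=> E; have [c sc] := ex s; have [d td] := ex t.
  rewrite (LE s _ c sc) (LE t _ d td) -chiM; apply: (LE r h0).
  by rewrite E td (pfun_nat s HB HB) sc -hcompA (torD TB).
have L1 (s : path w w) : s B HB h0 = h0 -> L s = 1.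
  move=> sh; have : L s * L s = L s.
    have [c sc] := ex s; rewrite (LE _ _ _ sc) -chiM -(LE _ _ _ sc).
    by apply/esym/(LE s h0); rewrite -(torD TB) hcompA -sc sh -sc sh.
  move/eqP; rewrite -subr_eq0 -{3}[L s]mulr1 -mulrBr mulf_eq0 (negPf (L0 s)) /=.
  by rewrite subr_eq0 => /eqP.
have Lc (M : rat) : exists (k : nat) (B : 'I_k -> alg A) (HB : forall i, fet (B i)),
    forall s : path w w, (forall i h, s (B i) (HB i) h = h) ->
      near (@pval l Q) M (L s) 1.
  by exists 1%N, (fun=> B), (fun=> HB) => s /(_ ord0 h0)/L1 ->; left.
exists (Locsys L0 LM Lc) => HB' s h c; rewrite (Prop_irrelevance HB' HB); exact: LE.
Qed.

Lemma char_of_uniq (L L' : locsys Q w) chi :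
  char_of act L chi -> char_of act L' chi -> L = L'.
Proof.
move=> H H'; apply: locsys_ext => s; have [h0 _] := fibre_ne w cA HB.
have [c sc] := tor_ex h0 (s B HB h0) TB.
by rewrite (H _ _ _ _ sc) (H' _ _ _ _ sc).
Qed.

Lemma char_of_eq (L : locsys Q w) chi chi' :
  char_of act L chi -> (forall c, chi c = chi' c) -> char_of act L chi'.
Proof. by move=> H E HB' s h c sh; rewrite -E; apply: H sh. Qed.

Hypothesis cB : conn B.

Lemma tor_path (h : hom B w) c : exists s : path w w, s B HB h = hcomp h (act c).
Proof. exact: path_ex. Qed.

(** On a connected torsor every element [c] is realised by a loop. *)
Lemma char_of_inj (L : locsys Q w) chi chi' :
  char_of act L chi -> char_of act L chi' -> forall c, chi c = chi' c.
Proof.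
move=> H H' c; have [h0 _] := fibre_ne w cA HB; have [s sh] := tor_path h0 c.
by rewrite -(H _ _ _ _ sh) -(H' _ _ _ _ sh).
Qed.

Lemma char_of_tensor (L1 L2 L3 : locsys Q w) chi1 chi2 :
  isTensor L1 L2 L3 -> char_of act L1 chi1 -> char_of act L2 chi2 ->
  char_of act L3 (fun c => chi1 c * chi2 c).
Proof.
by move=> E H1 H2 HB' s h c sh; rewrite E (H1 _ _ _ _ sh) (H2 _ _ _ _ sh).
Qed.

(** Loops are transitive on the fibre of the connected cover, so a function of weight [L] never
    vanishes, and chi(c) is the ratio of its values at h0 and at h0 c. Conversely the function h0 k
    |-> chi(k)^-1 has weight [L]. *)
Lemma summand_char (L : locsys Q w) :
  isSummand B L <-> exists2 chi, is_char chi & char_of act L chi.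
Proof.
split=> [[HB' [v [[h0 v0] vE]]]|[chi [chi0 chiM] H]].
  rewrite (Prop_irrelevance HB' HB) in vE.
  pose chi c := v h0 / v (hcomp h0 (act c)).
  have vS (s : path w w) (h : hom B w) c : s B HB h = hcomp h (act c) -> v h = L s * v (hcomp h (act c)).
    by move=> <-; apply: vE.
  have vne c : v (hcomp h0 (act c)) != 0.
    have [s sc] := tor_path h0 c; apply/eqP => E.
    by move/eqP: v0; rewrite (vS s h0 c sc) E mulr0.
  have LE HB1 (s : path w w) (h : hom B w) c :
      s B HB1 h = hcomp h (act c) -> L s = chi c.
    rewrite (Prop_irrelevance HB1 HB) => /(path_torsor h0) sc.
    by rewrite /chi {1}(vS s h0 c sc) mulfK.
  have char c : exists s : path w w, L s = chi c /\ s B HB h0 = hcomp h0 (act c).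
    by have [s sc] := tor_path h0 c; exists s; rewrite (LE _ _ _ _ sc).
  exists chi; last exact: LE.
  split=> [c|c d]; first by have [s [<- _]] := char c; apply: lchar_neq0.
  have [s [<- sc]] := char c; have [t [<- td]] := char d.
  rewrite -(@lcharM _ _ _ _ L s t (path_comp s t)) //.
  apply/esym/(LE HB _ h0) => /=.
  by rewrite td (pfun_nat s HB HB) sc -hcompA (torD TB).
have [h0 _] := fibre_ne w cA HB.
have /choice[k kE] h := tor_ex h0 h TB.
exists HB, (fun h => (chi (k h))^-1); split.
  by exists h0; rewrite invr_eq0.
move=> s h; have [c sc] := tor_ex h (s B HB h) TB.
rewrite (H _ _ _ _ sc); have -> : k (s B HB h) = gadd (k h) c.
  by apply: (tor_inj (h := h0) TB); rewrite -kE sc {1}(kE h) -hcompA (torD TB).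
by rewrite chiM invfM mulrCA mulfV ?mulr1.
Qed.
End OneTorsor.

Lemma pullback_char (A A' : comNzRingType) (phi : {rmorphism A -> A'})
  (w : geomPt A) (w' : geomPt A') (B : alg A) (B' : alg A')
  (act : Gam -> hom B B) (act' : Gam -> hom B' B') (g : hom B (resAlg phi B'))
  (L : locsys Q w) (L' : locsys Q w') chi :
  fet B -> (forall c, hcomp (resHom phi (act' c)) g = hcomp g (act c)) ->
  char_of act L chi -> isPullback phi L L' -> char_of act' L' chi.
Proof.
move=> HB gE H [tau Htau] HB' s' h' c sh'.
have [s [sE ->]] := Htau s'.
apply: (H HB s (tau B HB (hcomp (resHom phi h') g))).
rewrite (sE _ _ _ HB') sh' -(pfun_nat tau HB HB).
by congr (tau B HB _); rewrite -hcompA -gE; apply: hom_ext.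
Qed.

(** Any path [tau] between the base points will do: another choice conjugates [s], which does not
    change its translation on an abelian torsor. *)
Lemma char_pullback (A A' : comNzRingType) (phi : {rmorphism A -> A'})
  (w : geomPt A) (w' : geomPt A') (B : alg A) (B' : alg A')
  (act : Gam -> hom B B) (act' : Gam -> hom B' B') (g : hom B (resAlg phi B'))
  (L : locsys Q w) (L' : locsys Q w') chi :
  conn A -> conn A' -> torsor act -> torsor act' ->
  (forall c, hcomp (resHom phi (act' c)) g = hcomp g (act c)) ->
  char_of act L chi -> char_of act' L' chi -> isPullback phi L L'.
Proof.
move=> cA cA' TB TB' gE H H'.
have [tau _] := path_exists (geomIm phi w') w cA.
exists tau => s'; have [s0 s0E] := push_path_ex phi s'.
exists (path_comp tau (path_comp s0 (path_inv tau))).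
have sE C (HC : fet C) (C' : alg A') (HC' : fet C') (j : hom C (resAlg phi C'))
    (h' : hom C' w') : path_comp tau (path_comp s0 (path_inv tau)) C HC
      (tau C HC (hcomp (resHom phi h') j))
    = tau C HC (hcomp (resHom phi (s' C' HC' h')) j).
  by rewrite /= path_invK s0E.
split=> //.
have [h' _] := fibre_ne w' cA' (tor_fet TB').
have [c sc] := tor_ex h' (s' B' (tor_fet TB') h') TB'.
rewrite (H' _ _ _ _ sc); apply/esym.
apply: (H (tor_fet TB) _ (tau B (tor_fet TB) (hcomp (resHom phi h') g))).
rewrite (sE _ _ _ (tor_fet TB')) sc -(pfun_nat tau (tor_fet TB) (tor_fet TB)).
by congr (tau B _ _); rewrite -hcompA -gE; apply: hom_ext.
Qed.

End Torsors.

Lemma Fp_expp p (a : 'F_p) : prime p -> a ^+ p = a.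
Proof.
by move=> pp; rewrite -[a]natr_Zp -(pFrobenius_autE (pchar_Fp pp)) pFrobenius_aut_nat.
Qed.

(** * Frobenius at an F_p-point *)

Section Frobenius.
Variables (p : nat) (k : finClosure p) (A : comNzRingType) (x : {rmorphism A -> 'F_p}).
Hypothesis pp : prime p.

Lemma fc_pchar : p \in [pchar (fcf k)].
Proof. by rewrite (fmorph_pchar (fcin k)) pchar_Fp. Qed.

Let w0 := geomIm x (fcPt k).

(** The base point factors through F_p, whose elements are fixed by p-th powers; hence the p-th
    power of a point still lies above it. *)
Lemma frob_hom (B : alg A) (h' : hom B w0) :
  exists h : hom B w0, forall b, h b = h' b ^+ p.
Proof.
apply: (@mk_hom A B w0 (fun b => h' b ^+ p)).
- by move=> a b; rewrite rmorphD -!(pFrobenius_autE fc_pchar) pFrobenius_autD_comm //; apply: mulrC.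
- by rewrite rmorph1 expr1n.
- by move=> a b; rewrite rmorphM exprMn.
- by move=> a; rewrite hmapE /= -rmorphXn /= Fp_expp.
Qed.

(** Composition with Frobenius is natural and injective on the finite fibres, hence an automorphism
    of the fibre functor; the geometric Frobenius is its inverse. *)
Lemma frob_path_ex : exists s : path w0 w0, forall B (HB : fet B) (h h' : hom B w0),
  (forall b, hmap h b = hmap h' b ^+ p) -> s B HB h = h'.
Proof.
pose F (B : alg A) (h' : hom B w0) := projT1 (cid (frob_hom h')).
have FE (B : alg A) (h' : hom B w0) b : F B h' b = h' b ^+ p.
  exact: (projT2 (cid (frob_hom h'))).
have Fi (B : alg A) : injective (F B).
  move=> h h' E; apply: hom_ext => b; apply: (fmorph_inj (pFrobenius_aut fc_pchar)).
  by rewrite -[LHS]/(h b ^+ p) -[RHS]/(h' b ^+ p) -!FE E.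
have Fb (B : alg A) (HB : fet B) : bijective (F B).
  exact: (finT_self_bij (fibre_finT w0 HB) (Fi B)).
have Fn (B C : alg A) (HB : fet B) (HC : fet C) (g : hom B C) (h : hom C w0) :
    F B (hcomp h g) = hcomp (F C h) g.
  by apply: hom_ext => b; rewrite FE /= FE.
pose P : path w0 w0 := @Path A w0 w0 (fun B (_ : fet B) => F B) Fn Fb.
exists (path_inv P) => B HB h h' E; rewrite -[h'](path_invK P HB).
by congr (path_inv P B HB _); apply: hom_ext => b; rewrite E /= FE.
Qed.

Variables (Gam : finType) (gadd : Gam -> Gam -> Gam) (l : nat) (Q : padicClosure l).
Variables (w : geomPt A) (B : alg A) (act : Gam -> hom B B) (L : locsys Q w).
Variables (chi : Gam -> Q).

Lemma frobTrace_char (h h' : hom B w0) c t :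
  conn A -> torsor gadd act -> char_of act L chi ->
  (forall b, hmap h b = hmap h' b ^+ p) -> h' = hcomp h (act c) ->
  frobTrace k L x t <-> t = chi c.
Proof.
move=> cA TB HL hh' h'E.
have key (tau : path w0 w) (s : path w w) : (forall (B : alg A) (HB : fet B)
      (h h' : hom B w0), (forall b, hmap h b = hmap h' b ^+ p) ->
       s B HB (tau B HB h) = tau B HB h') -> L s = chi c.
  move=> sE; apply: (HL (tor_fet TB) s (tau B (tor_fet TB) h)).
  by rewrite (sE _ _ _ _ hh') h'E (pfun_nat tau (tor_fet TB) (tor_fet TB)).
split=> [[tau [s [sE ->]]]|->]; first exact: key sE.
have [tau _] := path_exists w0 w cA; have [s0 s0E] := frob_path_ex.
have sE (C : alg A) (HC : fet C) (j j' : hom C w0) :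
    (forall b, hmap j b = hmap j' b ^+ p) ->
    path_comp tau (path_comp s0 (path_inv tau)) C HC (tau C HC j) = tau C HC j'.
  by move=> jj'; rewrite /= path_invK (s0E _ _ _ _ jj').
by exists tau, (path_comp tau (path_comp s0 (path_inv tau))); split=> //; rewrite (key tau).
Qed.
End Frobenius.

(** * Coordinate rings *)

Lemma sub_ring_ex (R : comNzRingType) (P : R -> Prop) :
  P 1 -> (forall x y, P x -> P y -> P (x - y)) -> (forall x y, P x -> P y -> P (x * y)) ->
  exists (C : comNzRingType) (v : {rmorphism C -> R}),
    injective v /\ forall x, P x <-> exists c, v c = x.
Proof.
move=> P1 PB PM; pose T := {x : R | `[< P x >]}.
have P0 : P 0 by rewrite -(subrr 1); apply: PB.
have PN x : P x -> P (- x) by move=> Px; rewrite -sub0r; apply: PB.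
have PD x y : P x -> P y -> P (x + y).
  by move=> Px Py; rewrite -[y]opprK; apply: PB => //; apply: PN.
have svP (x : T) : P (sval x) by apply/asboolP; case: x.
pose mk x (Px : P x) : T := exist _ x (asboolT Px).
have Tinj (x y : T) : sval x = sval y -> x = y by move/val_inj.
pose add (x y : T) := mk _ (PD _ _ (svP x) (svP y)).
pose opp (x : T) := mk _ (PN _ (svP x)).
pose mul (x y : T) := mk _ (PM _ _ (svP x) (svP y)).
have addA : associative add by move=> x y z; apply: Tinj; rewrite /= addrA.
have addC : commutative add by move=> x y; apply: Tinj; rewrite /= addrC.
have add0 : left_id (mk 0 P0) add by move=> x; apply: Tinj; rewrite /= add0r.
have addN : left_inverse (mk 0 P0) opp add.
  by move=> x; apply: Tinj; rewrite /= addNr.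
pose M1 := GRing.isZmodule.Build T addA addC add0 addN.
pose T1 : zmodType := HB.pack T M1.
have mulA : associative (mul : T1 -> T1 -> T1).
  by move=> x y z; apply: Tinj; rewrite /= mulrA.
have mulC : commutative (mul : T1 -> T1 -> T1).
  by move=> x y; apply: Tinj; rewrite /= mulrC.
have mul1 : left_id (mk 1 P1 : T1) mul.
  by move=> x; apply: Tinj; rewrite /= mul1r.
have mulD : left_distributive (mul : T1 -> T1 -> T1) +%R.
  by move=> x y z; apply: Tinj; rewrite /= mulrDl.
have one0 : (mk 1 P1 : T1) != 0.
  by apply/eqP => /(f_equal sval) /= /eqP; rewrite oner_eq0.
pose M2 := GRing.Zmodule_isComNzRing.Build T1 mulA mulC mul1 mulD one0.
pose C : comNzRingType := HB.pack T T1 M2.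
pose v (x : C) : R := sval x.
have vB : zmod_morphism v by [].
have v1M : monoid_morphism v by [].
pose Q1 := GRing.isZmodMorphism.Build C R v vB.
pose Q2 := GRing.isMonoidMorphism.Build C R v v1M.
exists C, (HB.pack v Q1 Q2 : {rmorphism C -> R}); split=> [x y|x]; first exact: Tinj.
by split=> [Px|[c <-]]; [exists (mk x Px)|apply: svP].
Qed.

Lemma isUnit_hom (R R' : comNzRingType) (f : {rmorphism R -> R'}) x :
  isUnit x -> isUnit (f x).
Proof. by case=> y xy; exists (f y); rewrite -rmorphM xy rmorph1. Qed.

Lemma isUnitM (R : comNzRingType) (x y : R) : isUnit x -> isUnit y -> isUnit (x * y).
Proof. by move=> [x' xx'] [y' yy']; exists (x' * y'); rewrite mulrACA xx' yy' mulr1. Qed.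

Lemma isUnitX (R : comNzRingType) (x : R) n : isUnit x -> isUnit (x ^+ n).
Proof.
move=> ux; elim: n => [|n IH]; first by exists 1; rewrite mulr1.
by rewrite exprS; apply: isUnitM.
Qed.

Lemma isUnit_prod (R : comNzRingType) (I : Type) (r : seq I) (P : pred I) (F : I -> R) :
  (forall i, P i -> isUnit (F i)) -> isUnit (\prod_(i <- r | P i) F i).
Proof.
by move=> HF; elim/big_ind: _ => //; [exists 1; rewrite mulr1|exact: isUnitM].
Qed.

Lemma isUnit_field (F : fieldType) (x : F) : isUnit x <-> x != 0.
Proof.
split=> [[y xy]|x0]; last by exists x^-1; rewrite mulfV.
by apply/eqP => x0; move/eqP: xy; rewrite x0 mul0r eq_sym oner_eq0.
Qed.

Lemma isUnit_inj (R : comNzRingType) (x y z : R) : isUnit x -> x * y = x * z -> y = z.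
Proof. by move=> [x' xx'] E; rewrite -[y]mul1r -xx' [x * _]mulrC -mulrA E mulrA [x' * x]mulrC xx' mul1r. Qed.

Section Coord.
Variables (S : comNzRingType) (d : nat) (G : xgroup d) (U : pred 'I_d).
Hypothesis domG : forall (T : comNzRingType) (x : {ffun 'I_d -> T}),
  xdom G x <-> forall i, U i -> isUnit (x i).
Variable O : coordRing S G.

(** The elements satisfying P form a subring that contains the universal point and the inverses it
    requires. By the universal property the identity of O factors through this subring. *)
Lemma coord_ind (P : O -> Prop) :
  (forall s, P (astr O s)) -> (forall x y, P x -> P y -> P (x - y)) ->
  (forall x y, P x -> P y -> P (x * y)) -> (forall i, P (xuniv O i)) ->
  (forall i b, U i -> xuniv O i * b = 1 -> P b) -> forall y, P y.
Proof.
move=> PS PB PM Px PV.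
have P1 : P 1 by rewrite -(rmorph1 (astr O)).
have [C [v [vi vE]]] := sub_ring_ex P1 PB PM.
have lft y : P y -> exists c, v c = y by move/vE.
have /choice[a aE] s := lft _ (PS s).
have aB : zmod_morphism a by move=> x y; apply: vi; rewrite rmorphB !aE rmorphB.
have aM : monoid_morphism a.
  split; first by apply: vi; rewrite aE !rmorph1.
  by move=> x y; apply: vi; rewrite rmorphM !aE rmorphM.
pose Q1 := GRing.isZmodMorphism.Build S C a aB.
pose Q2 := GRing.isMonoidMorphism.Build S C a aM.
pose C' : alg S := Alg (HB.pack a Q1 Q2 : {rmorphism S -> C}).
pose v' : hom C' O := @Hom S C' O v aE.
have /choice[c cE] i := lft _ (Px i).
have cdom : xdom G [ffun i => c i : C'].
  apply/domG => i Ui; rewrite ffunE.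
  have /domG/(_ i Ui)[b xb] := xuniv_dom O.
  have [b' b'E] := lft _ (PV i b Ui xb).
  by exists b'; apply: vi; rewrite rmorphM cE b'E xb rmorph1.
have [h hE] := @xuniv_ex _ _ _ O C' _ cdom.
have vh : hcomp v' h = hid O.
  by apply: xuniv_uniq => i /=; rewrite hE ffunE cE.
by move=> y; apply/vE; exists (h y); exact: (f_equal (fun g : hom O O => g y) vh).
Qed.

Lemma coord_hom (T : alg S) (x : 'I_d -> T) : (forall i, U i -> isUnit (x i)) ->
  exists h : hom O T, forall i, h (xuniv O i) = x i.
Proof.
move=> Hx; have [|h hE] := @xuniv_ex _ _ _ O T [ffun i => x i].
  by apply/domG => i Ui; rewrite ffunE; apply: Hx.
by exists h => i; rewrite hE ffunE.
Qed.

End Coord.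

Section CoordDomain.
Variables (F : fieldType) (d : nat) (G : xgroup d) (U : pred 'I_d).
Hypothesis domG : forall (T : comNzRingType) (x : {ffun 'I_d -> T}),
  xdom G x <-> forall i, U i -> isUnit (x i).
Variable O : coordRing (F : comNzRingType) G.
Let x := xuniv O.
Let M := \prod_(i | U i) x i.

Lemma coord_unit i : U i -> isUnit (x i).
Proof. by have /domG := xuniv_dom O; apply. Qed.

Lemma coord_frac (y : O) : exists (P : {mpoly F[d]}) m,
  y * M ^+ m = mmap (astr O) x P.
Proof.
pose ev : {rmorphism {mpoly F[d]} -> O} := mmap (astr O) x.
have evC s : ev s%:MP = astr O s by exact: mmapC.
have evX i : ev 'X_i = x i by rewrite -[LHS]/(mmap _ _ _) mmapX mmap1U.
have evM : M = ev (\prod_(i | U i) 'X_i).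
  by rewrite rmorph_prod; apply: eq_bigr => i _; rewrite evX.
suff : exists (P : {mpoly F[d]}) m, y * M ^+ m = ev P by [].
move: y; apply: (coord_ind domG).
- by move=> s; exists s%:MP, 0%N; rewrite expr0 mulr1 evC.
- move=> y z [P [m yP]] [Q [k zQ]].
  exists (P * (\prod_(i | U i) 'X_i) ^+ k - Q * (\prod_(i | U i) 'X_i) ^+ m), (m + k)%N.
  by rewrite rmorphB !rmorphM !rmorphXn -evM -yP -zQ exprD; ring.
- move=> y z [P [m yP]] [Q [k zQ]]; exists (P * Q), (m + k)%N.
  by rewrite rmorphM -yP -zQ exprD; ring.
- by move=> i; exists 'X_i, 0%N; rewrite expr0 mulr1 evX.
- move=> i b Ui xb; exists (\prod_(j | U j && (j != i)) 'X_j), 1%N.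
  rewrite expr1 /M (bigD1 i) //= mulrA [b * _]mulrC xb mul1r rmorph_prod.
  by apply: eq_bigr => j _; rewrite evX.
Qed.

(** The variables define a point with values in the field of fractions, and by [coord_frac] an
    element that vanishes there has zero numerator. A ring known by its universal property only is
    thus seen to be a domain. *)
Lemma coord_embed : exists k : {rmorphism O -> {fraction {mpoly F[d]}}},
  injective k.
Proof.
pose c : {rmorphism F -> {fraction {mpoly F[d]}}} := @tofrac _ \o @mpolyC d F.
have X0 i : ('X_i : {mpoly F[d]}) != 0.
  by apply/eqP => /(f_equal (mcoeff U_(i)%MM)); rewrite mcoeffX eqxx mcoeff0 => /eqP; rewrite oner_eq0.
have [|k kE] := @coord_hom _ _ _ _ domG O (Alg c) (fun i => tofrac ('X_i)).
  by move=> i _; apply/isUnit_field; rewrite tofrac_eq0.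
have kP P : k (mmap (astr O) x P) = tofrac P.
  rewrite /mmap [P in RHS]mpolyE !rmorph_sum; apply: eq_bigr => m _.
  rewrite rmorphM -mul_mpolyC rmorphM (hmapE k); congr (_ * _).
  rewrite mpolyXE_id !rmorph_prod; apply: eq_bigr => i _.
  by rewrite !rmorphXn; congr (_ ^+ _); exact: kE.
exists (hmap k) => y z yz; apply/eqP; rewrite -subr_eq0; apply/eqP.
have [P [m yP]] := coord_frac (y - z).
have P0 : P = 0.
  apply/eqP; rewrite -tofrac_eq0 -kP -yP rmorphM rmorphB yz subrr mul0r //.
have uM : isUnit (M ^+ m) by apply/isUnitX/isUnit_prod/coord_unit.
by apply: (isUnit_inj uM); rewrite mulrC yP P0 mulr0 mmap0.
Qed.

Lemma coord_dom (y z : O) : y * z = 0 -> y = 0 \/ z = 0.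
Proof.
have [k ki] := coord_embed; move=> /(f_equal k); rewrite rmorphM rmorph0 => /eqP.
by rewrite mulf_eq0 => /orP[] /eqP E; [left|right]; apply: ki; rewrite E rmorph0.
Qed.

Lemma coord_conn : conn O.
Proof.
move=> e ee; have [] := @coord_dom e (e - 1); first by rewrite mulrBr mulr1 ee subrr.
  by left.
by move/eqP; rewrite subr_eq0 => /eqP; right.
Qed.
End CoordDomain.

Lemma torus_dom d (T : comNzRingType) (x : {ffun 'I_d -> T}) :
  xdom (torus d) x <-> forall i, predT i -> isUnit (x i).
Proof. by split=> H i; [move=> _; apply: H|apply: H]. Qed.

Lemma gmWitt_dom p n (T : comNzRingType) (x : {ffun 'I_n.+1 -> T}) :
  xdom (gmWitt p n) x <-> forall i, pred1 ord0 i -> isUnit (x i).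
Proof. by split=> [H i /eqP ->//|]; apply; rewrite /= eqxx. Qed.

(** * Kummer theory on the multiplicative group *)

(** The criterion of Chase, Harrison and Rosenberg for Galois extensions: the orthogonality
    relations make [x] and [y] dual bases for the trace and give the separability idempotent. *)
Lemma galois_fet (A : comNzRingType) (B : alg A) (Gam I : finType)
  (sigma : Gam -> hom B B) (e0 : Gam) (x y : I -> B) (tr : B -> A) :
  injective (astr B) -> sigma e0 = hid B ->
  (forall b, astr B (tr b) = \sum_c sigma c b) ->
  (forall c, \sum_i x i * sigma c (y i) = (c == e0)%:R) ->
  (forall c, \sum_i sigma c (x i) * y i = (c == e0)%:R) -> fet B.
Proof.
move=> ai s0 trE H1 H2.
have sel (F : Gam -> B) : \sum_c F c * (c == e0)%:R = F e0.
  rewrite (bigD1 e0) //= eqxx mulr1 big1 ?addr0 // => c /negPf ->.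
  by rewrite mulr0.
have trD a b : tr (a + b) = tr a + tr b.
  apply: ai; rewrite rmorphD !trE -big_split; apply: eq_bigr => c _.
  by rewrite rmorphD.
have trZ a b : tr (astr B a * b) = a * tr b.
  apply: ai; rewrite rmorphM !trE mulr_sumr; apply: eq_bigr => c _.
  by rewrite rmorphM hmapE.
have ltr : linear_form tr by split.
have expand z : z = \sum_i astr B (tr (z * y i)) * x i.
  under eq_bigr => i _ do rewrite trE mulr_suml.
  rewrite exchange_big /= -[z in LHS]/(hid B z) -s0 -(sel (fun c => sigma c z)).
  apply: eq_bigr => c _; rewrite -H1 mulr_sumr; apply: eq_bigr => i _.
  by rewrite rmorphM; ring.
have expand' z : z = \sum_i astr B (tr (z * x i)) * y i.
  under eq_bigr => i _ do rewrite trE mulr_suml.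
  rewrite exchange_big /= -[z in LHS]/(hid B z) -s0 -(sel (fun c => sigma c z)).
  apply: eq_bigr => c _; rewrite -H2 mulr_sumr; apply: eq_bigr => i _.
  by rewrite rmorphM; ring.
apply/fetP; split.
  by exists I, x, (fun i z => tr (z * y i)); split=> // i; apply: linear_form_mul.
exists I, x, y; split=> [f lf z|]; last first.
  have id_e0 b : sigma e0 b = b by rewrite s0.
  by have := H1 e0; rewrite eqxx; under eq_bigr => i _ do rewrite id_e0.
under eq_bigr => j _ do rewrite [z * x j]expand (lf_sum lf) rmorph_sum mulr_suml.
rewrite exchange_big; apply: eq_bigr => i _; rewrite [z * y i]expand' mulr_sumr.
apply: eq_bigr => j _ /=; rewrite (lfZ lf) rmorphM.
by rewrite [z * x j * _]mulrAC [astr _ _ * astr _ _]mulrC mulrA.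
Qed.

Lemma roots_unity_all (E : fieldType) (Gam : finType) (mu : Gam -> E) N :
  injective mu -> (forall c, mu c ^+ N = 1) -> #|Gam| = N -> (0 < N)%N ->
  forall x, x ^+ N = 1 -> exists c, x = mu c.
Proof.
move=> mui muN cG N0 x xN; apply: contrapT => nx.
have : (size (x :: map mu (enum Gam)) <= N)%N.
  apply: max_unity_roots => //=.
    rewrite unity_rootE xN eqxx; apply/allP => _ /mapP[c _ ->].
    by rewrite unity_rootE muN.
  rewrite map_inj_uniq ?enum_uniq // andbT; apply/mapP => -[c _ xc].
  by apply: nx; exists c.
by rewrite /= size_map -cardE cG ltnn.
Qed.

Section Laurent.
Variables (F : fieldType) (O : coordRing (F : comNzRingType) (torus 1)).
Let t := xuniv O ord0.

Definition lev : {rmorphism {poly F} -> O} :=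
  horner_morph (fun x => mulrC t (astr O x)).

Lemma levC a : lev a%:P = astr O a. Proof. exact: horner_morphC. Qed.
Lemma levX : lev 'X = t. Proof. exact: horner_morphX. Qed.

Lemma levE P : lev P = \sum_(i < size P) astr O P`_i * t ^+ i.
Proof.
rewrite -{1}[P]coefK poly_def rmorph_sum; apply: eq_bigr => i _.
by rewrite -mul_polyC rmorphM rmorphXn levC levX.
Qed.

Lemma torus1_unit : isUnit t.
Proof. by have := xuniv_dom O; apply. Qed.

Lemma torus1_ind (P : O -> Prop) :
  (forall s, P (astr O s)) -> (forall x y, P x -> P y -> P (x - y)) ->
  (forall x y, P x -> P y -> P (x * y)) -> P t -> (forall b, t * b = 1 -> P b) ->
  forall y, P y.
Proof.
move=> PS PB PM Px PV; apply: (coord_ind (@torus_dom 1)) => // [i|i b _].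
  by rewrite ord1.
by rewrite ord1; apply: PV.
Qed.

Lemma torus1_hom (T : alg (F : comNzRingType)) (x : T) : isUnit x ->
  exists h : hom O T, h t = x.
Proof.
move=> ux; have [//|h hE] := coord_hom (@torus_dom 1) O (x := fun=> x).
by exists h; rewrite hE.
Qed.

Lemma torus1_uniq (T : alg (F : comNzRingType)) (h h' : hom O T) : h t = h' t -> h = h'.
Proof. by move=> E; apply: xuniv_uniq => i; rewrite ord1. Qed.

Lemma laurent_frac y : exists P m, y * t ^+ m = lev P.
Proof.
move: y; apply: torus1_ind.
- by move=> s; exists s%:P, 0%N; rewrite expr0 mulr1 levC.
- move=> y z [P [m yP]] [Q [k zQ]]; exists (P * 'X^k - Q * 'X^m), (m + k)%N.
  by rewrite rmorphB !rmorphM !rmorphXn /= levX -yP -zQ exprD; ring.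
- move=> y z [P [m yP]] [Q [k zQ]]; exists (P * Q), (m + k)%N.
  by rewrite rmorphM -yP -zQ exprD; ring.
- by exists 'X, 0%N; rewrite expr0 mulr1 levX.
- by move=> b tb; exists 1, 1%N; rewrite expr1 mulrC tb rmorph1.
Qed.

Lemma lev_inj : injective lev.
Proof.
have inj0 P : lev P = 0 -> P = 0.
  pose c : {rmorphism F -> {fraction {poly F}}} := @tofrac _ \o @polyC F.
  have [|k kt] := @torus1_hom (Alg c) (tofrac 'X).
    by apply/isUnit_field; rewrite tofrac_eq0 polyX_eq0.
  have kP : k (lev P) = tofrac P.
    rewrite -[P]coefK poly_def !rmorph_sum; apply: eq_bigr => i _.
    rewrite -mul_polyC !rmorphM !rmorphXn levX levC kt; congr (_ * _).
    exact: (hmapE k).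
  by move=> P0; apply/eqP; rewrite -tofrac_eq0 -kP P0 rmorph0.
by move=> P Q /eqP; rewrite -subr_eq0 -rmorphB => /eqP/inj0/eqP; rewrite subr_eq0 => /eqP.
Qed.

(** Multiplied by powers of t, the unit and its inverse become polynomials with product a power of
    X, whose only divisors are scalar multiples of powers of X. *)
Lemma laurent_unit y : isUnit y ->
  exists (a : F) k1 k2, a != 0 /\ y * t ^+ k1 = astr O a * t ^+ k2.
Proof.
move=> [z yz]; have [P [m yP]] := laurent_frac y; have [Q [k zQ]] := laurent_frac z.
have PQ : P * Q = 'X^(m + k).
  apply: lev_inj; rewrite rmorphM -yP -zQ rmorphXn /= levX exprD.
  by rewrite mulrACA yz mul1r.
have : P %| ('X - 0%:P) ^+ (m + k) by rewrite subr0 -PQ dvdp_mulr.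
case/dvdp_exp_XsubCP => j _; rewrite subr0 => /eqpP[[a b] /= /andP[a0 b0] E].
exists (b / a), m, j; split; first by rewrite mulf_neq0 ?invr_eq0.
rewrite yP; have -> : P = (b / a) *: 'X^j.
  by rewrite mulrC -scalerA -E scalerA mulVf // scale1r.
by rewrite -mul_polyC rmorphM levC rmorphXn levX.
Qed.

Lemma laurent_common (I : finType) (c : I -> O) :
  exists m, forall i, exists P, c i * t ^+ m = lev P.
Proof.
have /choice[P /choice[m H]] i := laurent_frac (c i).
exists (\sum_i m i)%N => i; exists (P i * 'X^(\sum_(j | j != i) m j)).
by rewrite (bigD1 i) //= exprD mulrA H rmorphM rmorphXn /= levX.
Qed.

Lemma poly_bezout (I : finType) (P : I -> {poly F}) :
  exists D, (exists u : I -> {poly F}, D = \sum_i P i * u i) /\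
    forall i, exists v, P i = D * v.
Proof.
suff [D [[u uE] Dd]] : exists D, (exists u : I -> {poly F}, D = \sum_(i <- enum I) P i * u i) /\
    forall i, i \in enum I -> exists v, P i = D * v.
  exists D; split; first by exists u; rewrite uE big_enum.
  by move=> i; apply: Dd; rewrite mem_enum.
have := enum_uniq I; elim: (enum I) => [_|i s IH /= /andP[nis us]].
  by exists 0; split=> [|i //]; exists (fun=> 0); rewrite big_nil.
have [D [[u uE] Dd]] := IH us.
have [[a b] /= /eqpP[[x y] /= /andP[x0 y0] E]] := Bezoutp (P i) D.
exists (a * P i + b * D); split.
  exists (fun j => if j == i then a else b * u j); rewrite big_cons eqxx [a * _]mulrC.
  congr (_ + _); rewrite uE mulr_sumr !big_seq; apply: eq_bigr => j js.
  by rewrite ifN 1?mulrCA //; apply: contraNneq nis => <-.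
have gE : gcdp (P i) D = (x / y) *: (a * P i + b * D).
  by rewrite mulrC -scalerA E scalerA mulVf // scale1r.
have dv R : gcdp (P i) D %| R -> exists v, R = (a * P i + b * D) * v.
  move=> /dvdpP[q ->]; exists ((x / y) *: q); rewrite gE -!scalerAr.
  by rewrite [q * _]mulrC.
move=> j; rewrite inE => /orP[/eqP->|/Dd[v ->]]; first by apply: dv; apply: dvdp_gcdl.
by apply: dv; apply: dvdp_mulr; apply: dvdp_gcdr.
Qed.

Lemma laurent_bezout (I : finType) (c : I -> O) :
  exists D, (exists u : I -> O, D = \sum_i c i * u i) /\
    forall i, exists v, c i = D * v.
Proof.
have [m /choice[P cP]] := laurent_common c.
have [D [[u uE] Dd]] := poly_bezout P.
have [s ts] := isUnitX m torus1_unit.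
exists (lev D); split.
  exists (fun i => t ^+ m * lev (u i)); rewrite uE rmorph_sum; apply: eq_bigr => i _.
  by rewrite rmorphM -cP mulrA.
move=> i; have [v Pv] := Dd i; exists (lev v * s).
by rewrite mulrA -rmorphM -Pv -cP -mulrA ts mulr1.
Qed.

Lemma laurent_pow_inj (N : nat) (th : hom O O) : (0 < N)%N -> th t = t ^+ N ->
  injective th.
Proof.
move=> N0 tht.
have thP P : th (lev P) = lev (P \Po 'X^N).
  rewrite comp_polyE levE !rmorph_sum; apply: eq_bigr => i _.
  by rewrite -mul_polyC !rmorphM !rmorphXn levC levX (hmapE th) tht.
have inj0 y : th y = 0 -> y = 0.
  move=> y0; have [P [m yP]] := laurent_frac y.
  have P0 : P = 0.
    apply/eqP; rewrite -(@comp_poly_eq0 _ _ 'X^N) ?size_polyXn //.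
    by apply/eqP/lev_inj; rewrite -thP -yP rmorphM y0 mul0r rmorph0.
  by apply: (isUnit_inj (isUnitX m torus1_unit)); rewrite mulrC yP P0 rmorph0 mulr0.
by move=> x y /eqP; rewrite -subr_eq0 -rmorphB => /eqP/inj0/eqP; rewrite subr_eq0 => /eqP.
Qed.

Variables (Gam : finType) (gadd : Gam -> Gam -> Gam) (mu : Gam -> F) (N : nat).
Hypotheses (muD : forall c d, mu (gadd c d) = mu c * mu d) (mui : injective mu).
Hypotheses (muN : forall c, mu c ^+ N = 1) (cG : #|Gam| = N) (N0 : (0 < N)%N).
Hypothesis (NF : N%:R != 0 :> F).
Variable th : hom O O.
Hypothesis tht : th t = t ^+ N.

Lemma mu_neq0 c : mu c != 0.
Proof.
by apply/eqP => m0; have /eqP := muN c; rewrite m0 expr0n gtn_eqF // eq_sym oner_eq0.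
Qed.

Lemma mu_sum k : \sum_c mu c ^+ k = if (N %| k)%N then N%:R else 0.
Proof.
case: ifP => [/dvdnP[q ->]|nNk].
  under eq_bigr => c _ do rewrite mulnC exprM muN expr1n.
  by rewrite sumr_const -cG.
have [d dk] : exists d, mu d ^+ k != 1.
  apply: contrapT => no; have all1 c : mu c ^+ (k %% N) = 1.
    apply: contrapT => c1; apply: no; exists c; apply/eqP => E; apply: c1.
    by rewrite -E [in RHS](divn_eq k N) exprD mulnC exprM muN expr1n mul1r.
  have k0 : (0 < k %% N)%N by rewrite lt0n; apply/negP => /eqP E; move: nNk; rewrite /dvdn E.
  have : (size (map mu (enum Gam)) <= k %% N)%N.
    apply: max_unity_roots => //; last by rewrite map_inj_uniq ?enum_uniq.
    by apply/allP => _ /mapP[c _ ->]; rewrite unity_rootE all1.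
  by rewrite size_map -cardE cG leqNgt ltn_mod N0.
apply/eqP; have : (mu d ^+ k - 1) * (\sum_c mu c ^+ k) == 0.
  rewrite mulrBl mul1r subr_eq0; apply/eqP; rewrite mulr_sumr.
  have gi : injective (gadd d).
    by move=> a b /(f_equal mu); rewrite !muD => /(mulfI (mu_neq0 d))/mui.
  rewrite [RHS](reindex_inj gi); apply: eq_bigr => c _.
  by rewrite muD exprMn.
by rewrite mulf_eq0 subr_eq0 (negPf dk).
Qed.

Lemma theta_act_ex c : exists a : hom (Alg (hmap th)) (Alg (hmap th)),
  a t = astr O (mu c) * t.
Proof.
have [|a0 a0t] := @torus1_hom O (astr O (mu c) * t).
  by apply: isUnitM torus1_unit; apply/isUnit_hom/isUnit_field/mu_neq0.
have E : hcomp a0 th = th.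
  apply: torus1_uniq; rewrite /= tht rmorphXn a0t exprMn -rmorphXn muN rmorph1 mul1r.
  by [].
by exists (@Hom O (Alg (hmap th)) (Alg (hmap th)) (hmap a0)
   (fun s => f_equal (fun h : hom O O => h s) E)).
Qed.

Definition theta_act c := projT1 (cid (theta_act_ex c)).
Lemma theta_actE c : theta_act c t = astr O (mu c) * t.
Proof. exact: (projT2 (cid (theta_act_ex c))). Qed.

Lemma theta_act_S c s : theta_act c (astr O s) = astr O s.
Proof. by have := hmapE (theta_act c) (astr O s); rewrite /= hmapE. Qed.

Lemma theta_hom_eq (T : alg O) (h h' : hom (Alg (hmap th)) T) : h t = h' t -> h = h'.
Proof.
move=> E; pose T0 : alg (F : comNzRingType) := resAlg (astr O) T.
have hF (g : hom (Alg (hmap th)) T) s : g (astr O s) = astr T0 s.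
  by rewrite /= -(hmapE g) /= hmapE.
apply: hom_ext => x.
have := torus1_uniq (h := @Hom _ O T0 (hmap h) (hF h)) (h' := @Hom _ O T0 (hmap h') (hF h')) E.
by move/(f_equal (fun g : hom O T0 => g x)).
Qed.

(** The Galois criterion is met by x_i = t^i and y_i = t^-i / N for i < N: the relations are
    geometric sums of an N-th root of unity, which vanish unless the root is 1. *)
Lemma theta_torsor : torsor gadd theta_act.
Proof.
have [e0 m1] : exists c, 1 = mu c.
  by apply: (roots_unity_all mui muN cG N0); rewrite expr1n.
have act_t c : theta_act c t = astr O (mu c) * t := theta_actE c.
split.
- have [t' tt'] := torus1_unit.
  have tI i : t ^+ i * t' ^+ i = 1 by rewrite -exprMn tt' expr1n.
  have act_t' c : theta_act c t' = astr O (mu c)^-1 * t'.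
    have u : isUnit (theta_act c t) by exact/isUnit_hom/torus1_unit.
    apply: (isUnit_inj u); rewrite -[LHS]rmorphM tt' rmorph1 act_t mulrACA.
    by rewrite -rmorphM mulfV ?mu_neq0 // rmorph1 mul1r tt'.
  (* The trace descends along [th]: multiplication by the invariant t^(mN) makes b a polynomial, and
     the sum over the group keeps N times its monomials of degree divisible by N. *)
  have im_ex b : exists a, th a = \sum_c theta_act c b.
    have [P [m bP]] := laurent_frac b.
    have tmN : t ^+ (m * N) * t' ^+ (m * N) = 1 by [].
    have bP' : b * t ^+ (m * N) = lev (P * 'X^(m * N - m)).
      by rewrite rmorphM rmorphXn /= levX -bP -mulrA -exprD subnKC // leq_pmulr.
    set R := P * _ in bP'.
    have RE : exists a, th a = \sum_c theta_act c (lev R).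
      exists (\sum_(i < size R | (N %| i)%N) N%:R * astr O R`_i * t ^+ (i %/ N)).
      rewrite rmorph_sum levE.
      under [RHS]eq_bigr => c _ do rewrite rmorph_sum.
      rewrite exchange_big [RHS](bigID (fun i : 'I_(size R) => (N %| i)%N)) /=.
      rewrite [X in _ = _ + X]big1 ?addr0 => [|i nNi].
        apply: eq_bigr => i Ni; rewrite !rmorphM rmorphXn rmorph_nat (hmapE th) tht.
        rewrite -exprM mulnC divnK //.
        under eq_bigr => c _ do rewrite rmorphM rmorphXn /= theta_act_S act_t exprMn -rmorphXn mulrCA.
        by rewrite -mulr_suml -rmorph_sum mu_sum Ni rmorph_nat mulrA.
      under eq_bigr => c _ do rewrite rmorphM rmorphXn /= theta_act_S act_t exprMn -rmorphXn mulrCA.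
      by rewrite -mulr_suml -rmorph_sum mu_sum (negPf nNi) rmorph0 mul0r.
    have [a aE] := RE; exists (a * t' ^+ m).
    have tht' : th t' = t' ^+ N.
      have u : isUnit (th t) by exact/isUnit_hom/torus1_unit.
      by apply: (isUnit_inj u); rewrite -rmorphM tt' rmorph1 tht tI.
    rewrite rmorphM aE rmorphXn tht' -exprM mulr_suml; apply: eq_bigr => c _.
    rewrite -bP' rmorphM rmorphXn /= act_t exprMn -rmorphXn mulnC exprM muN expr1n.
    by rewrite rmorph1 mul1r -mulrA [(N * m)%N]mulnC tI mulr1.
  have /choice[tr trE] := im_ex.
  have geo (nu : F) : nu ^+ N = 1 -> \sum_(i < N) nu ^+ i * N%:R^-1 = (nu == 1)%:R.
    move=> nuN; rewrite -mulr_suml; have [->|n1] := eqVneq.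
      by under eq_bigr => i _ do rewrite expr1n; rewrite sumr_const card_ord mulfV.
    have /eqP := subrX1 nu N; rewrite nuN subrr eq_sym mulf_eq0 subr_eq0 (negPf n1) /=.
    by move/eqP ->; rewrite mul0r.
  have mu1 c : (mu c == 1) = (c == e0) by rewrite m1 (inj_eq mui).
  pose x (i : 'I_N) := t ^+ i; pose y (i : 'I_N) := t' ^+ i * astr O N%:R^-1.
  apply: (@galois_fet _ (Alg (hmap th)) Gam 'I_N theta_act e0 x y tr) => //.
  + exact: laurent_pow_inj N0 tht.
  + by apply: theta_hom_eq; rewrite act_t -m1 rmorph1 mul1r.
  + move=> c; rewrite -mu1 -invr_eq1.
    have := f_equal (astr O) (geo (mu c)^-1 _); rewrite rmorph_nat => <-; last first.
      by rewrite exprVn muN invr1.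
    rewrite rmorph_sum; apply: eq_bigr => i _.
    rewrite /y rmorphM rmorphXn /= act_t' theta_act_S exprMn -mulrA mulrCA.
    by rewrite [t ^+ i * _]mulrA tI mul1r rmorphM rmorphXn.
  + move=> c; rewrite -mu1.
    have := f_equal (astr O) (geo (mu c) (muN c)); rewrite rmorph_nat => <-.
    rewrite rmorph_sum; apply: eq_bigr => i _.
    rewrite /x rmorphXn /= act_t exprMn /y -mulrA [t ^+ i * _]mulrA tI mul1r.
    by rewrite rmorphM rmorphXn.
- move=> c d; apply: theta_hom_eq; rewrite /= !act_t rmorphM /= theta_act_S act_t.
  by rewrite muD rmorphM mulrA [astr O (mu d) * _]mulrC.
- move=> c d; apply: theta_hom_eq.
  by rewrite /= !act_t !rmorphM /= !theta_act_S !act_t !mulrA [astr _ _ * _]mulrC.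
- move=> w h h'.
  have hN (g : hom (Alg (hmap th)) w) : g t ^+ N = gmap w t.
    by rewrite -rmorphXn -tht; exact: (hmapE g).
  have ht0 : h t != 0 by apply/isUnit_field/isUnit_hom/torus1_unit.
  have hS (g : hom (Alg (hmap th)) w) s : g (astr O s) = gmap w (astr O s).
    by rewrite -(hmapE g) /= hmapE.
  have nui : injective (fun c => gmap w (astr O (mu c))).
    by move=> a b /(fmorph_inj (gmap w \o astr O))/mui.
  have [||c cE] := @roots_unity_all _ _ (fun c => gmap w (astr O (mu c))) N nui _ cG N0 (h' t / h t).
  + by move=> c; rewrite -!rmorphXn muN !rmorph1.
  + by rewrite expr_div_n !hN mulfV // -(hN h) expf_neq0.
  exists c; split.
    apply: theta_hom_eq; rewrite /= act_t rmorphM hS -cE divfK //.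
  move=> d E; apply: nui; rewrite -cE E /= act_t rmorphM hS mulfK //.
Qed.
End Laurent.

Lemma prim_root_ex (E : closedFieldType) N : (0 < N)%N -> N%:R != 0 :> E ->
  exists z : E, N.-primitive_root z.
Proof.
move=> N0 NE; have [r Hr] := closed_field_poly_normal ('X^N - 1 : {poly E}).
rewrite (monicP (monicXnsubC 1 N0)) scale1r in Hr.
have sr : size r = N.
  have := size_XnsubC (1 : E) N0; rewrite [_ - _]Hr size_prod_XsubC; by case.
have ur : uniq r by rewrite -separable_prod_XsubC -Hr cyclotomic.separable_Xn_sub_1.
have allr : all N.-unity_root r.
  by apply/allP => x xr; rewrite -[_ x]/(root ('X^N - 1) x) Hr root_prod_XsubC.
have /hasP[z _ zp] := has_prim_root N0 allr ur (eq_leq (esym sr)).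
by exists z.
Qed.

(** Characters take values among the l-adic roots of unity, while the cover has automorphisms by
    roots of unity of the base field; [T] matches the two. Its values outside the powers of [z] are
    arbitrary. *)
Lemma transfer_ex (E E' : fieldType) N (z : E) (z' : E') : (0 < N)%N ->
  N.-primitive_root z -> N.-primitive_root z' ->
  exists T : E -> E', forall k, T (z ^+ k) = z' ^+ k.
Proof.
move=> N0 zp zp'.
have /choice[a aP] x : exists a, forall k, x = z ^+ k -> x = z ^+ a.
  have [[k xk]|no] := pselect (exists k, x = z ^+ k); first by exists k.
  by exists 0%N => k xk; case: no; exists k.
exists (fun x => z' ^+ a x) => k; apply/eqP.
by rewrite (eq_prim_root_expr zp') -(eq_prim_root_expr zp) -(aP _ k).
Qed.

(** * Descent, and Lagrange resolvents on the multiplicative group *)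

Lemma dominate_all (A : comNzRingType) (w : geomPt A) m (B : 'I_m -> alg A)
  (h : forall i, hom (B i) w) : conn A -> (forall i, fet (B i)) ->
  exists (E : alg A) (x : hom E w), [/\ fet E, conn E &
    forall i, exists g : hom (B i) E, hcomp x g = h i].
Proof.
move=> cA; elim: m B h => [|m IH] B h HB.
  exists (triv A), (@Hom A (triv A) w (gmap w) (fun=> erefl)).
  by split=> // [|[]//]; apply: fet_triv.
have [E [x [HE cE xg]]] := IH _ (fun i => h (lift ord0 i)) (fun i => HB (lift ord0 i)).
have [E' [g1 [g2 [y [HE' cE' yg1 yg2]]]]] := dominate cA x (h ord0) HE (HB ord0).
exists E', y; split=> // i; case: (unliftP ord0 i) => [j|] ->; last by exists g2.
by have [g gE] := xg j; exists (hcomp g1 g); rewrite hcompA yg1.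
Qed.

Lemma dominate_fibre (A : comNzRingType) (w : geomPt A) (B : alg A) :
  conn A -> fet B -> exists (E : alg A) (x : hom E w), [/\ fet E, conn E &
    forall h : hom B w, exists g : hom B E, hcomp x g = h].
Proof.
move=> cA HB; have [m [p [p' pK p'K]]] := fibre_finT w HB.
have [E [x [HE cE xg]]] := dominate_all (B := fun=> B) p cA (fun=> HB).
by exists E, x; split=> // h; have [g gE] := xg (p' h); exists g; rewrite gE.
Qed.

(** The two images of y in D (x) D agree on all connected covers, hence agree. Forms f_l and
    elements x_l with \sum_l f_l(x_l) = 1 then carry out faithfully flat descent explicitly: y is
    the sum of the f_l(x_l y). *)
Lemma fet_descent (A : comNzRingType) (D : alg A) (w : geomPt A) (y : D) :
  conn A -> fet D ->
  (forall (E : alg A) (g g' : hom D E), fet E -> conn E -> g y = g' y) ->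
  exists a, y = astr D a.
Proof.
move=> cA HD Hy.
have [||di diE] := @mk_hom A D (resAlg (astr D) (triv D)) idfun (rmorphD _) (rmorph1 _).
- exact: rmorphM.
- by [].
have [P [i [HP Pi Pform]]] := pushout_ex di HD.
have HP' := fet_comp HD HP.
have [||a aE] := @mk_hom A D (resAlg (astr D) P) (astr P) (rmorphD _) (rmorph1 _).
- exact: rmorphM.
- by [].
have /eqP : a y - i y = 0.
  apply: (zero_test w cA HP') => C q HC cC; apply/eqP; rewrite rmorphB subr_eq0.
  by apply/eqP; exact: (Hy C (hcomp q a) (hcomp q i) HC cC).
rewrite subr_eq0 aE => /eqP Ey.
have [I [f [x [lf fx1]]]] := fet_trace1 cA HD.
exists (\sum_l f l (x l * y)); rewrite rmorph_sum /= -[LHS]mulr1 -(rmorph1 (astr D)) -fx1.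
rewrite rmorph_sum mulr_sumr; apply: eq_bigr => l _.
have [f' lf' f'E] := Pform _ (lf l).
by rewrite -f'E -(lfZ lf') Ey -rmorphM f'E mulrC.
Qed.

Section Kummer.
Variables (F : closedFieldType) (O : coordRing (F : comNzRingType) (torus 1)).
Let t := xuniv O ord0.
Let cO : conn O := coord_conn (O := O) (@torus_dom 1).
Variables (w : geomPt O) (l : nat) (Q : padicClosure l) (L : locsys Q w).
Variables (N : nat) (z : F) (z' : Q).
Hypotheses (F0 : [pchar F] =i pred0) (N0 : (0 < N)%N).
Hypotheses (zp : N.-primitive_root z) (zp' : N.-primitive_root z').
Hypothesis LN : forall s, L s ^+ N = 1.

(** By continuity [L] is close to 1 on the loops fixing the fibres of finitely many covers, and its
    values are N-th roots of unity, which are isolated. A connected pointed C dominating all points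
    of these covers detects such loops. *)
Lemma finite_order_open : exists (C : alg O) (c : hom C w) (HC : fet C),
  conn C /\ forall s : path w w, s C HC c = c -> L s = 1.
Proof.
have [r rP] : exists r : seq Q, forall x : Q, x ^+ N = 1 -> x \in r.
  exists (map (fun i => z' ^+ i) (iota 0 N)) => x /eqP xN.
  have [i ->] := prim_rootP zp' (eqP xN).
  by apply/mapP; exists (val i) => //; rewrite mem_iota ltn_ord.
(* This exceeds the valuation of x - 1 for every N-th root of unity x other than 1; absolute values
   make the meaningless term at x = 1 harmless. *)
pose M : rat := 1 + \sum_(x <- r) `|pval (x - 1)|.
have far (x : Q) : x ^+ N = 1 -> near (@pval l Q) M x 1 -> x = 1.
  move=> /rP xr [//|]; rewrite /M (big_rem x xr) /= => H; exfalso.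
  have h0 : 0 <= \sum_(y <- rem x r) `|pval (y - 1)| by apply: sumr_ge0.
  have := le_lt_trans (le_trans (ler_norm (pval (x - 1))) (lexx _)) (ltr_pwDl ltr01 (lexx _)).
  have := ler_norm (pval (x - 1)) => h1 _.
  have : 1 <= 0 :> rat.
    rewrite -(lerD2r `|pval (x - 1)|) add0r; apply: le_trans h1.
    by apply: le_trans H; rewrite lerD2l lerDl.
  by rewrite ler10.
have [k [B [HB HL]]] := lchar_cont L M.
have ex i := dominate_fibre w cO (HB i).
pose E i := projT1 (cid (ex i)).
have exx i : exists x : hom (E i) w, [/\ fet (E i), conn (E i) &
    forall h : hom (B i) w, exists g : hom (B i) (E i), hcomp x g = h].
  exact: projT2 (cid (ex i)).
pose x i := projT1 (cid (exx i)).
have xP i : [/\ fet (E i), conn (E i) &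
    forall h : hom (B i) w, exists g : hom (B i) (E i), hcomp (x i) g = h].
  exact: projT2 (cid (exx i)).
have HE i : fet (E i) by case: (xP i).
have [C [c [HC cC cg]]] := dominate_all x cO HE.
exists C, c, HC; split=> // s sc; apply: far => //; apply: HL => i h.
have [_ _ /(_ h)[g <-]] := xP i; have [g' <-] := cg i.
by rewrite -hcompA (pfun_nat s (HB i) HC) sc.
Qed.

Variables (T : Q -> F).
Hypothesis TE : forall k, T (z' ^+ k) = z ^+ k.

Let rootQ (x : Q) : x ^+ N = 1 -> exists k, x = z' ^+ k.
Proof. by move=> /(prim_rootP zp')[i ->]; exists i. Qed.

Let TM x y : x ^+ N = 1 -> y ^+ N = 1 -> T (x * y) = T x * T y.
Proof. by move=> /rootQ[i ->] /rootQ[j ->]; rewrite -exprD !TE exprD. Qed.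

Let T1 : T 1 = 1. Proof. by rewrite -(expr0 z') TE. Qed.

Let TN x : x ^+ N = 1 -> T x ^+ N = 1.
Proof. by move=> /rootQ[i ->]; rewrite TE exprAC (prim_expr_order zp) expr1n. Qed.

Let T0 x : x ^+ N = 1 -> T x != 0.
Proof.
move=> /TN H; apply/eqP => x0; move/eqP: H; rewrite x0 expr0n gtn_eqF //.
by rewrite eq_sym oner_eq0.
Qed.

Let LM (s r : path w w) : L (path_comp s r) = L s * L r.
Proof. exact: lcharM. Qed.

Section Resolvent.
Variables (C : alg O) (c : hom C w) (HC : fet C).
Hypotheses (cC : conn C) (LC : forall s : path w w, s C HC c = c -> L s = 1).

(** V at the point s c is T(L s); this is well defined because [L] is trivial on the stabiliser of
    [c]. *)
Lemma fibre_weight : exists V : hom C w -> F,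
  (forall h, V h != 0) /\ forall (s : path w w) h, V (s C HC h) = T (L s) * V h.
Proof.
have /choice[k kc] h : exists s : path w w, s C HC c = h by exact: path_ex.
have Lk (s : path w w) h : s C HC c = h -> L s = L (k h).
  move=> sh; have : L (path_comp (path_inv (k h)) s) = 1.
    by apply: LC; rewrite /= sh; have := path_invK (k h) HC c; rewrite kc.
  have : L (path_comp (path_inv (k h)) (k h)) = 1.
    by apply: LC; rewrite /= path_invK.
  rewrite !LM => H1 H2; apply: (mulfI (lchar_neq0 L (path_inv (k h)))).
  by rewrite H1.
exists (fun h => T (L (k h))); split=> [h|s h]; first exact/T0/LN.
rewrite -TM ?LN //; congr T; rewrite -LM; apply/esym/Lk => /=.
by rewrite kc.
Qed.

Variables (V : hom C w -> F).
Hypotheses (V0 : forall h, V h != 0)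
  (VE : forall (s : path w w) h, V (s C HC h) = T (L s) * V h).
Variables (J : finType) (u v : J -> C).
Hypothesis uvS : sep_elt u v.
Variables (r : nat) (P : 'I_r -> hom C w).
Hypothesis Pb : bijective P.

Definition kst (D : alg O) a := astr D (astr O a).

Lemma kst_hom (D E : alg O) (g : hom D E) a : g (kst D a) = kst E a.
Proof. exact: hmapE. Qed.

Lemma kstM (D : alg O) a b : kst D (a * b) = kst D a * kst D b.
Proof. by rewrite /kst !rmorphM. Qed.

(** Lagrange resolvents: sums of the conjugates of u_j weighted by V^-1; [rres] has v_j and V, for
    the inverse character. Taking both halves of the separability idempotent yields [res_sum], so
    the resolvents do not all vanish. *)
Definition lres (D : alg O) (G : 'I_r -> hom C D) j :=
  \sum_i kst D (V (P i))^-1 * G i (u j).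
Definition rres (D : alg O) (G : 'I_r -> hom C D) j :=
  \sum_i kst D (V (P i)) * G i (v j).

Lemma lres_hom (D E : alg O) (g : hom D E) G j :
  g (lres G j) = lres (fun i => hcomp g (G i)) j.
Proof.
by rewrite rmorph_sum; apply: eq_bigr => i _; rewrite rmorphM kst_hom.
Qed.

Lemma rres_hom (D E : alg O) (g : hom D E) G j :
  g (rres G j) = rres (fun i => hcomp g (G i)) j.
Proof.
by rewrite rmorph_sum; apply: eq_bigr => i _; rewrite rmorphM kst_hom.
Qed.

Variables (D : alg O) (d : hom D w) (HD : fet D) (cD : conn D).
Variable G : 'I_r -> hom C D.
Hypothesis dG : forall i, hcomp d (G i) = P i.

(** Distinct conjugates are orthogonal for the separability idempotent; the r diagonal terms remain,
    each with weight V^-1 V = 1. *)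
Lemma res_sum : \sum_j lres G j * rres G j = r%:R.
Proof.
have Pi : injective P by exact: bij_inj.
have E a b : eq_idem u v (G a) (G b) = (a == b)%:R.
  have [->|ne] := eqVneq a b; first exact: (eq_idem1 uvS).
  have [//|e1] := cD (eq_idem_idem HC uvS (G a) (G b)).
  have : d (eq_idem u v (G a) (G b)) = eq_idem u v (P a) (P b).
    by rewrite rmorph_sum; apply: eq_bigr => j _; rewrite rmorphM -!dG.
  rewrite e1 rmorph1 (eq_idem_pt _ _ HC uvS) asboolF => [/eqP|/Pi/eqP].
    by rewrite oner_eq0.
  by rewrite (negPf ne).
transitivity (\sum_a \sum_b kst D ((V (P a))^-1 * V (P b)) * eq_idem u v (G a) (G b)).
  under eq_bigr => j _ do rewrite mulr_suml.
  rewrite exchange_big; apply: eq_bigr => a _.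
  under eq_bigr => j _ do rewrite mulr_sumr.
  rewrite exchange_big; apply: eq_bigr => b _; rewrite mulr_sumr.
  by apply: eq_bigr => j _; rewrite kstM mulrACA.
rewrite -[X in _ = X%:R]card_ord -sumr_const; apply: eq_bigr => a _.
rewrite (bigD1 a) //= big1 => [|b ba]; last by rewrite E eq_sym (negPf ba) mulr0.
by rewrite E eqxx mulr1 addr0 mulVf // /kst !rmorph1.
Qed.

(* The two families [g \o G] and [g' \o G] of points of [C] in [E] agree up to a
   permutation, along which the weights [V] are multiplied by a constant. *)
Lemma res_twist (E : alg O) (e : hom E w) (g g' : hom D E) (s s' : path w w) :
  conn E -> hcomp e g = s D HD d -> hcomp e g' = s' D HD d ->
  (forall j, g (lres G j) = kst E (T (L s) / T (L s')) * g' (lres G j)) /\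
  (forall j, g (rres G j) = kst E (T (L s') / T (L s)) * g' (rres G j)).
Proof.
move=> cE eg eg'; case: Pb => P' PK P'K.
have egG a : hcomp e (hcomp g (G a)) = s C HC (P a).
  by rewrite hcompA eg -(pfun_nat s HC HD) dG.
have eg'G a : hcomp e (hcomp g' (G a)) = s' C HC (P a).
  by rewrite hcompA eg' -(pfun_nat s' HC HD) dG.
pose pi a := P' (path_inv s' C HC (s C HC (P a))).
have piE a : s' C HC (P (pi a)) = s C HC (P a).
  by rewrite /pi P'K path_invKr.
have pi_inj : injective pi.
  move=> a b ab; apply: (can_inj PK); apply: (path_inj (s := s) (HB := HC)).
  by rewrite -!piE ab.
have GE a : hcomp g (G a) = hcomp g' (G (pi a)).
  by apply: (hom_conn_eqw (q := e) HC cE); rewrite egG eg'G piE.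
have Vpi a : T (L s') * V (P (pi a)) = T (L s) * V (P a) by rewrite -!VE piE.
have Ts (q : path w w) : T (L q) != 0 by apply/T0/LN.
split=> j.
  rewrite !lres_hom /lres [X in _ = _ * X](reindex_inj pi_inj) mulr_sumr.
  apply: eq_bigr => a _; rewrite GE mulrA -kstM; congr (kst _ _ * _).
  apply: (mulIf (V0 (P a))); rewrite mulVf //.
  have -> : T (L s) / T (L s') / V (P (pi a)) * V (P a) =
     (T (L s) * V (P a)) / (T (L s') * V (P (pi a))).
    by rewrite invfM; ring.
  by rewrite Vpi mulfV // mulf_neq0.
rewrite !rres_hom /rres [X in _ = _ * X](reindex_inj pi_inj) mulr_sumr.
apply: eq_bigr => a _; rewrite GE mulrA -kstM; congr (kst _ _ * _).
by rewrite mulrAC Vpi mulrC mulKf.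
Qed.

End Resolvent.

End Kummer.

Section KummerUnit.
Variables (F : closedFieldType) (O : coordRing (F : comNzRingType) (torus 1)).
Let t := xuniv O ord0.
Let cO : conn O := coord_conn (O := O) (@torus_dom 1).
Variables (w : geomPt O) (l : nat) (Q : padicClosure l) (L : locsys Q w).
Variables (N : nat) (z : F) (z' : Q).
Hypotheses (F0 : [pchar F] =i pred0) (N0 : (0 < N)%N).
Hypotheses (zp : N.-primitive_root z) (zp' : N.-primitive_root z').
Hypothesis LN : forall s, L s ^+ N = 1.
Variables (T : Q -> F).
Hypothesis TE : forall k, T (z' ^+ k) = z ^+ k.

(** A single resolvent may have zeros. The products m_i n_j of resolvents of opposite weights are
    invariant and descend to a matrix [gam] over O, of rank one and trace r. Over the principal ring
    O a nonzero row of it is D0 times a unimodular vector v0, and combining the m_i with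
    coefficients v0_i / r gives an invertible function of the weight of [L]. *)
Lemma kummer_unit : exists (D : alg O) (d : hom D w) (HD : fet D) (f : D) (k1 k2 : nat),
  [/\ conn D, isUnit f, f ^+ N * astr D (t ^+ k1) = astr D (t ^+ k2) &
      forall s : path w w, s D HD d f = kst w (T (L s)) * d f].
Proof.
have [C [c [HC [cC LC]]]] := finite_order_open zp' LN.
have [V [V0 VE]] := fibre_weight N0 zp zp' LN TE cC LC.
have [_ [J [u [v uvS]]]] := fet_fsep HC.
have [r [P Pb]] := fibre_finT w HC.
have [D [d [HD cD dP]]] := dominate_fibre w cO HC.
have [G dG] := choice (fun i => dP (P i)).
pose m := lres V u P G; pose n := rres V v P G.
have LT s : T (L s) ^+ N = 1.
  have [i ->] := prim_rootP zp' (LN s).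
  by rewrite TE exprAC (prim_expr_order zp) expr1n.
have T0 s : T (L s) != 0.
  apply/eqP => x0; move/eqP: (LT s); rewrite x0 expr0n gtn_eqF //.
  by rewrite eq_sym oner_eq0.
have key (E : alg O) (e : hom E w) (g g' : hom D E) (s s' : path w w) : conn E ->
    hcomp e g = s D HD d -> hcomp e g' = s' D HD d ->
  (forall j, g (m j) = kst E (T (L s) / T (L s')) * g' (m j)) /\
  (forall j, g (n j) = kst E (T (L s') / T (L s)) * g' (n j)).
  exact: (res_twist N0 zp zp' LN TE V0 VE u v Pb dG).
have twist (E : alg O) (g g' : hom D E) : fet E -> conn E -> exists k : F,
    [/\ k != 0, k ^+ N = 1, forall j, g (m j) = kst E k * g' (m j) &
        forall j, g (n j) = kst E k^-1 * g' (n j)].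
  move=> HE cE; have [e _] := fibre_ne w cO HE.
  have [s sd] := path_ex HD d (hcomp e g) cO cD.
  have [s' s'd] := path_ex HD d (hcomp e g') cO cD.
  have [km kn] := key E e g g' s s' cE (esym sd) (esym s'd).
  exists (T (L s) / T (L s')); rewrite mulf_neq0 ?invr_eq0 // expr_div_n !LT divr1.
  by split=> // j; rewrite kn; congr (kst _ _ * _); rewrite invfM invrK mulrC.
have desc y := fet_descent w (y := y) cO HD.
have gam_ex i j : exists a, m i * n j = astr D a.
  apply: desc => E g g' HE cE; have [k [k0 _ km kn]] := twist E g g' HE cE.
  rewrite !rmorphM km kn mulrACA -[kst E k * _]kstM mulfV // /kst !rmorph1.
  by rewrite mul1r.
have /choice[gam /= gamE] : forall ij : J * J, exists a, m ij.1 * n ij.2 = astr D a.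
  by move=> ij; apply: gam_ex.
have gE i j : m i * n j = astr D (gam (i, j)) := gamE (i, j).
have ai := fet_inj cO HD.
have trg : \sum_j gam (j, j) = r%:R.
  apply: ai; rewrite rmorph_sum rmorph_nat -(res_sum HC V0 uvS Pb cD dG).
  by apply: eq_bigr => j _; rewrite -gE.
have r0 : r%:R != 0 :> F.
  have [h _] := fibre_ne w cO HC; case: Pb => P' _ _; have r0 : (0 < r)%N by apply: leq_ltn_trans (ltn_ord (P' h)).
  by rewrite (pcharf0P F).1 // -lt0n.
have rO : astr O r%:R^-1 * r%:R = 1.
  by rewrite -(rmorph_nat (astr O)) -rmorphM mulVf // rmorph1.
have dom (a b b' : O) : a <> 0 -> a * b = a * b' -> b = b'.
  move=> a0 E; have [|//|/eqP] := coord_dom (O := O) (@torus_dom 1) (y := a) (z := b - b').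
    by rewrite mulrBr E subrr.
  by rewrite subr_eq0 => /eqP.
have [i0 gi0] : exists i, gam (i, i) <> 0.
  apply: contrapT => no; have := trg; rewrite big1 => [E|i _].
    by move: rO; rewrite -E mulr0 => /eqP; rewrite eq_sym oner_eq0.
  by apply: contrapT => gi; apply: no; exists i.
have rk i j k h : gam (i, j) * gam (k, h) = gam (i, h) * gam (k, j).
  by apply: ai; rewrite !rmorphM -!gE; ring.
have [D0 [[u0 D0E] vE]] := laurent_bezout (fun j => gam (i0, j)).
have [v0 v0E] := choice vE.
have D00 : D0 <> 0 by move=> E; apply: gi0; rewrite v0E E mul0r.
(* The row vector v0 is fixed by gam / r, because gam has rank one, trace r and a row proportional
   to v0. *)
pose W j := \sum_i astr O r%:R^-1 * v0 i * gam (i, j).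
have WE j : W j = v0 j.
  apply: (dom D0) => //; rewrite -v0E mulr_sumr.
  transitivity (\sum_i gam (i0, j) * astr O r%:R^-1 * gam (i, i)).
    apply: eq_bigr => i _.
    transitivity (astr O r%:R^-1 * (D0 * v0 i * gam (i, j))); first by ring.
    by rewrite -v0E rk; ring.
  by rewrite -mulr_sumr trg -mulrA rO mulr1.
pose f := \sum_i astr D (astr O r%:R^-1 * v0 i) * m i.
pose n0 := \sum_j astr D (u0 j) * n j.
have fn j : f * n j = astr D (v0 j).
  rewrite -WE rmorph_sum mulr_suml; apply: eq_bigr => i _.
  by rewrite -mulrA gE -rmorphM.
have fn0 : f * n0 = 1.
  rewrite mulr_sumr; under eq_bigr => j _ do rewrite mulrCA fn -rmorphM.
  rewrite -rmorph_sum -(rmorph1 (astr D)); congr (astr D _).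
  apply: (dom D0) => //; rewrite mulr1 mulr_sumr {2}D0E; apply: eq_bigr => j _.
  by rewrite v0E; ring.
have fE (E : alg O) (g g' : hom D E) k : (forall j, g (m j) = kst E k * g' (m j)) ->
    g f = kst E k * g' f.
  move=> gm; rewrite !rmorph_sum mulr_sumr; apply: eq_bigr => i _.
  by rewrite !rmorphM gm !hmapE mulrCA.
have nE (E : alg O) (g g' : hom D E) k : (forall j, g (n j) = kst E k * g' (n j)) ->
    g n0 = kst E k * g' n0.
  move=> gm; rewrite !rmorph_sum mulr_sumr; apply: eq_bigr => i _.
  by rewrite !rmorphM gm !hmapE mulrCA.
have kX (E : alg O) k : k ^+ N = 1 -> kst E k ^+ N = 1.
  by move=> kN; rewrite /kst -!rmorphXn kN !rmorph1.
have [h0 h0E] : exists a, f ^+ N = astr D a.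
  apply: desc => E g g' HE cE; have [k [_ kN km _]] := twist E g g' HE cE.
  by rewrite !rmorphXn (fE _ _ _ _ km) exprMn kX // mul1r.
have [h1 h1E] : exists a, n0 ^+ N = astr D a.
  apply: desc => E g g' HE cE; have [k [_ kN _ kn]] := twist E g g' HE cE.
  by rewrite !rmorphXn (nE _ _ _ _ kn) exprMn kX ?exprVn ?kN ?invr1 // mul1r.
have [|a [k1 [k2 [a0 hE]]]] := @laurent_unit F O h0.
  by exists h1; apply: ai; rewrite rmorphM -h0E -h1E -exprMn fn0 expr1n rmorph1.
(* The field F is algebraically closed, so the constant a of the unit f^N is absorbed into f. *)
have [b bN] : exists b, b ^+ N = a.
  have /closed_rootP[b] : size ('X^N - a%:P) != 1%N by rewrite size_XnsubC // eqSS -lt0n.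
  by rewrite /root !hornerE subr_eq0 => /eqP bN; exists b.
have b0 : b != 0.
  by apply/eqP => b0; move/eqP: a0; apply; rewrite -bN b0 expr0n gtn_eqF.
exists D, d, HD, (kst D b^-1 * f), k1, k2; split=> //.
- apply: isUnitM; last by exists n0.
  by exists (kst D b); rewrite -kstM mulVf // /kst !rmorph1.
- rewrite exprMn h0E -mulrA -rmorphM hE rmorphM mulrA.
  have -> : kst D b^-1 ^+ N = kst D a^-1 by rewrite /kst -!rmorphXn exprVn bN.
  by rewrite -[astr D (astr O a)]/(kst D a) -kstM mulVf // /kst !rmorph1 mul1r.
- move=> s; have [E [g1 [g2 [x [HE cE xg1 xg2]]]]] := dominate cO (s D HD d) d HD HD.
  have L1 : L (path_id w) = 1.
    apply: (mulfI (lchar_neq0 L (path_id w))); rewrite mulr1.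
    by rewrite -(@lcharM _ _ _ _ L (path_id w) (path_id w) (path_id w)).
  have [km _] := key E x g1 g2 s (path_id w) cE xg1 xg2.
  have gf := fE _ _ _ _ km.
  rewrite -xg1 rmorphM [d _]rmorphM (kst_hom (hcomp x g1)) (kst_hom d) mulrCA; congr (_ * _).
  rewrite -[LHS]/(x (g1 f)) gf rmorphM (kst_hom x) L1.
  have T1 : T 1 = 1 by rewrite -(expr0 z') TE.
  by rewrite T1 divr1 -[d f]/((path_id w) D HD d f) -xg2.
Qed.
End KummerUnit.

Section KummerChar.
Variables (F : closedFieldType) (O : coordRing (F : comNzRingType) (torus 1)).
Let t := xuniv O ord0.
Let cO : conn O := coord_conn (O := O) (@torus_dom 1).
Variables (Gam : finType) (gadd : Gam -> Gam -> Gam) (mu : Gam -> F) (N : nat).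
Hypotheses (muD : forall c d, mu (gadd c d) = mu c * mu d) (mui : injective mu).
Hypotheses (muN : forall c, mu c ^+ N = 1) (cG : #|Gam| = N) (N0 : (0 < N)%N).
Hypotheses (F0 : [pchar F] =i pred0).
Variable th : hom O O.
Hypothesis tht : th t = t ^+ N.

Lemma theta_lift (T : alg O) (y : T) : isUnit y -> y ^+ N = astr T t ->
  exists h : hom (Alg (hmap th)) T, h t = y.
Proof.
move=> uy yN; have [h0 h0t] := @torus1_hom F O (resAlg (astr O) T) y uy.
pose a : hom O (resAlg (astr O) T) :=
  @Hom _ O (resAlg (astr O) T) (astr T) (fun=> erefl).
have E : hcomp h0 th = a.
  by apply: torus1_uniq; rewrite /= -/t tht rmorphXn h0t yN.
by exists (@Hom O (Alg (hmap th)) T (hmap h0)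
   (fun s => f_equal (fun g : hom O (resAlg (astr O) T) => g s) E)).
Qed.

(** Here f^N is tau = t^(k2 - k1). The pull-back [Km] of theta along t |-> tau maps both to D, by f,
    and to theta itself, by a multiple of tau. Comparison at one point reads L s from the action on
    tau, as mu(c)^(k2 - k1) carried back by [T']. *)
Lemma kummer_char (w : geomPt O) (l : nat) (Q : padicClosure l) (L : locsys Q w) :
  (forall s, L s ^+ N = 1) ->
  exists2 chi, is_char gadd chi & char_of (theta_act muN N0 tht) L chi.
Proof.
move=> LN.
have [z zp] : exists z : F, N.-primitive_root z.
  by apply: prim_root_ex => //; rewrite (pcharf0P F).1 // -lt0n.
have [z' zp'] : exists z : Q, N.-primitive_root z.
  by apply: prim_root_ex => //; rewrite (pcharf0P Q).1 -?lt0n //; apply: pc_char0.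
have [T TE] := transfer_ex N0 zp' zp; have [T' T'E] := transfer_ex N0 zp zp'.
have [D [d [HD [f [k1 [k2 [cD uf fN sf]]]]]]] := kummer_unit F0 N0 zp zp' LN TE.
have [t' tt'] : isUnit t by exact: torus1_unit.
have tI i : t ^+ i * t' ^+ i = 1 by rewrite -exprMn tt' expr1n.
have mu0 c : mu c != 0 by exact: (mu_neq0 muN N0).
have NF : N%:R != 0 :> F by rewrite (pcharf0P F).1 // -lt0n.
have TH := theta_torsor muD mui muN cG N0 NF tht.
pose act := theta_act muN N0 tht.
have act_t c : act c t = astr O (mu c) * t := theta_actE muN N0 tht c.
have act_S c s : act c (astr O s) = astr O s := theta_act_S muN N0 tht c s.
have th_S s : th (astr O s) = astr O s by exact: (hmapE th).
have tht' : th t' = t' ^+ N.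
  have u : isUnit (th t) by exact/isUnit_hom/torus1_unit.
  by apply: (isUnit_inj u); rewrite -rmorphM tt' rmorph1 tht tI.
pose tau := t ^+ k2 * t' ^+ k1.
have utau : isUnit tau.
  by apply: isUnitM; apply: isUnitX; [exact: torus1_unit|exists t; rewrite mulrC].
have fN' : f ^+ N = astr D tau.
  rewrite /tau rmorphM -fN -mulrA -rmorphM tI rmorph1 mulr1 //.
have [psi psit] := @torus1_hom F O O tau utau.
have [g1 g1t] := @theta_lift (resAlg (hmap psi) D) f uf (etrans fN' (f_equal _ (esym psit))).
have [Km [i [HK Ki _]]] := pushout_ex g1 (tor_fet TH).
have [u1 u1E] := pushout_lift Ki g1.
have [h _] := fibre_ne w cO (tor_fet TH).
have hS s : h (astr O s) = gmap w (astr O s).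
  by rewrite -(hmapE h) /= th_S.
have th_tau : th tau = tau ^+ N.
  by rewrite /tau rmorphM !rmorphXn tht tht' exprMn -!exprM ![(N * _)%N]mulnC.
have htau : h tau ^+ N = gmap w tau.
  by rewrite -rmorphXn -th_tau; exact: (hmapE h).
have htau0 : h tau != 0 by exact/isUnit_field/isUnit_hom.
(* The root of unity mu(c') makes the points of [Km] induced by d and by h coincide. *)
have [c' c'E] : exists c', d f / h tau = gmap w (astr O (mu c')).
  apply: (roots_unity_all (mu := fun c => gmap w (astr O (mu c))) _ _ cG N0).
  - by move=> a b /(fmorph_inj (gmap w \o astr O))/mui.
  - by move=> c; rewrite -!rmorphXn muN !rmorph1.
  rewrite expr_div_n htau -rmorphXn fN' (hmapE d) /= mulfV //.
  exact/isUnit_field/isUnit_hom.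
have uy : isUnit (astr O (mu c') * tau).
  by apply: isUnitM => //; apply/isUnit_hom/isUnit_field.
have [|g2 g2t] := @theta_lift (resAlg (hmap psi) (Alg (hmap th))) (astr O (mu c') * tau) uy.
  by rewrite /= psit exprMn -rmorphXn muN rmorph1 mul1r th_tau.
have [u2 u2E] := pushout_lift Ki g2.
have u1t : u1 (i t) = f.
  by rewrite -g1t -u1E.
have u2t : u2 (i t) = astr O (mu c') * tau by rewrite -g2t -u2E.
have du : hcomp d u1 = hcomp h u2.
  apply: (pushout_uniq (T := w) Ki).
  apply: (theta_hom_eq (T := resAlg (hmap psi) w)); rewrite /= -/t u1t u2t.
  by rewrite rmorphM hS -c'E divfK.
have df0 : d f != 0 by exact/isUnit_field/isUnit_hom.
have act_tau c : act c tau = astr O (mu c ^+ k2 / mu c ^+ k1) * tau.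
  have act_t' : act c t' = astr O (mu c)^-1 * t'.
    have u : isUnit (act c t) by exact/isUnit_hom/torus1_unit.
    apply: (isUnit_inj u); rewrite -[LHS]rmorphM tt' rmorph1 act_t mulrACA.
    by rewrite -rmorphM mulfV ?mu0 // rmorph1 mul1r tt'.
  rewrite /tau rmorphM !rmorphXn act_t act_t' !exprMn rmorphM rmorphXn.
  by rewrite -exprVn rmorphXn mulrACA.
have LE (s : path w w) c : s _ (tor_fet TH) h = hcomp h (act c) ->
    T (L s) = mu c ^+ k2 / mu c ^+ k1.
  move=> sh; apply: (fmorph_inj (gmap w \o astr O)).
  apply: (mulIf df0); rewrite /= -[LHS]sf.
  have : hcomp (s D HD d) u1 = hcomp (s _ (tor_fet TH) h) u2.
    by rewrite -!(pfun_nat s HK) du.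
  move/(f_equal (fun g : hom Km w => g (i t))); rewrite /= u1t u2t sh => ->.
  rewrite [LHS]rmorphM /= -/(act c) act_S act_tau rmorphM !hS mulrA mulrAC.
  by rewrite -[gmap w (astr O (mu c'))]c'E divfK // mulrC.
pose nu c := mu c ^+ k2 / mu c ^+ k1.
have nuz c : exists k, nu c = z ^+ k.
  have nuN : nu c ^+ N = 1.
    by rewrite expr_div_n ![_ ^+ _ ^+ N]exprAC muN !expr1n divr1.
  by have [k ->] := prim_rootP zp nuN; exists k.
exists (fun c => T' (nu c)).
  split=> [c|a b].
    have [k ->] := nuz c; rewrite T'E expf_neq0 //.
    apply/eqP => z0; have /eqP := prim_expr_order zp'.
    by rewrite z0 expr0n gtn_eqF // eq_sym oner_eq0.
  have -> : nu (gadd a b) = nu a * nu b.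
    by rewrite /nu muD !exprMn invfM mulrACA.
  by have [k ->] := nuz a; have [k' ->] := nuz b; rewrite -exprD !T'E exprD.
move=> HB s h' c; rewrite (Prop_irrelevance HB (tor_fet TH)) => /(path_torsor h) sh.
have [k Lk] := prim_rootP zp' (LN s).
by rewrite -[nu c](LE s c sh) {1 2}Lk TE T'E.
Qed.
End KummerChar.

(** * Units of Z_p *)

Section Padic.
Variables (p : nat) (Q : padicClosure p).
Hypothesis pp : prime p.
Local Notation v := (@pval p Q).
Implicit Types (x y : Q) (M : rat) (k : nat).

(** The bound v(x) >= M with the convention v(0) = +oo, since [pval 0] is meaningless. *)
Definition vge M x := x = 0 \/ M <= v x.

Lemma near_vge M x y : near v M x y <-> vge M (x - y).
Proof.
rewrite /near /vge; split=> -[E|?]; [left|right|left|right] => //.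
  by rewrite E subrr.
by apply/eqP; rewrite -subr_eq0 E.
Qed.

Lemma pval1 : v 1 = 0.
Proof.
have := @pvalM p Q 1 1 (oner_neq0 _) (oner_neq0 _); rewrite mulr1 => E.
by apply: (@addrI _ (v 1)); rewrite addr0 -E.
Qed.

Lemma pvalN x : v (- x) = v x.
Proof.
have [->|x0] := eqVneq x 0; first by rewrite oppr0.
have N1 : (-1 : Q) != 0 by rewrite oppr_eq0 oner_neq0.
have := pvalM N1 N1; rewrite mulrNN mulr1 pval1 => E.
rewrite -mulN1r pvalM //; lra.
Qed.

Lemma vge_le M M' x : M' <= M -> vge M x -> vge M' x.
Proof. by move=> H [->|Mx]; [left|right; apply: le_trans Mx]. Qed.
Lemma vgeN M x : vge M x -> vge M (- x).
Proof. by case=> [->|?]; [rewrite oppr0; left|right; rewrite pvalN]. Qed.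
Lemma vgeD M x y : vge M x -> vge M y -> vge M (x + y).
Proof.
move=> [->|Mx]; first by rewrite add0r.
move=> [->|My]; first by rewrite addr0; right.
have [->|x0] := eqVneq x 0; first by rewrite add0r; right.
have [->|y0] := eqVneq y 0; first by rewrite addr0; right.
have [->|xy0] := eqVneq (x + y) 0; first by left.
by right; apply: le_trans (pvalD x0 y0 xy0); rewrite le_min Mx My.
Qed.
Lemma vgeB M x y : vge M x -> vge M y -> vge M (x - y).
Proof. by move=> Hx Hy; apply: vgeD => //; apply: vgeN. Qed.
Lemma vge_sum M (I : Type) (r : seq I) (P : pred I) (F : I -> Q) :
  (forall i, P i -> vge M (F i)) -> vge M (\sum_(i <- r | P i) F i).
Proof. by move=> H; elim/big_ind: _ => //; [left|exact: vgeD]. Qed.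
Lemma vgeM M M' x y : vge M x -> vge M' y -> vge (M + M') (x * y).
Proof.
move=> [->|Mx]; first by rewrite mul0r; left.
move=> [->|My]; first by rewrite mulr0; left.
have [->|x0] := eqVneq x 0; first by rewrite mul0r; left.
have [->|y0] := eqVneq y 0; first by rewrite mulr0; left.
by right; rewrite pvalM // lerD.
Qed.
Lemma vgeMl M x y : vge 0 x -> vge M y -> vge M (x * y).
Proof. by move=> Hx Hy; rewrite -[M]add0r; apply: vgeM. Qed.
Lemma vgeMr M x y : vge M x -> vge 0 y -> vge M (x * y).
Proof. by move=> Hx Hy; rewrite mulrC; apply: vgeMl. Qed.
Lemma vge1 : vge 0 1. Proof. by right; rewrite pval1. Qed.
Lemma vgeX x k : vge 0 x -> vge 0 (x ^+ k).
Proof.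
by move=> Hx; elim: k => [|k IH]; [exact: vge1|rewrite exprS; apply: vgeMl].
Qed.
Lemma vge_nat k : vge 0 (k%:R : Q).
Proof.
elim: k => [|k IH]; first by left.
by rewrite -natr1; apply: vgeD => //; apply: vge1.
Qed.
Lemma vge_trans M x y z : vge M (x - y) -> vge M (y - z) -> vge M (x - z).
Proof. by move=> a b; have := vgeD a b; rewrite addrA subrK. Qed.
Lemma vge_sym M x y : vge M (x - y) -> vge M (y - x).
Proof. by move=> /vgeN; rewrite opprB. Qed.

Lemma Qnat_eq0 k : (k%:R == 0 :> Q) = (k == 0%N).
Proof. by rewrite (pcharf0P Q).1 //; apply: pc_char0. Qed.
Lemma Qp_neq0 : (p%:R : Q) != 0.
Proof. by rewrite Qnat_eq0 -lt0n prime_gt0. Qed.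
Lemma pvalX x k : x != 0 -> v (x ^+ k) = v x *+ k.
Proof.
move=> x0; elim: k => [|k IH]; first by rewrite expr0 pval1.
by rewrite exprS pvalM ?expf_neq0 // IH mulrS.
Qed.
Lemma pvalpX k : v (p%:R ^+ k) = k%:R.
Proof. by rewrite pvalX ?Qp_neq0 // pvalp. Qed.
Lemma pvalV x : x != 0 -> v x^-1 = - v x.
Proof.
move=> x0; have := pvalM x0 (invr_neq0 x0); rewrite mulfV // pval1 => E; lra.
Qed.
Lemma vgepX k : vge k%:R (p%:R ^+ k : Q). Proof. by right; rewrite pvalpX. Qed.
Lemma vgepXM k x : vge 0 x -> vge k%:R (p%:R ^+ k * x).
Proof. by move=> Hx; apply: vgeMr => //; apply: vgepX. Qed.
Lemma vge_dvd k a : (p ^ k %| a)%N -> vge k%:R (a%:R : Q).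
Proof.
by move=> /dvdnP[c ->]; rewrite mulnC natrM natrX; apply/vgepXM/vge_nat.
Qed.

Lemma vge1_false M : 0 < M -> ~ vge M (1 : Q).
Proof. by move=> M0 [/eqP|]; rewrite ?oner_eq0 // pval1; lra. Qed.

(** By Bezout, if a and p both had positive valuation, so would 1. *)
Lemma pval_coprime a : coprime p a -> v (a%:R : Q) = 0.
Proof.
move=> cpa.
have a0 : (0 < a)%N.
  by case: a cpa => //; rewrite /coprime gcdn0 => /eqP p1; move: pp; rewrite p1.
have Qa : (a%:R : Q) != 0 by rewrite Qnat_eq0 -lt0n.
case: (vge_nat a) => [/eqP|va]; first by rewrite (negPf Qa).
have [u w E _] := egcdnP p a0.
have g1 : gcdn a p = 1%N by rewrite gcdnC; exact/eqP.
apply/eqP; rewrite eq_le va andbT leNgt; apply/negP => va0.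
have E1 : (1 : Q) = u%:R * a%:R - w%:R * p%:R.
  by rewrite -!natrM E g1 natrD addrAC subrr add0r.
have [e [e0 e1 ea]] : exists e : rat, [/\ 0 < e, e <= 1 & e <= v (a%:R : Q)].
  by case: (leP 1 (v (a%:R : Q))) => H; [exists 1|exists (v (a%:R : Q))]; split=> //; apply: ltW.
apply: (vge1_false e0); rewrite E1; apply: vgeB.
  by apply: vgeMl; [exact: vge_nat|right].
by apply: vgeMl; [exact: vge_nat|right; rewrite pvalp].
Qed.

Lemma pval_nat a : (0 < a)%N -> v (a%:R : Q) = (logn p a)%:R.
Proof.
move=> a0; case: (pfactor_coprime pp a0) => m cpm E.
rewrite {1}E natrM pvalM ?Qnat_eq0.
- by rewrite pval_coprime // add0r natrX pvalpX.
- by apply/eqP => m0; move: a0; rewrite E m0.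
- by rewrite expn_eq0 -leqn0 leqNgt prime_gt0.
Qed.

Lemma vge_natP k a : vge k%:R (a%:R : Q) <-> (p ^ k %| a)%N.
Proof.
split; last exact: vge_dvd.
case: (posnP a) => [->|a0]; first by rewrite dvdn0.
case=> [/eqP|]; first by rewrite Qnat_eq0 eqn0Ngt a0.
by rewrite pval_nat // ler_nat pfactor_dvdn.
Qed.

Lemma nat_ge M : exists k, M <= k%:R.
Proof.
exists (Num.bound `|M|); apply: le_trans (ler_norm _) (ltW _).
exact: archi_boundP.
Qed.

Lemma vge_all0 x : (forall k, vge k%:R x) -> x = 0.
Proof.
move=> H; have [k kx] := nat_ge (v x + 1).
by case: (H k) => // kv; have := le_trans kx kv; rewrite -subr_ge0 opprD addrA subrr add0r oppr_ge0 ler10.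
Qed.

(** Z_p as the closure of the natural numbers, equivalent to [isZp] by [zpP]; in this form ring
    operations become congruences. *)
Definition zp x := forall k, exists m : nat, vge k%:R (x - m%:R).

Lemma zp_nat a : zp a%:R.
Proof. by move=> k; exists a; rewrite subrr; left. Qed.
Lemma zp_vge x : zp x -> vge 0 x.
Proof.
move=> /(_ 0%N)[m H]; rewrite -[x](subrK m%:R); apply: vgeD => //; exact: vge_nat.
Qed.
Lemma zpD x y : zp x -> zp y -> zp (x + y).
Proof.
move=> zx zy k; have [a Ha] := zx k; have [b Hb] := zy k; exists (a + b)%N.
by rewrite natrD opprD addrACA; apply: vgeD.
Qed.
Lemma zpM x y : zp x -> zp y -> zp (x * y).
Proof.
move=> zx zy k; have [a Ha] := zx k; have [b Hb] := zy k; exists (a * b)%N.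
have -> : x * y - (a * b)%:R = x * (y - b%:R) + (x - a%:R) * b%:R.
  by rewrite natrM; ring.
by apply: vgeD; [apply: vgeMl => //; apply: zp_vge|apply: vgeMr => //; apply: vge_nat].
Qed.
Lemma zpN x : zp x -> zp (- x).
Proof.
move=> zx k; have [a Ha] := zx k; exists (a * (p ^ k).-1)%N.
have -> : - x - (a * (p ^ k).-1)%:R = - (x - a%:R) - (a * p ^ k)%:R.
  have pk : (0 < p ^ k)%N by rewrite expn_gt0 prime_gt0.
  by rewrite -{2}(prednK pk) mulnS natrD; ring.
by apply: vgeB; [exact: vgeN|apply: vge_dvd; rewrite dvdn_mull].
Qed.
Lemma zpB x y : zp x -> zp y -> zp (x - y).
Proof. by move=> zx zy; apply: zpD => //; apply: zpN. Qed.
Lemma zpX x k : zp x -> zp (x ^+ k).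
Proof.
move=> zx; elim: k => [|k IH]; first exact: (zp_nat 1).
by rewrite exprS; apply: zpM.
Qed.
Lemma zp_sum (I : Type) (r : seq I) (P : pred I) (F : I -> Q) :
  (forall i, P i -> zp (F i)) -> zp (\sum_(i <- r | P i) F i).
Proof. by move=> H; elim/big_ind: _ => //; [exact: (zp_nat 0)|exact: zpD]. Qed.

Lemma zp_close x : (forall k, exists2 y, zp y & vge k%:R (x - y)) -> zp x.
Proof.
move=> H k; have [y zy xy] := H k; have [m ym] := zy k.
by exists m; apply: vge_trans xy ym.
Qed.

Lemma zp_div x k : zp x -> vge k%:R x -> exists2 y, zp y & x = p%:R ^+ k * y.
Proof.
move=> zx kx; have pk0 : (p%:R ^+ k : Q) != 0 by rewrite expf_neq0 ?Qp_neq0.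
exists (x / p%:R ^+ k); last by rewrite mulrC divfK.
move=> j; have [m xm] := zx (k + j)%N.
have /vge_natP/dvdnP[q mq] : vge k%:R (m%:R : Q).
  rewrite -[m%:R](subKr x); apply: vgeB => //; apply: vge_le xm.
  by rewrite ler_nat leq_addr.
exists q; have -> : x / p%:R ^+ k - q%:R = (x - m%:R) * (p%:R ^+ k)^-1.
  by rewrite mulrBl mq natrM natrX mulfK.
have -> : (j%:R : rat) = (k + j)%:R + - k%:R by rewrite natrD; lra.
by apply: vgeM => //; right; rewrite pvalV // pvalpX.
Qed.

Lemma unit_vge M u x : u != 0 -> v u = 0 -> vge M (u * x) -> vge M x.
Proof.
move=> u0 vu H; rewrite -[x](mulKf u0); apply: vgeMl => //.
by right; rewrite pvalV // vu oppr0.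
Qed.

Lemma zpV x : zp x -> x != 0 -> v x = 0 -> zp x^-1.
Proof.
move=> zx x0 vx k; case: k => [|k].
  by exists 0%N; rewrite subr0; right; rewrite pvalV // vx oppr0.
have [m xm] := zx k.+1.
have cpm : coprime p m.
  rewrite prime_coprime //; apply/negP => pm.
  have : vge 1 x.
    rewrite -[x](subrK m%:R); apply: vgeD; first by apply: vge_le xm; rewrite ler1n.
    by apply: (@vge_dvd 1); rewrite expn1.
  by case=> [/eqP|]; rewrite ?(negPf x0) // vx ler10.
have cpk : coprime m (p ^ k.+1) by rewrite coprime_sym coprimeXl.
have m0 : (0 < m)%N.
  by case: m cpm {xm cpk} => //; rewrite /coprime gcdn0 => /eqP p1; move: pp; rewrite p1.
have [c w E _] := egcdnP (p ^ k.+1) m0.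
exists c; apply: (unit_vge x0 vx); rewrite mulrBr mulfV //.
have -> : 1 - x * c%:R = - ((x - m%:R) * c%:R + w%:R * (p ^ k.+1)%:R).
  have : ((c * m)%:R : Q) = (w * p ^ k.+1 + 1)%:R by rewrite E (eqP cpk).
  by rewrite natrD !natrM => H; rewrite mulrBl [m%:R * _]mulrC H; ring.
apply/vgeN/vgeD; first by apply: vgeMr => //; apply: vge_nat.
by apply: vgeMl; [exact: vge_nat|apply: vge_dvd].
Qed.

Lemma zp_rat (u : rat) : vge 0 (ratr u : Q) -> zp (ratr u).
Proof.
rewrite /ratr => H.
have d0 : (0 < `|denq u|)%N by rewrite absz_gt0 denq_neq0.
have dE : (denq u)%:~R = (`|denq u|)%:R :> Q by rewrite -[in LHS]absz_denq.
rewrite dE in H *.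
have zn : zp (numq u)%:~R.
  rewrite [numq u]intEsign rmorphM /= rmorphXn /= rmorphN1.
  by apply: zpM; [apply/zpX/zpN/(zp_nat 1)|apply: zp_nat].
have Qd : (`|denq u|%:R : Q) != 0 by rewrite Qnat_eq0 -lt0n.
have [pd|] := boolP (p %| `|denq u|)%N; last first.
  rewrite -prime_coprime // => cpd; apply: zpM => //; apply: zpV => //.
    exact: zp_nat.
  exact: pval_coprime.
exfalso; have cnd := coprime_num_den u.
have pn : coprime p `|numq u|.
  rewrite prime_coprime //; apply/negP => pn.
  have : (p %| gcdn `|numq u| `|denq u|)%N by rewrite dvdn_gcd pn.
  by rewrite (eqP cnd) dvdn1 => /eqP p1; move: pp; rewrite p1.
have vn : v ((numq u)%:~R : Q) = 0.
  rewrite [numq u]intEsign rmorphM /= rmorphXn /= rmorphN1.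
  case: (_ < 0); rewrite ?expr1 ?expr0 ?mulN1r ?mul1r ?pvalN; exact: pval_coprime.
have n0 : ((numq u)%:~R : Q) != 0.
  rewrite [numq u]intEsign rmorphM /= rmorphXn /= rmorphN1 mulf_neq0 ?signr_eq0 //.
  rewrite Qnat_eq0; apply/eqP => E.
  by move: pn; rewrite E /coprime gcdn0 => /eqP p1; move: pp; rewrite p1.
case: H => [/eqP|]; first by rewrite mulf_eq0 invr_eq0 (negPf n0) (negPf Qd).
rewrite pvalM ?invr_neq0 // vn pvalV // add0r oppr_ge0 pval_nat //.
by rewrite (lern0 rat) => /eqP E; move: pd; rewrite -(expn1 p) pfactor_dvdn // E.
Qed.

Lemma limit_nat (u : nat -> Q) x :
  limit v u x <-> forall k, exists m, forall i, (m <= i)%N -> vge k%:R (u i - x).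
Proof.
split=> H.
  by move=> k; have [m Hm] := H k%:R; exists m => i /Hm/near_vge.
move=> M; have [k Mk] := nat_ge M; have [m Hm] := H k; exists m => i /Hm ui.
by apply/near_vge; apply: vge_le ui.
Qed.

Lemma zpP x : isZp x <-> zp x.
Proof.
split=> [[[u Hu] /near_vge]|zx].
  rewrite subr0 => x0; apply: zp_close => k.
  have [m /(_ m (leqnn m)) Hm] := (limit_nat _ _).1 Hu k.
  exists (ratr (u m)); last exact: vge_sym.
  apply: zp_rat; rewrite -[ratr _](subrK x); apply: vgeD => //.
  by apply: vge_le Hm; rewrite ler0n.
split; last by apply/near_vge; rewrite subr0; apply: zp_vge.
have [m mx] := choice zx.
exists (fun i => (m i)%:R); apply/limit_nat => k; exists k => i ki.
rewrite ratr_nat; apply: vge_sym; apply: vge_le (mx i); by rewrite ler_nat.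
Qed.

(** Completeness is given for rational sequences, so the terms are replaced by natural numbers
    approximating them with growing precision. *)
Lemma zp_complete (u : nat -> Q) : (forall i, zp (u i)) ->
  (forall k, exists m, forall i, (m <= i)%N -> vge k%:R (u i.+1 - u i)) ->
  exists x, zp x /\ limit v u x.
Proof.
move=> zu Hu; have /choice[a aE] i := zu i i.
have cau k : exists m, forall i j, (m <= i)%N -> (i <= j)%N -> vge k%:R (u j - u i).
  have [m Hm] := Hu k; exists m => i j mi /subnK <-.
  elim: (j - i)%N => [|d IH]; first by rewrite subrr; left.
  rewrite addSn; apply: vge_trans IH; apply: Hm.
  exact: leq_trans mi (leq_addl _ _).
have auk k i : (k <= i)%N -> vge k%:R (u i - (a i)%:R).
  by move=> ki; apply: vge_le (aE i); rewrite ler_nat.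
have [M|x Hx] := @pc_complete p Q (fun i => (a i)%:R).
  have [k Mk] := nat_ge M; have [m Hm] := cau k; exists (maxn m k) => i j.
  rewrite !geq_max => /andP[mi ki] /andP[mj kj].
  apply/near_vge; rewrite !ratr_nat; apply: (vge_le Mk).
  apply: (vge_trans (y := u i)); first exact/vge_sym/auk.
  apply: (vge_trans (y := u j)); last exact/auk.
  by case/orP: (leq_total i j) => ij; [apply/vge_sym/Hm|apply/Hm].
have Hx' : limit v u x.
  apply/limit_nat => k; have [m Hm] := (limit_nat _ _).1 Hx k.
  exists (maxn m k) => i; rewrite geq_max => /andP[mi ki].
  by apply: vge_trans (auk k i ki) _; have := Hm i mi; rewrite ratr_nat.
exists x; split=> //; apply: zp_close => k.
have [m /(_ m (leqnn _)) Hm] := (limit_nat _ _).1 Hx' k.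
by exists (u m) => //; apply: vge_sym.
Qed.

Lemma limit_uniq (u : nat -> Q) x y : limit v u x -> limit v u y -> x = y.
Proof.
move=> /limit_nat Hx /limit_nat Hy; apply/eqP; rewrite -subr_eq0; apply/eqP.
apply: vge_all0 => k; have [m Hm] := Hx k; have [m' Hm'] := Hy k.
apply: (vge_trans (y := u (maxn m m'))).
  by apply/vge_sym/Hm; rewrite leq_maxl.
by apply/Hm'; rewrite leq_maxr.
Qed.

Lemma limit_vge (u : nat -> Q) x y M : limit v u x ->
  (exists m, forall i, (m <= i)%N -> vge M (u i - y)) -> vge M (x - y).
Proof.
move=> Hx [m Hm]; have [m' Hm'] := Hx M.
apply: (vge_trans (y := u (maxn m m'))).
  by apply/vge_sym/near_vge/Hm'; rewrite leq_maxr.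
by apply: Hm; rewrite leq_maxl.
Qed.
End Padic.

(** * Reduction modulo p and Teichmuller representatives *)

Section Teichmuller.
Variables (p : nat) (Q : padicClosure p).
Hypothesis pp : prime p.
Local Notation v := (@pval p Q).
Implicit Types (x y : Q) (k : nat).

Lemma Fp_nat_dvd (a b : nat) : (a%:R == b%:R :> 'F_p) = (a == b %[mod p]).
Proof.
wlog ab : a b / (b <= a)%N => [H|].
  by case/orP: (leq_total b a) => ?; [apply: H|rewrite eq_sym [RHS]eq_sym; apply: H].
rewrite -subr_eq0 -natrB // -(dvdn_pcharf (pchar_Fp pp)).
by rewrite eqn_mod_dvd.
Qed.

Definition red x (a : 'F_p) := vge 1 (x - (a : nat)%:R).

Lemma red_nat (m : nat) : red m%:R m%:R.
Proof.
rewrite /red; have : (m%:R : 'F_p) == ((m%:R : 'F_p) : nat)%:R by rewrite natr_Zp.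
rewrite Fp_nat_dvd; set b := nat_of_ord _ => mb.
wlog ab : m b mb / (b <= m)%N => [H|].
  case/orP: (leq_total b m) => bm; first exact: H.
  by apply: vge_sym; apply: H => //; rewrite eq_sym.
rewrite -natrB //. by apply: (@vge_dvd p Q pp 1); rewrite expn1 -eqn_mod_dvd.
Qed.

Lemma red_vge x y a : red x a -> vge 1 (y - x) -> red y a.
Proof. by move=> xa yx; apply: vge_trans yx xa. Qed.

Lemma redD x y a b : red x a -> red y b -> red (x + y) (a + b).
Proof.
move=> xa yb; apply: (@red_vge ((a : nat) + (b : nat))%N%:R).
  have -> : a + b = ((a : nat) + (b : nat))%N%:R by rewrite natrD !natr_Zp.
  exact: red_nat.
by rewrite natrD opprD addrACA; apply: vgeD.
Qed.

Lemma red_vge0 x a : red x a -> vge 0 x.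
Proof.
move=> xa; rewrite -[x](subrK (a : nat)%:R); apply: vgeD; last exact: vge_nat.
by apply: vge_le xa; rewrite ler01.
Qed.

Lemma redM x y a b : red x a -> red y b -> red (x * y) (a * b).
Proof.
move=> xa yb; apply: (@red_vge ((a : nat) * (b : nat))%N%:R).
  have -> : a * b = ((a : nat) * (b : nat))%N%:R by rewrite natrM !natr_Zp.
  exact: red_nat.
have -> : x * y - ((a : nat) * (b : nat))%N%:R
    = x * (y - (b : nat)%:R) + (x - (a : nat)%:R) * (b : nat)%:R.
  by rewrite natrM; ring.
apply: vgeD; first by apply: vgeMl => //; exact: red_vge0 xa.
by apply: vgeMr => //; apply: vge_nat.
Qed.

Lemma redN x a : red x a -> red (- x) (- a).
Proof.
move=> xa; have := redM (red_nat p.-1) xa.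
have -> : (p.-1%:R : 'F_p) = -1.
  apply/eqP; rewrite -subr_eq0 opprK natr1 prednK ?prime_gt0 //.
  by rewrite pchar_Fp_0.
rewrite mulN1r => H; apply: (red_vge H).
have -> : - x - p.-1%:R * x = - (p%:R * x).
  have -> : (p%:R : Q) = p.-1%:R + 1 by rewrite natr1 prednK ?prime_gt0.
  by ring.
apply: vgeN; apply: vgeMr (red_vge0 xa).
by apply: (@vge_dvd p Q pp 1); rewrite expn1.
Qed.

Lemma redX x a k : red x a -> red (x ^+ k) (a ^+ k).
Proof.
move=> xa; elim: k => [|k IH]; first exact: (red_nat 1).
by rewrite !exprS; apply: redM.
Qed.

Lemma red_int (a : int) : red a%:~R a%:~R.
Proof.
rewrite [a]intEsign !rmorphM /= !rmorphXn /= !rmorphN1.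
apply: redM; last exact: red_nat.
by apply: redX; apply: redN; apply: (red_nat 1).
Qed.

Lemma red_sum (I : Type) (r : seq I) (F : I -> Q) (F' : I -> 'F_p) :
  (forall i, red (F i) (F' i)) -> red (\sum_(i <- r) F i) (\sum_(i <- r) F' i).
Proof.
by move=> H; elim/big_ind2: _ => //; [exact: (red_nat 0)|move=> *; exact: redD].
Qed.

Lemma red_prod (I : Type) (r : seq I) (F : I -> Q) (F' : I -> 'F_p) :
  (forall i, red (F i) (F' i)) -> red (\prod_(i <- r) F i) (\prod_(i <- r) F' i).
Proof.
by move=> H; elim/big_ind2: _ => //; [exact: (red_nat 1)|move=> *; exact: redM].
Qed.

Lemma red_inj x a b : red x a -> red x b -> a = b.
Proof.
move=> xa xb; have H : vge 1 ((a : nat)%:R - (b : nat)%:R : Q).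
  by apply: vge_trans xb; apply: vge_sym.
apply/eqP; rewrite -[a]natr_Zp -[b]natr_Zp Fp_nat_dvd.
wlog ab : a b H {xa xb} / (b <= a)%N => [W|].
  case/orP: (leq_total b a) => ba; first exact: W.
  by rewrite eq_sym; apply: W => //; apply: vge_sym.
rewrite -natrB // in H; rewrite eqn_mod_dvd //.
by have := (vge_natP Q pp 1 (a - b)).1 H; rewrite expn1.
Qed.

Lemma red_ex x : zp x -> exists a, red x a.
Proof.
move=> /(_ 1%N)[m xm]; exists m%:R; exact: red_vge (red_nat m) xm.
Qed.

(** Modulo x - y the cofactor in x^p - y^p is p y^(p-1), so it contributes one more power of p. *)
Lemma powp_vge x y k : vge 0 x -> vge 0 y -> vge k.+1%:R (x - y) ->
  vge k.+2%:R (x ^+ p - y ^+ p).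
Proof.
move=> x0 y0 xy; rewrite subrXX.
have -> : (k.+2%:R : rat) = k.+1%:R + 1 by rewrite -natr1.
apply: vgeM => //.
have xy1 : vge 1 (x - y) by apply: vge_le xy; rewrite ler1n.
have -> : \sum_(i < p) x ^+ (p.-1 - i) * y ^+ i =
    \sum_(i < p) (x ^+ (p.-1 - i) - y ^+ (p.-1 - i)) * y ^+ i + p%:R * y ^+ p.-1.
  have -> : p%:R * y ^+ p.-1 = \sum_(i < p) y ^+ p.-1 by rewrite sumr_const card_ord mulr_natl.
  rewrite -big_split; apply: eq_bigr => i _.
  have ip : (i <= p.-1)%N by rewrite -ltnS prednK ?prime_gt0.
  by rewrite /= mulrBl -exprD subnK // subrK.
apply: vgeD.
  apply: vge_sum => i _; apply: vgeMr; last exact: vgeX.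
  rewrite subrXX; apply: vgeMr => //; apply: vge_sum => j _.
  by apply: vgeMl; apply: vgeX.
apply: vgeMr; last exact: vgeX.
by apply: (@vge_dvd p Q pp 1); rewrite expn1.
Qed.

Lemma powpX_vge x y k : vge 0 x -> vge 0 y -> vge 1 (x - y) ->
  vge k.+1%:R (x ^+ (p ^ k) - y ^+ (p ^ k)).
Proof.
move=> x0 y0 xy; elim: k => [|k IH]; first by rewrite expn0 !expr1.
by rewrite expnSr !exprM; apply: powp_vge => //; apply: vgeX.
Qed.

Lemma teichP a (t : Q) : isTeich a t <-> [/\ zp t, t ^+ p = t & red t a].
Proof.
split=> -[zt tp ta]; split=> //.
- exact/(zpP pp).
- exact/near_vge.
- exact/(zpP pp).
- exact/near_vge.
Qed.

Lemma teich_pow (t : Q) k : t ^+ p = t -> t ^+ (p ^ k) = t.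
Proof.
by move=> tp; elim: k => [|k IH]; rewrite ?expr1 // expnS exprM tp.
Qed.

Lemma teich_uniq a (t t' : Q) : isTeich a t -> isTeich a t' -> t = t'.
Proof.
move=> /teichP[zt tp ta] /teichP[zt' tp' ta'].
apply/eqP; rewrite -subr_eq0; apply/eqP; apply: vge_all0 => k.
rewrite -(teich_pow k tp) -(teich_pow k tp').
apply: (@vge_le p Q k.+1%:R); first by rewrite ler_nat.
apply: powpX_vge; [exact: zp_vge|exact: zp_vge|].
by apply: vge_trans ta _; apply: vge_sym.
Qed.

(** The limit of the a^(p^k) for a natural number a lifting the residue: by Fermat and [powpX_vge]
    consecutive terms agree modulo p^(k+1). *)
Lemma teich_ex a : exists t : Q, isTeich a t.
Proof.
pose u k : Q := (a : nat)%:R ^+ (p ^ k).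
have zu k : zp (u k) by apply/zpX/zp_nat.
have du k : vge k.+1%:R (u k.+1 - u k).
  rewrite /u expnS exprM; apply: powpX_vge; [exact/vgeX/vge_nat|exact: vge_nat|].
  by have := redX p (red_nat (a : nat)); rewrite Fp_expp // natr_Zp.
have [|t [zt ut]] := @zp_complete p Q u zu.
  move=> k; exists k => i ki; apply: vge_le (du i); rewrite ler_nat; exact: leqW.
have tu k : vge k.+1%:R (t - u k).
  apply: (limit_vge ut); exists k => i /subnK <-.
  elim: (i - k)%N => [|d IH]; first by rewrite subrr; left.
  rewrite addSn; apply: vge_trans IH; apply: vge_le (du _).
  by rewrite ler_nat ltnS leq_addl.
exists t; apply/teichP; split=> //.
  apply/eqP; rewrite -subr_eq0; apply/eqP; apply: vge_all0 => k.
  apply: (vge_trans (y := u k.+1)); last first.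
    apply: vge_sym; apply: vge_le (tu k.+1); rewrite ler_nat; exact: leqW.
  rewrite /u expnSr exprM; apply: (@vge_le p Q k.+2%:R); first by rewrite ler_nat !leqW.
  by apply: powp_vge (tu k); [exact: zp_vge|exact: (zp_vge (zu k))].
by have := tu 0%N; rewrite /u expn0 expr1.
Qed.

Definition teich a : Q := projT1 (cid (teich_ex a)).
Lemma teich_isTeich a : isTeich a (teich a).
Proof. exact: (projT2 (cid (teich_ex a))). Qed.
Lemma teich_zp a : zp (teich a). Proof. by have /teichP[] := teich_isTeich a. Qed.
Lemma teich_p a : teich a ^+ p = teich a. Proof. by have /teichP[] := teich_isTeich a. Qed.
Lemma teich_red a : red (teich a) a. Proof. by have /teichP[] := teich_isTeich a. Qed.
Lemma teichE a t : isTeich a t -> t = teich a.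
Proof. by move=> H; apply: teich_uniq H (teich_isTeich a). Qed.

Lemma teichM a b : teich (a * b) = teich a * teich b.
Proof.
apply/esym/teichE/teichP; split; first by apply: zpM; apply: teich_zp.
  by rewrite exprMn !teich_p.
by apply: redM; apply: teich_red.
Qed.

Lemma teich0 : teich 0 = 0.
Proof.
apply/esym/teichE/teichP; split; [exact: (zp_nat Q 0)| |exact: (red_nat 0)].
by rewrite expr0n gtn_eqF // prime_gt0.
Qed.

Lemma teich1 : teich 1 = 1.
Proof.
apply/esym/teichE/teichP; split; [exact: (zp_nat Q 1)| |exact: (red_nat 1)].
by rewrite expr1n.
Qed.

Lemma red_unit x a : red x a -> a != 0 -> x != 0 /\ v x = 0.
Proof.
move=> xa a0; have nx M : 0 < M -> ~ vge M x.
  move=> M0 Mx.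
  have [e [e0 e1 eM]] : exists e : rat, [/\ 0 < e, e <= 1 & e <= M].
    by case: (leP 1 M) => H; [exists 1|exists M]; split=> //; apply: ltW.
  have : vge e ((a : nat)%:R : Q).
    rewrite -[(a : nat)%:R](subKr x); apply: vgeB; first exact: vge_le Mx.
    exact: vge_le xa.
  have cpa : coprime p a.
    rewrite prime_coprime //; apply: contraNN a0 => /(vge_natP Q pp 1).
    by move=> pa; apply/eqP; move: xa; rewrite /red => xa;
       apply: (@red_inj x); [exact: xa|rewrite /red subr0 -[x](subrK (a : nat)%:R); apply: vgeD].
  case=> [/eqP|]; last by rewrite pval_coprime //; lra.
  rewrite Qnat_eq0 => /eqP a0'; move: cpa; rewrite a0' /coprime gcdn0 => /eqP p1.
  by move: pp; rewrite p1.
have x0 : x != 0 by apply/eqP => x0; apply: (nx 1) => //; left.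
split=> //; case: (red_vge0 xa) => [/eqP|vx]; first by rewrite (negPf x0).
apply/eqP; rewrite eq_le vx andbT leNgt; apply/negP => v0.
by apply: (nx (v x)) => //; right.
Qed.

Lemma teich_unit a : a != 0 -> teich a != 0 /\ v (teich a) = 0.
Proof. exact/red_unit/teich_red. Qed.

Lemma zunit_red x : zp x -> x != 0 -> v x = 0 -> exists2 a, red x a & a != 0.
Proof.
move=> zx x0 vx; have [a xa] := red_ex zx; exists a => //.
apply/eqP => a0; move: xa; rewrite a0 /red subr0 => -[/eqP|]; first by rewrite (negPf x0).
by rewrite vx ler10.
Qed.
End Teichmuller.

(** With q = k div p, Legendre's sum for k is q plus that for q. Twice it is, for q > 0, below 2q +
    q, which is at most pq and hence at most k, because p >= 3. The bound fails for p = 2 and k =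
    2. *)
Lemma logn_fact_bound p k : prime p -> odd p -> (0 < k)%N ->
  (2 * logn p k`! < k)%N.
Proof.
move=> pp op; rewrite logn_fact //.
have p3 : (2 < p)%N by case: p pp op => [|[|[|]]].
have : forall m k, (0 < k)%N -> (2 * \sum_(1 <= i < m.+1) k %/ p ^ i < k)%N.
  elim=> [|m IH] {}k k0; first by rewrite big_geq.
  rewrite big_nat_recl // expn1.
  under eq_bigr => i _ do rewrite expnS divnMA.
  case: (posnP (k %/ p)) => [->|q0].
    by rewrite big1 // => i _; rewrite div0n.
  have := IH _ q0; have := leq_trunc_div k p; nia.
by move=> H k0; apply: H.
Qed.

(** * The p-adic exponential on p Z_p *)

Section Exponential.
Variables (p : nat) (Q : padicClosure p).
Hypotheses (pp : prime p) (op : odd p).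
Local Notation v := (@pval p Q).
Implicit Types (a e : Q) (k j : nat).

Definition eterm a k : Q := a ^+ k / k`!%:R.
Definition is_exp a e := limit v (fun m => \sum_(k < m) eterm a k) e.

Lemma fact_neq0 k : (k`!%:R : Q) != 0.
Proof. by rewrite Qnat_eq0 -lt0n fact_gt0. Qed.

Lemma eterm0 a : eterm a 0 = 1.
Proof. by rewrite /eterm expr0 fact0 divr1. Qed.

Lemma eterm1 a : eterm a 1 = a.
Proof. by rewrite /eterm expr1 divr1. Qed.

Lemma eterm_vge a j k : vge j%:R a -> vge ((k * j)%:R - (logn p k`!)%:R) (eterm a k).
Proof.
move=> ja; apply: vgeM; last by right; rewrite pvalV ?fact_neq0 // pval_nat // fact_gt0.
elim: k => [|k IH]; first by rewrite mul0n expr0; apply: vge1.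
by rewrite mulSn natrD exprS; apply: vgeM.
Qed.

Lemma eterm_half a k : vge 1 a -> vge (k%:R / 2%:R) (eterm a k).
Proof.
move=> a1; have := @eterm_vge a 1 k a1; apply: vge_le; rewrite muln1.
case: k => [|k]; first by rewrite fact0 logn1 mul0r subr0.
have : (2 * logn p k.+1`! <= k.+1)%N by apply/ltnW/logn_fact_bound.
rewrite -(ler_nat rat) natrM; lra.
Qed.

(** The terms of degree at least two are smaller than a: kj >= j + 1 + v_p(k!) for k >= 2. This
    gives exp(a) = 1 + a modulo p^(j+1). *)
Lemma eterm_ge2 a j k : (0 < j)%N -> (1 < k)%N -> vge j%:R a -> vge j.+1%:R (eterm a k).
Proof.
move=> j0 k1 ja; have := @eterm_vge a j k ja; apply: vge_le.
have H : (j.+1 + logn p k`! <= k * j)%N.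
  have := logn_fact_bound pp op (ltnW k1).
  by case: k k1 {ja} => [|[|[|k]]] // _; nia.
by move: H; rewrite -(ler_nat rat) natrD; lra.
Qed.

Lemma eterm_zp a k : zp a -> vge 1 a -> zp (eterm a k).
Proof.
move=> za a1; have [b zb ab] : exists2 b, zp b & a = p%:R ^+ 1 * b by exact: zp_div.
have [m [cpm E]] : exists m, coprime p m /\ k`! = (m * p ^ logn p k`!)%N.
  by case: (pfactor_coprime pp (fact_gt0 k)) => m; exists m.
have mU := pval_coprime Q pp cpm.
have m0 : (m%:R : Q) != 0.
  by apply/eqP => m0; have := fact_neq0 k; rewrite E natrM m0 mul0r eqxx.
have lk : (logn p k`! <= k)%N.
  case: (posnP k) => [->|k0]; first by rewrite fact0 logn1.
  by have := logn_fact_bound pp op k0; lia.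
have -> : eterm a k = p%:R ^+ (k - logn p k`!) * b ^+ k * m%:R^-1.
  have fE : (k`!%:R : Q) = m%:R * p%:R ^+ logn p k`! by rewrite {1}E natrM natrX.
  rewrite /eterm fE ab expr1 exprMn -{1}(subnK lk) exprD.
  have pk0 : (p%:R ^+ logn p k`! : Q) != 0 by rewrite expf_neq0 ?Qp_neq0.
  by field; rewrite pk0 m0.
apply: zpM; last by apply: zpV => //; apply: zp_nat.
by apply: zpM; apply: zpX => //; apply: zp_nat.
Qed.

Lemma exp_ex a : zp a -> vge 1 a -> exists e, zp e /\ is_exp a e.
Proof.
move=> za a1; apply: zp_complete => //.
  by move=> m; apply: zp_sum => i _; apply: eterm_zp.
move=> k; exists (2 * k)%N => i ki; rewrite big_ord_recr /= addrAC subrr add0r.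
apply: vge_le (eterm_half i a1); have : ((2 * k)%:R <= i%:R :> rat) by rewrite ler_nat.
rewrite natrM; lra.
Qed.

Lemma exp_cong a e j : (0 < j)%N -> vge j%:R a -> is_exp a e ->
  vge j.+1%:R (e - (1 + a)).
Proof.
move=> j0 ja H; apply: (limit_vge H); exists 2%N => i i2.
rewrite -(subnK i2) addn2 !big_ord_recl /= eterm0 eterm1.
set S := \sum_(_ < _) _; have -> : 1 + (a + S) - (1 + a) = S by ring.
by apply: vge_sum => l _; apply: eterm_ge2.
Qed.

Lemma exp_uniq a e e' : is_exp a e -> is_exp a e' -> e = e'.
Proof. exact: limit_uniq. Qed.

Lemma exp0 : is_exp 0 1.
Proof.
move=> M; exists 1%N => -[|m] // _; left.
by rewrite big_ord_recl eterm0 big1 ?addr0 // => i _; rewrite /eterm expr0n mul0r.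
Qed.

Lemma exp_vge1 a e : vge 1 a -> is_exp a e -> vge 1 (e - 1).
Proof.
move=> a1 H; have := exp_cong (j := 1) isT a1 H => H2.
have -> : e - 1 = (e - (1 + a)) + a by ring.
by apply: vgeD => //; apply: vge_le H2; rewrite ler1n.
Qed.

Lemma exp_unit a e : vge 1 a -> is_exp a e -> e != 0 /\ v e = 0.
Proof.
move=> a1 /(exp_vge1 a1) H; apply: (@red_unit p Q pp e 1 _ (oner_neq0 _)).
exact: red_vge (red_nat Q pp 1) H.
Qed.

(** Truncations are values at 1 of polynomials. Below degree m the product of the two has the
    coefficients of exp(a + b) by the binomial formula; from degree m on, coefficients have
    valuation at least m/2, hence at least k. *)
Lemma exp_add a b e e' : vge 1 a -> vge 1 b -> is_exp a e -> is_exp b e' ->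
  is_exp (a + b) (e * e').
Proof.
move=> a1 b1 Ha Hb; apply/limit_nat => k.
have [m1 H1] := (limit_nat _ _).1 Ha k; have [m2 H2] := (limit_nat _ _).1 Hb k.
exists (m1 + m2 + 2 * k)%N => m Hm.
have {}H1 := H1 m; have {}H2 := H2 m.
pose S a := \sum_(k < m) eterm a k.
have S0 c : vge 1 c -> vge 0 (S c).
  move=> c1; apply: vge_sum => i _; apply: vge_le (eterm_half i c1).
  by rewrite divr_ge0 // ler0n.
have e0 : vge 0 e.
  rewrite -[e](subrK (S a)); apply: vgeD; last exact: S0.
  by apply: vge_sym; apply: vge_le (H1 _); [rewrite ler0n|lia].
suff HS : vge k%:R (S (a + b) - S a * S b).
  apply: vge_trans HS _; have -> : S a * S b - e * e' = (S a - e) * S b + e * (S b - e') by ring.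
  apply: vgeD; first by apply: vgeMr; [apply: H1; lia|apply: S0].
  by apply: vgeMl => //; apply: H2; lia.
pose P c : {poly Q} := \poly_(i < m) eterm c i.
have SE c : S c = (P c).[1].
  rewrite /P horner_poly; apply: eq_bigr => i _; by rewrite expr1n mulr1.
have PE c i : (P c)`_i = if (i < m)%N then eterm c i else 0 by rewrite coef_poly.
have sz : (size (P a * P b)%R <= m + m)%N.
  apply: leq_trans (size_polyMleq _ _) _; rewrite -ltnS.
  have := size_poly m (fun i => eterm a i); have := size_poly m (fun i => eterm b i).
  rewrite -/(P a) -/(P b); lia.
have -> : S a * S b = \sum_(i < m + m) (P a * P b)`_i.
  rewrite !SE -hornerM (horner_coef_wide _ sz); apply: eq_bigr => i _.
  by rewrite expr1n mulr1.
rewrite big_split_ord /= opprD addrA.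
rewrite [X in X + _](_ : _ = 0) ?add0r.
  apply/vgeN/vge_sum => i _; rewrite coefM; apply: vge_sum => j _; rewrite !PE.
  case: ifP => _; last by rewrite mul0r; left.
  case: ifP => _; last by rewrite mulr0; left.
  apply: (vge_le _ (vgeM (eterm_half j a1) (eterm_half (m + i - j) b1))).
  have : ((2 * k)%:R <= (j + (m + i - j))%:R :> rat).
    by rewrite ler_nat; have := ltn_ord j; lia.
  by rewrite natrD natrM; lra.
rewrite -sumrB big1 // => i _; rewrite coefM.
apply/eqP; rewrite subr_eq0; apply/eqP; rewrite /eterm addrC exprDn mulr_suml.
apply: eq_bigr => j _; rewrite !PE.
have ji : (j <= i)%N by rewrite -ltnS.
rewrite (leq_ltn_trans ji (ltn_ord i)) (leq_ltn_trans (leq_subr j i) (ltn_ord i)).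
rewrite -(bin_fact ji) !natrM /eterm -mulr_natl.
have c0 : ('C(i, j)%:R : Q) != 0 by rewrite Qnat_eq0 -lt0n bin_gt0.
by field; rewrite c0 !fact_neq0.
Qed.

(** As exp(a) is 1 + a modulo one more power of p than divides a, the divisibility of exp(a) - 1
    passes to a one power at a time. *)
Lemma exp_small_iff a e k : vge 1 a -> is_exp a e ->
  (vge k.+1%:R (e - 1) <-> vge k.+1%:R a).
Proof.
move=> a1 H; split=> [He|ka]; last first.
  have -> : e - 1 = (e - (1 + a)) + a by ring.
  apply: vgeD => //; apply: vge_le (exp_cong (j := k.+1) isT ka H).
  by rewrite ler_nat.
suff /(_ k (leqnn k)) : forall j, (j <= k)%N -> vge j.+1%:R a by [].
elim=> [//|j IH] jk; have {}IH := IH (ltnW jk).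
have -> : a = (e - 1) - (e - (1 + a)) by ring.
apply: vgeB; first by apply: vge_le He; rewrite ler_nat.
exact: exp_cong.
Qed.
End Exponential.

(** * Exponential coordinates on the units of Z_p *)

Section UnitCoordinates.
Variables (p : nat) (Q : padicClosure p).
Hypotheses (pp : prime p) (op : odd p).
Local Notation v := (@pval p Q).
Local Notation tau := (@teich p Q pp).

(** The p-adic integer of a Witt vector over F_p. In general the i-th digit involves a p^i-th root
    of the coordinate; in F_p this root is the coordinate itself. *)
Definition digits n (x : {ffun 'I_n -> 'F_p}) : Q := \sum_(i < n) p%:R ^+ i * tau (x i).

Lemma digits_zp n (x : {ffun 'I_n -> 'F_p}) : zp (digits x).
Proof.
by apply: zp_sum => i _; apply: zpM; [apply/zpX/zp_nat|apply: teich_zp].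
Qed.

Lemma pdigits_vge n (x : {ffun 'I_n -> 'F_p}) : vge 1 (p%:R * digits x).
Proof. by rewrite -[p%:R]expr1; apply: (vgepXM pp 1); apply/zp_vge/digits_zp. Qed.

Lemma red_mmap m (P : {mpoly int[m]}) (h : 'I_m -> Q) (h' : 'I_m -> 'F_p) :
  (forall i, red (h i) (h' i)) -> red (mmap intr h P) (mmap intr h' P).
Proof.
move=> hh; rewrite /mmap; apply: red_sum => // mo; apply: redM => //.
  exact: red_int.
by rewrite /mmap1; apply: red_prod => // i; apply: redX.
Qed.

(** The last ghost component at Teichmuller representatives is [digits], as they are fixed by p-th
    powers. The Witt polynomials evaluated there agree with the representatives of [z] modulo p
    only, but the i-th enters with a factor p^i and a p-power exponent, which brings each error to
    the full order. *)
Lemma wittAdd_digits n (x y z : {ffun 'I_n -> 'F_p}) : wittAdd p x y z ->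
  vge n%:R (digits z - (digits x + digits y)).
Proof.
case: n x y z => [|n] x y z; first by rewrite /digits !big_ord0 addr0 subrr; left.
move=> [P /(_ ord_max) gP zP].
pose T (i : 'I_(n.+1 + n.+1)) : Q :=
  match split i with inl a => tau (x a) | inr b => tau (y b) end.
pose ev : {rmorphism {mpoly int[n.+1 + n.+1]} -> Q} := mmap intr T.
have evX i : ev 'X_i = T i by rewrite -[LHS]/(mmap _ _ _) mmapX mmap1U.
have Zred i : red (ev (P i)) (z i).
  rewrite zP; apply: red_mmap => j; rewrite /T; case: split => a; exact: teich_red.
have E : \sum_(i < n.+1) ev (P i) ^+ (p ^ (n - i)) * p%:R ^+ i = digits x + digits y.
  have ghostE (w : {ffun 'I_n.+1 -> {mpoly int[n.+1 + n.+1]}}) :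
      ev (ghost p w ord_max) = \sum_(i < n.+1) ev (w i) ^+ (p ^ (n - i)) * p%:R ^+ i.
    rewrite /ghost (eq_bigl predT) => [|i]; last by rewrite -ltnS ltn_ord.
    rewrite (rmorph_sum ev); apply: eq_bigr => i _.
    by rewrite (rmorphMn ev) (rmorphXn ev) -mulr_natr natrX.
  transitivity (ev (ghost p P ord_max)); first exact/esym/ghostE.
  rewrite gP; apply: etrans (rmorphD ev _ _) _.
  congr (_ + _).
    apply: etrans (ghostE _) _; apply: eq_bigr => i _.
    rewrite ffunE evX mulrC; congr (_ * _); rewrite /T.
    have -> : split (lshift n.+1 i) = inl i by exact: (unsplitK (inl i)).
    exact/teich_pow/teich_p.
  apply: etrans (ghostE _) _; apply: eq_bigr => i _.
  rewrite ffunE evX mulrC; congr (_ * _); rewrite /T.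
  have -> : split (rshift n.+1 i) = inr i by exact: (unsplitK (inr i)).
  exact/teich_pow/teich_p.
rewrite -E -sumrB; apply: vge_sum => i _.
rewrite mulrC -mulrBl mulrC.
rewrite -(teich_pow (n - i) (teich_p Q pp (z i))).
have -> : (n.+1%:R : rat) = i%:R + (n - i).+1%:R.
  by rewrite -natrD addnS subnKC // -ltnS.
apply: vgeM; first exact: vgepX.
apply: powpX_vge => //.
- exact/zp_vge/teich_zp.
- exact: red_vge0 (Zred i).
- apply: vge_trans (teich_red Q pp (z i)) _; apply: vge_sym; exact: Zred.
Qed.

Lemma digits_inj n (x y : {ffun 'I_n -> 'F_p}) :
  vge n%:R (digits x - digits y) -> x = y.
Proof.
elim: n x y => [|n IH] x y H; first by apply/ffunP => -[].
have tailE (u : {ffun 'I_n.+1 -> 'F_p}) :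
    digits u = tau (u ord0) + p%:R * digits [ffun i => u (lift ord0 i)].
  rewrite /digits big_ord_recl expr0 mul1r mulr_sumr; congr (_ + _).
  by apply: eq_bigr => i _; rewrite ffunE lift0 exprS mulrA.
have pd (u : {ffun 'I_n.+1 -> 'F_p}) : vge 1 (p%:R * digits [ffun i => u (lift ord0 i)]).
  exact: pdigits_vge.
have E0 : x ord0 = y ord0.
  apply: (red_inj pp (x := digits x)).
    by rewrite tailE; apply: red_vge (teich_red Q pp _) _; rewrite addrAC subrr add0r.
  apply: red_vge (teich_red Q pp (y ord0)) _.
  have -> : digits x - tau (y ord0) = (digits x - digits y) + (digits y - tau (y ord0)) by ring.
  apply: vgeD; first by apply: vge_le H; rewrite ler1n.
  by rewrite tailE addrAC subrr add0r.
have E1 : [ffun i => x (lift ord0 i)] = [ffun i => y (lift ord0 i)].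
  apply: IH; move: H; rewrite !tailE E0 => H.
  set dx := digits _ in H *; set dy := digits _ in H *.
  have {}H : vge n.+1%:R (p%:R * (dx - dy)).
    by have -> : p%:R * (dx - dy) = tau (y ord0) + p%:R * dx - (tau (y ord0) + p%:R * dy) by ring.
  have -> : (n%:R : rat) = n.+1%:R - 1 by rewrite -natr1; lra.
  rewrite -[dx - dy](mulKf (Qp_neq0 Q pp)) addrC; apply: vgeM => //.
  by right; rewrite pvalV ?Qp_neq0 // pvalp.
apply/ffunP => i; case: (unliftP ord0 i) => [j|] -> //.
by move/ffunP/(_ j): E1; rewrite !ffunE.
Qed.

Variable n : nat.
Implicit Types (u : Zpunit Q) (x y z : {ffun 'I_n.+1 -> 'F_p}).
Local Notation pd x := (p%:R * digits (ftail x)).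

Lemma zunit_zp u : zp (uval u). Proof. by case: (uvalP u) => /(zpP pp). Qed.

Lemma expIsoP u x : expIso u x <-> exists e, is_exp (pd x) e /\
  vge n.+1%:R (uval u - tau (x ord0) * e).
Proof.
have dE (t : 'I_n.+1 -> Q) : (forall i, isTeich (x i) (t i)) ->
    \sum_(i < n) p%:R ^+ i * t (lift ord0 i) = digits (ftail x).
  by move=> Ht; apply: eq_bigr => i _; rewrite ffunE (teichE pp (Ht _)).
split=> [[t [e [Ht He Hu]]]|[e [He Hu]]].
  exists e; split; first by move: He; rewrite (dE t Ht).
  by move/near_vge: Hu; rewrite (teichE pp (Ht ord0)).
have Ht i : isTeich (x i) (tau (x i)) by exact: teich_isTeich.
by exists (fun i => tau (x i)), e; split=> //; [rewrite (dE _ Ht)|apply/near_vge].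
Qed.

Lemma mk_zunit (a : Q) : zp a -> a != 0 -> v a = 0 -> exists u : Zpunit Q, uval u = a.
Proof.
move=> za a0 va.
have H : [/\ isZp a, a != 0 & v a = 0] by split=> //; apply/(zpP pp).
by exists (ZpUnit H).
Qed.

Lemma expIso_ex x : x ord0 != 0 -> exists u, expIso u x.
Proof.
move=> x0; have zd : zp (pd x) by apply: zpM; [apply: zp_nat|apply: digits_zp].
have [e [ze He]] := exp_ex pp op zd (pdigits_vge _).
have [e0 ve] := exp_unit pp op (pdigits_vge _) He.
have [t0 vt] := teich_unit Q pp x0.
have [u uE] := @mk_zunit (tau (x ord0) * e) (zpM (teich_zp Q pp _) ze)
  (mulf_neq0 t0 e0) (etrans (pvalM t0 e0) (etrans (f_equal2 _ vt ve) (addr0 _))).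
exists u; apply/expIsoP; exists e; split=> //.
by rewrite uE subrr; left.
Qed.

(** Successive approximation: if a / e = 1 + p^(m+1) c, the next digit is the residue b of c, and
    multiplying e by exp(p^(m+1) [b]) gains one power of p. *)
Lemma unit_digits (a : Q) m : zp a -> vge 1 (a - 1) ->
  exists (d : {ffun 'I_m -> 'F_p}) (e : Q),
    is_exp (p%:R * digits d) e /\ vge m.+1%:R (a - e).
Proof.
move=> za a1; elim: m => [|m [d [e [He ae]]]].
  by exists [ffun=> 0], 1; rewrite /digits big_ord0 mulr0; split=> //; apply: exp0.
have zd : zp (p%:R * digits d) by apply: zpM; [apply: zp_nat|apply: digits_zp].
have [e' [ze' He']] := exp_ex pp op zd (pdigits_vge _).
have ee' := exp_uniq He He'; subst e'.
have [e0 ve] := exp_unit pp op (pdigits_vge _) He.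
have [c zc cE] : exists2 c, zp c & (a - e) / e = p%:R ^+ m.+1 * c.
  apply: (zp_div pp); first by apply: zpM; [apply: zpB|apply: zpV].
  by apply: vgeMr => //; right; rewrite pvalV // ve oppr0.
have [b cb] := red_ex pp zc.
pose d' : {ffun 'I_m.+1 -> 'F_p} :=
  [ffun i => if unlift ord_max i is Some j then d j else b].
have dE : digits d' = digits d + p%:R ^+ m * tau b.
  rewrite /digits big_ord_recr /= /d' ffunE unlift_none; congr (_ + _).
  apply: eq_bigr => i _; rewrite ffunE.
  have -> : widen_ord (leqnSn m) i = lift ord_max i by apply: val_inj; rewrite /= /bump leqNgt ltn_ord.
  by rewrite liftK.
pose del := p%:R ^+ m.+1 * tau b.
have vdel : vge m.+1%:R del by apply: (vgepXM pp); apply/zp_vge/teich_zp.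
have vdel1 : vge 1 del by apply: vge_le vdel; rewrite ler1n.
have zdel : zp del by apply: zpM; [apply/zpX/zp_nat|apply: teich_zp].
have [f [zf Hf]] := exp_ex pp op zdel vdel1.
have fc := exp_cong pp op (j := m.+1) isT vdel Hf.
exists d', (e * f); split.
  have -> : p%:R * digits d' = p%:R * digits d + del by rewrite dE mulrDr /del exprS mulrA.
  by apply: exp_add => //; apply: pdigits_vge.
have -> : a - e * f = e * (p%:R ^+ m.+1 * (c - tau b) - (f - (1 + del))).
  have -> : a = e * (1 + p%:R ^+ m.+1 * c) by rewrite -cE mulrDr mulr1 [e * _]mulrC divfK // addrC subrK.
  by rewrite /del; ring.
apply: vgeMl; first exact: zp_vge.
apply: vgeB => //; rewrite -[m.+2]addn1 natrD; apply: vgeM; first exact: vgepX.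
by apply: vge_trans cb _; apply: vge_sym; apply: teich_red.
Qed.

Lemma expIso_total u : exists2 x : {ffun 'I_n.+1 -> 'F_p}, x ord0 != 0 & expIso u x.
Proof.
have [_ u0 vu] := uvalP u; have zu := zunit_zp u.
have [a ua a0] := zunit_red pp zu u0 vu.
have [t0 vt] := teich_unit Q pp a0.
have zV : zp (tau a)^-1 by apply: zpV => //; apply: teich_zp.
have [||d [e [He ue]]] := @unit_digits (uval u / tau a) n.
- exact: zpM.
- rewrite -(mulfV t0) -mulrBl; apply: vgeMr; last exact: zp_vge.
  by apply: vge_trans ua _; apply: vge_sym; apply: teich_red.
exists [ffun i => if unlift ord0 i is Some j then d j else a].
  by rewrite ffunE unlift_none.
apply/expIsoP; exists e; split.
  have -> : ftail [ffun i => if unlift ord0 i is Some j then d j else a] = d.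
    by apply/ffunP => i; rewrite !ffunE liftK.
  exact: He.
rewrite ffunE unlift_none.
have -> : uval u - tau a * e = tau a * (uval u / tau a - e) by rewrite mulrBr [tau a * (_ / _)]mulrC divfK.
by apply: vgeMl => //; apply/zp_vge/teich_zp.
Qed.

(** The residue of u gives x_0. The exponentials then agree modulo p^(n+1), hence so do their
    arguments by [exp_small_iff], and the digits follow after division by p. *)
Lemma expIso_inj u x y : expIso u x -> expIso u y -> x = y.
Proof.
move=> /expIsoP[e [He Hu]] /expIsoP[e' [He' Hu']].
have x1 := pdigits_vge (ftail x); have y1 := pdigits_vge (ftail y).
have e1 := exp_vge1 pp op x1 He; have e1' := exp_vge1 pp op y1 He'.
have k1 (a : Q) : vge n.+1%:R a -> vge 1 a by apply: vge_le; rewrite ler1n.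
have red_u (z : {ffun 'I_n.+1 -> 'F_p}) (f : Q) : vge 1 (f - 1) ->
    vge n.+1%:R (uval u - tau (z ord0) * f) -> red (uval u) (z ord0).
  move=> f1 /k1 H; apply: red_vge (teich_red Q pp _) _; apply: vge_trans H _.
  rewrite -{2}[tau _]mulr1 -mulrBr; apply: vgeMl => //; apply/zp_vge/teich_zp.
have E0 : x ord0 = y ord0 by apply: (red_inj pp (red_u x e e1 Hu) (red_u y e' e1' Hu')).
have [_ u0 vu] := uvalP u.
have [t0 vt] : tau (x ord0) != 0 /\ v (tau (x ord0)) = 0.
  have [a ua a0] := zunit_red pp (zunit_zp u) u0 vu.
  by apply: teich_unit; rewrite (red_inj pp (red_u x e e1 Hu) ua).
have ee : vge n.+1%:R (e - e').
  apply: (unit_vge t0 vt); rewrite mulrBr; apply: (vge_trans (y := uval u)).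
    exact: vge_sym.
  by rewrite E0.
pose del := pd x - pd y.
have d1 : vge 1 del by apply: vgeB.
have zdel : zp del by apply: (zpB pp); apply: zpM; [apply: zp_nat|apply: digits_zp|apply: zp_nat|apply: digits_zp].
have [f [zf Hf]] := exp_ex pp op zdel d1.
have eE : e = e' * f.
  apply: (exp_uniq He); have := exp_add pp op y1 d1 He' Hf.
  by rewrite /del addrC subrK.
have [e0' ve'] := exp_unit pp op y1 He'.
have : vge n.+1%:R (f - 1).
  by apply: (unit_vge e0' ve'); rewrite mulrBr mulr1 -eE.
move/(exp_small_iff pp op n d1 Hf) => Hdel.
have tails : ftail x = ftail y.
  apply: digits_inj; have -> : (n%:R : rat) = - 1 + n.+1%:R by rewrite -natr1; lra.
  have -> : digits (ftail x) - digits (ftail y) = p%:R^-1 * del.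
    by rewrite /del -mulrBr mulKf // Qp_neq0.
  by apply: vgeM => //; right; rewrite pvalV ?Qp_neq0 // pvalp.
apply/ffunP => i; case: (unliftP ord0 i) => [j|] -> //.
by move/ffunP/(_ j): tails; rewrite !ffunE.
Qed.

Lemma expIso_mul u1 u2 u3 x y z : uval u3 = uval u1 * uval u2 ->
  expIso u1 x -> expIso u2 y -> xop (gmWitt p n) x y z -> expIso u3 z.
Proof.
move=> uE /expIsoP[e [He Hu]] /expIsoP[e' [He' Hu']] [z0 /wittAdd_digits zD].
have x1 := pdigits_vge (ftail x); have y1 := pdigits_vge (ftail y).
have z1 := pdigits_vge (ftail z).
(* Witt addition matches addition of digits modulo p^n only; after multiplication by p the
   discrepancy is divisible by p^(n+1), and its exponential f is 1 to that order. *)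
pose del := pd z - (pd x + pd y).
have zpd (w : {ffun 'I_n.+1 -> 'F_p}) : zp (pd w).
  by apply: zpM; [apply: zp_nat|apply: digits_zp].
have zdel : zp del by apply: zpB => //; apply: zpD.
have vdel : vge n.+1%:R del.
  have -> : del = p%:R * (digits (ftail z) - (digits (ftail x) + digits (ftail y))).
    by rewrite /del; ring.
  rewrite -add1n natrD; apply: vgeM => //; right; by rewrite pvalp.
have d1 : vge 1 del by apply: vge_le vdel; rewrite ler1n.
have [f [zf Hf]] := exp_ex pp op zdel d1.
have f1 := (exp_small_iff pp op n d1 Hf).2 vdel.
have Hz : is_exp (pd z) (e * e' * f).
  have -> : pd z = pd x + pd y + del by rewrite /del addrC subrK.
  by apply: exp_add => //; [apply: vgeD|apply: exp_add].
have e0 (a g : Q) : vge 1 a -> is_exp a g -> vge 0 g.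
  by move=> a1 Hg; have [_ vg] := exp_unit pp op a1 Hg; right; rewrite vg.
apply/expIsoP; exists (e * e' * f); split=> //.
rewrite uE z0 teichM.
set tx := tau _ in Hu *; set ty := tau _ in Hu' *.
have -> : uval u1 * uval u2 - tx * ty * (e * e' * f) =
   uval u1 * (uval u2 - ty * e') + (uval u1 - tx * e) * (ty * e') - tx * ty * e * e' * (f - 1) by ring.
have tx0 : vge 0 tx by exact/zp_vge/teich_zp.
have ty0 : vge 0 ty by exact/zp_vge/teich_zp.
have ve := e0 _ _ x1 He; have ve' := e0 _ _ y1 He'.
apply: vgeB; last by apply: vgeMl f1; do 3?[apply: vgeMl => //].
apply: vgeD; first by apply: vgeMl Hu'; apply/zp_vge/zunit_zp.
by apply: vgeMr => //; apply: vgeMl.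
Qed.

Lemma expIso_one u x : near v n.+1%:R (uval u) 1 -> x ord0 = 1 ->
  (forall i, i != ord0 -> x i = 0) -> expIso u x.
Proof.
move=> /near_vge u1 x0 xi; apply/expIsoP; exists 1.
have -> : digits (ftail x) = 0.
  by apply: big1 => i _; rewrite ffunE xi // teich0 mulr0.
by rewrite mulr0 x0 teich1 mulr1; split=> //; apply: exp0.
Qed.

Lemma expIso_close u u' x : expIso u x -> expIso u' x ->
  vge n.+1%:R (uval u - uval u').
Proof.
move=> /expIsoP[e [He Hu]] /expIsoP[e' [He' Hu']].
rewrite (exp_uniq He' He) in Hu'; apply: vge_trans Hu _; exact: vge_sym.
Qed.

Lemma zunit_div u u' : exists w : Zpunit Q, uval u = uval u' * uval w.
Proof.
have [_ u0 vu] := uvalP u; have [_ u0' vu'] := uvalP u'.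
have [|||w wE] := @mk_zunit (uval u / uval u').
- by apply: zpM; [exact: zunit_zp|apply: zpV => //; exact: zunit_zp].
- by rewrite mulf_neq0 ?invr_eq0.
- by rewrite pvalM ?invr_eq0 // pvalV // vu vu' subr0.
by exists w; rewrite wE mulrC divfK.
Qed.

End UnitCoordinates.

(** * The sequence of Sekiguchi and Suwa *)

Lemma quot_ring_ex (T : comNzRingType) (J : T -> Prop) :
  J 0 -> (forall x y, J x -> J y -> J (x + y)) -> (forall a x, J x -> J (a * x)) ->
  ~ J 1 -> exists (C : comNzRingType) (q : {rmorphism T -> C}), forall x, q x = 0 <-> J x.
Proof.
move=> J0 JD JM J1; pose S (x : T) : bool := `[< J x >].
have clS : idealr_closed S.
  split; [exact/asboolP|exact/asboolP|].
  move=> a x y /asboolP Jx /asboolP Jy; apply/asboolP.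
  by apply: JD => //; apply: JM.
pose I : idealr T := HB.pack S (isIdealr.Build T S clS).
pose C : comNzRingType := {ideal_quot I}.
pose q : {rmorphism T -> C} := \pi_({ideal_quot I})%qT.
exists C, q => x.
have -> : (q x = 0) <-> (x - 0 \in I).
  rewrite Quotient.idealrBE; split=> [E|/eqP E].
    by apply/eqP; rewrite -[LHS]/(q x) E -(rmorph0 q).
  by rewrite -(rmorph0 q); exact: E.
by rewrite subr0; split => [/asboolP|?]; [|apply/asboolP].
Qed.

Lemma constPt_delta (C : finType) (T : comNzRingType) (e : {ffun C -> T}) :
  conn T -> constPt e -> exists c, e = [ffun c' => (c' == c)%:R].
Proof.
move=> cT [e1 ee].
have [c ec] : exists c, e c = 1.
  apply: contrapT => no; move/eqP: e1; rewrite big1 ?(eq_sym 0) ?oner_eq0 // => c _.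
  by have [|//|ec1] := cT (e c); [rewrite ee eqxx|case: no; exists c].
exists c; apply/ffunP => c'; rewrite ffunE; have [->//|ne] := eqVneq.
by have := ee c' c; rewrite (negPf ne) ec mulr1.
Qed.

Lemma constPt_deltaP (C : finType) (T : comNzRingType) (c : C) :
  constPt [ffun c' => (c' == c)%:R : T].
Proof.
split.
  rewrite (bigD1 c) //= ffunE eqxx big1 ?addr0 // => c' /negPf ne.
  by rewrite ffunE ne.
move=> a b; rewrite !ffunE; have [->|] := eqVneq a b; first by case: eqP => _; rewrite ?mulr1 ?mulr0.
by have [->|] := eqVneq a c; rewrite ?mul0r // eq_sym => /negPf ->; rewrite mulr0.
Qed.

Lemma delta_sum (C : finType) (T : comNzRingType) (c : C) (F : C -> T) :
  \sum_c' [ffun c' => (c' == c)%:R : T] c' * F c' = F c.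
Proof.
rewrite (bigD1 c) //= ffunE eqxx mul1r big1 ?addr0 // => c' /negPf ne.
by rewrite ffunE ne mul0r.
Qed.

Section GroupScheme.
Variables (R : comNzRingType) (X : grpScheme R).

Lemma gmulI (T : alg R) (x y z : hom (gring X) T) : gmul x y = gmul x z -> y = z.
Proof.
have [x' xx'] := gmulV x; rewrite gmulC in xx'.
by move=> E; rewrite -[y]gmul1 -xx' -gmulA E gmulA xx' gmul1.
Qed.

Lemma gmul_idem (T : alg R) (x : hom (gring X) T) : gmul x x = x -> x = gone X T.
Proof. by move=> E; apply: (@gmulI T x); rewrite E gmulC gmul1. Qed.
End GroupScheme.

Section SekiguchiSuwa.
Variables (p n : nat) (pp : prime p) (op : odd p).
Variables (R K : comNzRingType) (j : {rmorphism R -> K}) (r : {rmorphism R -> 'F_p}).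
Variable D : sekiguchiSuwa n j r.
Hypothesis cR : conn R.

Definition Gam : finType := ('I_p.-1 * 'I_(p ^ n))%type.

Lemma p1_gt0 : (0 < p.-1)%N. Proof. by case: p pp op => [|[|[]]]. Qed.
Lemma pn_gt0 : (0 < p ^ n)%N. Proof. by rewrite expn_gt0 prime_gt0. Qed.

Definition gadd (a b : Gam) : Gam :=
  (Ordinal (ltn_pmod (a.1 + b.1) p1_gt0), Ordinal (ltn_pmod (a.2 + b.2) pn_gt0)).
Definition g0 : Gam := (Ordinal p1_gt0, Ordinal pn_gt0).
Definition gopp (a : Gam) : Gam :=
  (Ordinal (ltn_pmod (p.-1 - a.1) p1_gt0), Ordinal (ltn_pmod (p ^ n - a.2) pn_gt0)).

Lemma gaddC a b : gadd a b = gadd b a.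
Proof. by congr pair; apply: val_inj; rewrite /= addnC. Qed.

Lemma gaddN a : gadd a (gopp a) = g0.
Proof.
by congr pair; apply: val_inj; rewrite /= modnDmr subnKC ?modnn // ltnW.
Qed.

Lemma gadd0 a : gadd g0 a = a.
Proof. by case: a => a b; congr pair; apply: val_inj; rewrite /= add0n modn_small. Qed.

Lemma card_Gam : #|Gam| = (p.-1 * p ^ n)%N.
Proof. by rewrite card_prod !card_ord. Qed.

Lemma ssiD a b : ssi D (gadd a b) = gmul (ssi D a) (ssi D b).
Proof. by apply: ssi_morph; rewrite /= modn_mod. Qed.

Lemma ssi0 : ssi D g0 = gone (ssY D) (triv R).
Proof. by apply: gmul_idem; rewrite -ssiD gadd0. Qed.

Definition tohom (T : alg R) : hom (triv R) T := @Hom R (triv R) T (astr T) (fun=> erefl).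

Definition ssT (T : alg R) (c : Gam) : hom (gring (ssY D)) T := hcomp (tohom T) (ssi D c).

Lemma ssT_nat (T T' : alg R) (g : hom T T') c : hcomp g (ssT T c) = ssT T' c.
Proof. by apply: hom_ext => x /=; rewrite hmapE. Qed.

Lemma ssTD (T : alg R) a b : ssT T (gadd a b) = gmul (ssT T a) (ssT T b).
Proof. by rewrite /ssT ssiD gmul_nat. Qed.

Lemma ssT0 (T : alg R) : ssT T g0 = gone (ssY D) T.
Proof. by rewrite /ssT ssi0 gone_nat. Qed.

Lemma ssf_one (T : alg R) : hcomp (gone (ssY D) T) (ssf D) = gone (ssX D) T.
Proof. by apply: gmul_idem; rewrite -ssf_morph gmul1. Qed.

(** Exactness gives a single decomposition of 1 for the unit point; the indicator functions of [c]
    and of [g0] both qualify. *)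
Lemma ssT_uniq0 (T : alg R) c : ssT T c = gone (ssY D) T -> c = g0.
Proof.
move=> E; have [e [_ eU]] := (ssi_exact (gone (ssY D) T)).1 (ssf_one T).
have H d : ssT T d = gone (ssY D) T -> e = [ffun c' => (c' == d)%:R].
  move=> Ed; apply: eU; split=> [|b]; first exact: constPt_deltaP.
  by rewrite (delta_sum d (fun c' => astr T (ssi D c' b))) -Ed.
have := H c E; rewrite (H g0 (ssT0 T)) => /ffunP/(_ c); rewrite !ffunE eqxx.
by have [//|_] := eqVneq => /esym/eqP; rewrite oner_eq0.
Qed.

Lemma ssT_inj (T : alg R) c d : ssT T c = ssT T d -> c = d.
Proof.
move=> E; have H : gadd c (gopp d) = g0.
  by apply: (@ssT_uniq0 T); rewrite ssTD E -ssTD gaddN ssT0.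
have : gadd (gadd c (gopp d)) d = gadd g0 d by rewrite H.
rewrite gadd0 => <-; rewrite -[LHS]gadd0 -(gaddN d).
congr pair; apply: val_inj; rewrite /= ?modnDml ?modnDmr; congr (_ %% _)%N; lia.
Qed.

Lemma ssf_ker (T : alg R) c : hcomp (ssT T c) (ssf D) = gone (ssX D) T.
Proof.
suff E : hcomp (ssi D c) (ssf D) = gone (ssX D) (triv R).
  by rewrite /ssT -hcompA E gone_nat.
apply/ssi_exact; exists [ffun c' => (c' == c)%:R]; split.
  split=> [|b]; first exact: constPt_deltaP.
  by rewrite (delta_sum c (fun c' => astr (triv R) (ssi D c' b))).
move=> e [/(constPt_delta cR)[d ->] He]; suff -> : c = d by [].
apply: (@ssT_inj (triv R)); apply: hom_ext => b.
have := He b; rewrite (delta_sum d (fun c' => astr (triv R) (ssi D c' b))).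
by move=> E; rewrite /= E.
Qed.

Lemma ssf_ker_ex (T : alg R) (y : hom (gring (ssY D)) T) : conn T ->
  hcomp y (ssf D) = gone (ssX D) T -> exists c, y = ssT T c.
Proof.
move=> cT /ssi_exact[e [[/(constPt_delta cT)[c ->] He] _]]; exists c.
apply: hom_ext => b; rewrite He.
by rewrite (delta_sum c (fun c' => astr T (ssi D c' b))).
Qed.

Definition transl c : hom (gring (ssY D)) (gring (ssY D)) :=
  gmul (hid _) (ssT (gring (ssY D)) c).

Lemma translE (T : alg R) (y : hom (gring (ssY D)) T) c :
  hcomp y (transl c) = gmul y (ssT T c).
Proof. by rewrite gmul_nat hcomp1 ssT_nat. Qed.

Lemma transl_ssf c : hcomp (transl c) (ssf D) = ssf D.
Proof. by rewrite ssf_morph ssf_ker hcomp1l gmulC gmul1. Qed.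

Definition ssact c : hom (Alg (hmap (ssf D))) (Alg (hmap (ssf D))) :=
  @Hom _ (Alg (hmap (ssf D))) (Alg (hmap (ssf D))) (hmap (transl c))
    (fun s => f_equal (fun h : hom (gring (ssX D)) (gring (ssY D)) => h s) (transl_ssf c)).

(** The points of Y above a geometric point of X form a coset of the kernel of f, and over a field
    exactness identifies this kernel with Gam. *)
Lemma ss_torsor : torsor gadd ssact.
Proof.
split.
- exact: ssf_fet.
- move=> c d; apply: hom_ext => x.
  have : hcomp (transl c) (transl d) = transl (gadd c d).
    by rewrite translE /transl ssTD gmulA.
  by move/(f_equal (fun h : hom (gring (ssY D)) (gring (ssY D)) => h x)).
- move=> c d; apply: hom_ext => x.
  have : hcomp (transl c) (transl d) = hcomp (transl d) (transl c).
    by rewrite !translE /transl -!gmulA [gmul (ssT _ d) _]gmulC.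
  by move/(f_equal (fun h : hom (gring (ssY D)) (gring (ssY D)) => h x)).
- move=> w h h'; pose T : alg R := resAlg (astr (gring (ssX D))) w.
  have hS (g : hom (Alg (hmap (ssf D))) w) s : g (astr (gring (ssY D)) s) = astr T s.
    by rewrite -(hmapE (ssf D)); exact: (hmapE g).
  pose Y (g : hom (Alg (hmap (ssf D))) w) : hom (gring (ssY D)) T :=
    @Hom R (gring (ssY D)) T (hmap g) (hS g).
  have Yf g g' : hcomp (Y g) (ssf D) = hcomp (Y g') (ssf D).
    by apply: hom_ext => s /=; rewrite (hmapE g) (hmapE g').
  have Yact g c : Y (hcomp g (ssact c)) = gmul (Y g) (ssT T c).
    by rewrite -translE; apply: hom_ext.
  have Yinj g g' : Y g = Y g' -> g = g'.
    move=> E; apply: hom_ext => x.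
    exact: (f_equal (fun k : hom (gring (ssY D)) T => k x) E).
  have cT : conn T by exact: conn_idomain.
  have [y' yy'] := gmulV (Y h).
  have [|c cE] := @ssf_ker_ex T (gmul y' (Y h')) cT.
    by rewrite ssf_morph (Yf h' h) -ssf_morph gmulC yy' ssf_one.
  exists c; split.
    by apply: Yinj; rewrite Yact -cE gmulA yy' gmul1.
  move=> d hd; apply: (@ssT_inj T); apply: (@gmulI _ _ _ (Y h)).
  by rewrite -cE gmulA yy' gmul1 -Yact -hd.
Qed.
End SekiguchiSuwa.

(** * The restrictions of f to the two fibres, in coordinates *)

Section FibreUniversal.
Variables (R S : comNzRingType) (j : {rmorphism R -> S}) (Z : grpScheme R).
Variables (d : nat) (G : xgroup d) (iso : fibreIso j Z G) (O : coordRing S G).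

Lemma fibre_pt_ex : exists u : hom (gring Z) (resAlg j O), iso O u = xuniv O.
Proof. exact: (fiso_im iso (xuniv O)).1 (xuniv_dom O). Qed.

Variable u : hom (gring Z) (resAlg j O).
Hypothesis uE : iso O u = xuniv O.

Lemma fibre_coord (T : alg S) (h : hom O T) i :
  iso T (hcomp (resHom j h) u) i = h (xuniv O i).
Proof. by rewrite fiso_nat uE. Qed.

Lemma fibre_lift (T : alg S) (y : hom (gring Z) (resAlg j T)) :
  exists h : hom O T, hcomp (resHom j h) u = y.
Proof.
have dy : xdom G (iso T y) by apply/(fiso_im iso); exists y.
have [h hE] := @xuniv_ex _ _ _ O T _ dy.
by exists h; apply: (fiso_inj (f := iso)); apply/ffunP => i; rewrite fibre_coord hE.
Qed.

Lemma fibre_uniq (T : alg S) (h h' : hom O T) :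
  hcomp (resHom j h) u = hcomp (resHom j h') u -> h = h'.
Proof. by move=> E; apply: xuniv_uniq => i; rewrite -!fibre_coord E. Qed.
End FibreUniversal.

Section FibreCover.
Variables (p n : nat) (R K : comNzRingType).
Variables (j0 : {rmorphism R -> K}) (r : {rmorphism R -> 'F_p}).
Variable D : sekiguchiSuwa n j0 r.
Variables (S : comNzRingType) (j : {rmorphism R -> S}) (d : nat) (G : xgroup d).
Variables (isoY : fibreIso j (ssY D) G) (isoX : fibreIso j (ssX D) G).
Variable O : coordRing S G.
Variables (uY : hom (gring (ssY D)) (resAlg j O)) (uX : hom (gring (ssX D)) (resAlg j O)).
Hypotheses (uYE : isoY O uY = xuniv O) (uXE : isoX O uX = xuniv O).

Lemma fibre_map_ex : exists q : hom O O, hcomp (resHom j q) uX = hcomp uY (ssf D).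
Proof. exact: (fibre_lift (T := O) uXE (hcomp uY (ssf D))). Qed.

Variable q : hom O O.
Hypothesis qE : hcomp (resHom j q) uX = hcomp uY (ssf D).

Lemma fibre_sq s : uY (ssf D s) = q (uX s).
Proof. by rewrite -[RHS]/(hcomp (resHom j q) uX s) qE. Qed.

Definition cover_map : hom (Alg (hmap (ssf D))) (resAlg (hmap uX) (Alg (hmap q))) :=
  @Hom _ (Alg (hmap (ssf D))) (resAlg (hmap uX) (Alg (hmap q))) (hmap uY) fibre_sq.

(** The Cartesian square between f and its restriction to a fibre, verified on points: a point of Y
    over the base S corresponds to a point of the coordinate ring, and so does its image in X. *)
Lemma cover_pushout : is_pushout cover_map.
Proof.
move=> T g; pose T0 : alg S := resAlg (astr O) T.
have gS s : g (astr (gring (ssY D)) s) = astr (resAlg j T0) s.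
  rewrite -(hmapE (ssf D)); have := hmapE g (astr (gring (ssX D)) s).
  by rewrite /= (hmapE uX) => ->.
pose y : hom (gring (ssY D)) (resAlg j T0) := @Hom R (gring (ssY D)) (resAlg j T0) (hmap g) gS.
have [h hy] := fibre_lift uYE y.
pose a : hom O T0 := @Hom S O T0 (astr T) (fun=> erefl).
have hq : hcomp h q = a.
  apply: (fibre_uniq uXE); apply: hom_ext => s; rewrite /= -fibre_sq.
  have := f_equal (fun k : hom (gring (ssY D)) (resAlg j T0) => k (ssf D s)) hy.
  by rewrite /= => ->; exact: (hmapE g).
pose h' : hom (Alg (hmap q)) T :=
  @Hom O (Alg (hmap q)) T (hmap h) (fun s => f_equal (fun k : hom O T0 => k s) hq).
exists h'; split.
  apply: hom_ext => x.
  exact: (f_equal (fun k : hom (gring (ssY D)) (resAlg j T0) => k x) hy).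
move=> k kE.
have kS s : k (astr O s) = astr T0 s.
  rewrite -[RHS]/(astr T (astr O s)) -(hmapE k); congr (k _).
  by rewrite /= (hmapE q).
pose k' : hom O T0 := @Hom S O T0 (hmap k) kS.
have hk : h = k'.
  apply: (fibre_uniq uYE); rewrite hy; apply: hom_ext => x.
  exact: (f_equal (fun l : hom (Alg (hmap (ssf D))) (resAlg (hmap uX) T) => l x) (esym kE)).
by apply: hom_ext => x; rewrite /= hk.
Qed.

Hypotheses (pp : prime p) (op : odd p) (cR : conn R).

(** The action comes by base change; the last clause identifies it with translation by the kernel,
    from which its effect on coordinates is computed. *)
Lemma cover_torsor : exists act : Gam p n -> hom (Alg (hmap q)) (Alg (hmap q)),
  [/\ torsor (gadd (n := n) pp op) act,
      forall c, hcomp (resHom (hmap uX) (act c)) cover_map = hcomp cover_map (ssact pp op D cR c) &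
      forall c, exists2 a : hom O O, (forall x, a x = act c x) &
        hcomp (resHom j a) uY = gmul uY (ssT D (resAlg j O) c)].
Proof.
have [act [actT actE]] := torsor_pushout (ss_torsor pp op D cR) cover_pushout.
exists act; split=> // c.
have aS s : act c (astr O s) = astr O s.
  have := hmapE (act c) (astr O s); rewrite /= (hmapE q); exact.
exists (@Hom S O O (hmap (act c)) aS) => //.
rewrite -translE; apply: hom_ext => x.
exact: (f_equal (fun k : hom (Alg (hmap (ssf D))) (resAlg (hmap uX) (Alg (hmap q))) => k x) (actE c)).
Qed.
End FibreCover.

(** * Connectedness of a group scheme with connected fibres *)

Section ConnectedY.
Variables (p n : nat) (R : comNzRingType) (K : fieldType).
Hypothesis pp : prime p.
Variables (j : {rmorphism R -> K}) (r : {rmorphism R -> 'F_p}).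
Variables (Z : grpScheme R) (d d' : nat) (G : xgroup d) (G' : xgroup d').
Variables (isoK : fibreIso j Z G) (isoF : fibreIso r Z G').
Variables (OK : coordRing (K : comNzRingType) G) (OF : coordRing ('F_p : comNzRingType) G').
Hypotheses (cOK : conn OK) (cOF : conn OF) (cR : conn R) (ji : injective j).
Hypothesis fracK : forall x : K, exists k a, j a = p%:R ^+ k * x.
Hypothesis kerF : forall x : R, r x = 0 -> exists m y, x ^+ m = p%:R * y.
Hypothesis pK : p%:R != 0 :> K.

Let rnat (a : 'F_p) : r (a : nat)%:R = a.
Proof. by rewrite rmorph_nat natr_Zp. Qed.

(** Replacing e by 1 - e if necessary, e vanishes at the unit section and so on both fibres. If e
    were not 0, the factor T on which e is 1 would admit, compatibly with R, no map to a K-algebra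
    and none to an F_p-algebra ([noK], [noF]). But either p is invertible in T, or T modulo the
    radical of pT is an F_p-algebra. *)
Lemma grp_conn : conn (gring Z).
Proof.
have [uK uKE] := fibre_pt_ex isoK OK; have [uF uFE] := fibre_pt_ex isoF OF.
suff key (e : gring Z) : e * e = e -> gone Z (triv R) e = 0 -> e = 0.
  move=> e ee; have [|e0|e1] := cR (e := gone Z (triv R) e); first by rewrite -rmorphM ee.
    by left; apply: key.
  right; apply/eqP; rewrite eq_sym -subr_eq0; apply/eqP; apply: key.
    exact: idem_opp.
  by rewrite rmorphB rmorph1 e1 subrr.
move=> ee eg.
have uK0 : uK e = 0.
  have [|//|e1] := cOK (e := uK e); first by rewrite -rmorphM ee.
  have [h hE] := fibre_lift uKE (gone Z (resAlg j (triv (K : comNzRingType)))).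
  have := f_equal (fun k : hom (gring Z) (resAlg j (triv (K : comNzRingType))) => k e) hE.
  rewrite /= e1 rmorph1.
  have <- := gone_nat Z (@Hom R (triv R) (resAlg j (triv (K : comNzRingType))) j (fun=> erefl)).
  by rewrite /= eg rmorph0 => /eqP; rewrite oner_eq0.
have uF0 : uF e = 0.
  have [|//|e1] := cOF (e := uF e); first by rewrite -rmorphM ee.
  have [h hE] := fibre_lift uFE (gone Z (resAlg r (triv ('F_p : comNzRingType)))).
  have := f_equal (fun k : hom (gring Z) (resAlg r (triv ('F_p : comNzRingType))) => k e) hE.
  rewrite /= e1 rmorph1.
  have <- := gone_nat Z (@Hom R (triv R) (resAlg r (triv ('F_p : comNzRingType))) r (fun=> erefl)).
  by rewrite /= eg rmorph0 => /eqP; rewrite oner_eq0.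
apply/eqP/negPn/negP => e0.
have [T [q [s [_ _ sK sq]]]] := factor_ring ee e0.
have qe : q e = 1.
  by apply: (can_inj sK); rewrite !sq ee -(rmorph1 q) sq mul1r.
pose f : {rmorphism R -> T} := q \o astr (gring Z).
have noK (T' : alg (K : comNzRingType)) (g : {rmorphism T -> T'}) :
    (forall x, g (f x) = astr T' (j x)) -> False.
  move=> gE; pose y : hom (gring Z) (resAlg j T') :=
    @Hom R (gring Z) (resAlg j T') (g \o q : {rmorphism gring Z -> T'}) gE.
  have [h hE] := fibre_lift uKE y.
  have := f_equal (fun k : hom (gring Z) (resAlg j T') => k e) hE.
  by rewrite /= uK0 rmorph0 qe rmorph1 => /eqP; rewrite eq_sym oner_eq0.
have noF (T' : alg ('F_p : comNzRingType)) (g : {rmorphism T -> T'}) :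
    (forall x, g (f x) = astr T' (r x)) -> False.
  move=> gE; pose y : hom (gring Z) (resAlg r T') :=
    @Hom R (gring Z) (resAlg r T') (g \o q : {rmorphism gring Z -> T'}) gE.
  have [h hE] := fibre_lift uFE y.
  have := f_equal (fun k : hom (gring Z) (resAlg r T') => k e) hE.
  by rewrite /= uF0 rmorph0 qe rmorph1 => /eqP; rewrite eq_sym oner_eq0.
pose J (t : T) := exists m y, t ^+ m = p%:R * y.
have [J1|nJ1] := pselect (J 1).
  have [m [b]] := J1; rewrite expr1n => pb.
  have pbX k : p%:R ^+ k * b ^+ k = 1 by rewrite -exprMn -pb expr1n.
  have /choice[k /choice[a aE]] := fracK.
  (* With b the inverse of p in T, the fraction a / p^k is sent to f(a) b^k, which makes T a
     K-algebra. *)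
  pose F x := f (a x) * b ^+ k x.
  have FE x k' a' : j a' = p%:R ^+ k' * x -> F x = f a' * b ^+ k'.
    move=> E; have H : p%:R ^+ k' * a x = p%:R ^+ k x * a'.
      by apply: ji; rewrite !rmorphM !rmorphXn !rmorph_nat aE E mulrCA.
    have := f_equal f H; rewrite !rmorphM !rmorphXn !rmorph_nat => {}H.
    transitivity (p%:R ^+ k' * b ^+ k' * (f (a x) * b ^+ k x)); first by rewrite pbX mul1r.
    transitivity (b ^+ k' * b ^+ k x * (p%:R ^+ k' * f (a x))); first by ring.
    transitivity (p%:R ^+ k x * b ^+ k x * (f a' * b ^+ k')); first by rewrite H; ring.
    by rewrite pbX mul1r.
  have FD x y : F (x + y) = F x + F y.
    rewrite (FE _ (k x + k y)%N (p%:R ^+ k y * a x + p%:R ^+ k x * a y)); last first.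
      by rewrite rmorphD !rmorphM !rmorphXn !rmorph_nat !aE exprD; ring.
    rewrite rmorphD !rmorphM !rmorphXn !rmorph_nat /F exprD.
    transitivity ((p%:R ^+ k y * b ^+ k y) * (f (a x) * b ^+ k x) +
      (p%:R ^+ k x * b ^+ k x) * (f (a y) * b ^+ k y)); first by ring.
    by rewrite !pbX !mul1r.
  have FM x y : F (x * y) = F x * F y.
    rewrite (FE _ (k x + k y)%N (a x * a y)); last by rewrite rmorphM !aE exprD; ring.
    by rewrite rmorphM /F exprD; ring.
  have F1 : F 1 = 1 by rewrite (FE _ 0%N 1) ?rmorph1 ?expr0 ?mulr1.
  have FB : zmod_morphism F.
    by move=> x y; apply: (@addIr _ (F y)); rewrite -FD !subrK.
  pose Q1 := GRing.isZmodMorphism.Build K T F FB.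
  pose Q2 := GRing.isMonoidMorphism.Build K T F (conj F1 FM).
  pose T' : alg (K : comNzRingType) := Alg (HB.pack F Q1 Q2 : {rmorphism K -> T}).
  apply: (noK T' (idfun : {rmorphism T -> T})) => x.
  by rewrite /= (FE _ 0%N x) ?expr0 ?mulr1 ?mul1r.
have [||||C [g gE]] := @quot_ring_ex T J.
- by exists 1%N, 0; rewrite mulr0 expr1.
- move=> x y [m [a ma]] [k [b kb]].
  exists (m + k)%N; rewrite exprDn.
  have : forall i : 'I_(m + k).+1, exists z, x ^+ (m + k - i) * y ^+ i *+ 'C(m + k, i) = p%:R * z.
    move=> i; case: (leqP k i) => ki.
      exists (x ^+ (m + k - i) * (y ^+ (i - k) * b) * 'C(m + k, i)%:R).
      have Ey : y ^+ i = y ^+ (i - k) * (p%:R * b) by rewrite -kb -exprD subnK.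
      by rewrite -mulr_natr Ey; ring.
    exists (x ^+ (k - i) * a * y ^+ i * 'C(m + k, i)%:R).
    have -> : (m + k - i = m + (k - i))%N by lia.
    by rewrite -mulr_natr exprD ma; ring.
  by case/choice => z zE; exists (\sum_i z i); rewrite mulr_sumr; apply: eq_bigr => i _.
- move=> a x [m [y E]]; exists m, (a ^+ m * y); rewrite exprMn E; ring.
- exact: nJ1.
have p0 : p%:R = 0 :> C.
  rewrite -(rmorph_nat g); apply/gE; exists 1%N, 1; by rewrite expr1 mulr1.
pose h (a : 'F_p) : C := (a : nat)%:R.
have modp (a b : nat) : a = b %[mod p] -> a%:R = b%:R :> C.
  move=> ab; rewrite (divn_eq a p) [in RHS](divn_eq b p) !natrD !natrM p0 !mulr0 ab //.
have hnat (a : nat) : h a%:R = a%:R.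
  by apply: modp; apply/eqP; rewrite -Fp_nat_dvd // natr_Zp.
have hD a b : h (a + b) = h a + h b.
  rewrite -natrD -[RHS]hnat natrD !natr_Zp //.
have hM a b : h (a * b) = h a * h b.
  by rewrite -natrM -[RHS]hnat natrM !natr_Zp.
have hB : zmod_morphism h.
  by move=> x y; apply: (@addIr _ (h y)); rewrite -hD !subrK.
have h1 : h 1 = 1 by exact: (hnat 1%N).
pose Q1 := GRing.isZmodMorphism.Build 'F_p C h hB.
pose Q2 := GRing.isMonoidMorphism.Build 'F_p C h (conj h1 hM).
pose T' : alg ('F_p : comNzRingType) := Alg (HB.pack h Q1 Q2 : {rmorphism 'F_p -> C}).
apply: (noF T' g) => x.
(* An element of R minus an integer lift of its residue is nilpotent modulo p, so it dies in C: the
   structure map of R factors through [r]. *)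
have /kerF[m [y E]] : r (x - (r x : nat)%:R) = 0 by rewrite rmorphB rnat subrr.
have /eqP : g (f (x - (r x : nat)%:R)) = 0.
  by apply/gE; exists m, (f y); rewrite -rmorphXn E rmorphM rmorph_nat.
by rewrite !rmorphB !rmorph_nat subr_eq0 => /eqP.
Qed.
End ConnectedY.

(** * Identities between alpha, gamma, theta and multiplication *)

Section GammaIdentities.
Variables (p : nat) (T : comNzRingType).
Hypothesis p0 : (0 < p)%N.

(** The sequence shifted by one, with 1 in front, so that the coordinate x_1^p of gamma has the same
    shape as the following quotients. *)
Let pr (a : nat -> T) m : T := if m is m'.+1 then a m' else 1.

Let seq_identities (a b : nat -> T) n :
  (forall k, (k < n)%N -> b k * pr a k = a k ^+ p) -> forall m, (m <= n)%N ->
  \prod_(i < m) b i ^+ (p ^ i) = pr a m ^+ (p ^ m) /\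
  \prod_(i < m) b i = (\prod_(i < m) a i) ^+ p.-1 * pr a m.
Proof.
move=> H; elim=> [|m IH] mn; first by rewrite !big_ord0 !expr1n mulr1.
have [IH1 IH2] := IH (ltnW mn); rewrite !big_ord_recr /= IH1 IH2; split.
  by rewrite -exprMn [pr a m * _]mulrC H // -exprM -expnS.
rewrite -mulrA [pr a m * _]mulrC H // exprMn -mulrA; congr (_ * _).
by rewrite -exprSr prednK.
Qed.

Variables (n : nat) (x z : {ffun 'I_n.+1 -> T}).
Hypothesis xz : isGamma p x z.

Let a i := x (inord i.+1).
Let b i := z (inord i.+1).

Let aE (i : 'I_n) : x (lift ord0 i) = a i.
Proof. by congr (x _); apply: val_inj; rewrite /= inordK ?lift0 // ltnS. Qed.
Let bE (i : 'I_n) : z (lift ord0 i) = b i.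
Proof. by congr (z _); apply: val_inj; rewrite /= inordK ?lift0 // ltnS. Qed.

Let abE k : (k < n)%N -> b k * pr a k = a k ^+ p.
Proof.
move=> kn; have := xz (inord k.+1); rewrite /b.
have -> : val (inord k.+1 : 'I_n.+1) = k.+1 by rewrite /= inordK // ltnS.
by case: k kn => [|k] kn //= ->; rewrite mulr1.
Qed.

Let x0E : z ord0 = x ord0 ^+ p.-1. Proof. exact: (xz ord0). Qed.

Let alpha_den : \prod_(i < n.+1 | (0 < i)%N) z i ^+ (p ^ i.-1) = pr a n ^+ (p ^ n).
Proof.
rewrite big_mkcond big_ord_recl /= mul1r.
rewrite -(seq_identities abE (leqnn n)).1; apply: eq_bigr => i _.
by rewrite bE.
Qed.

Let prodE : \prod_i z i = (\prod_i x i) ^+ p.-1 * pr a n.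
Proof.
rewrite !big_ord_recl x0E exprMn -mulrA; congr (_ * _).
under eq_bigr => i _ do rewrite bE.
under [in RHS]eq_bigr => i _ do rewrite aE.
exact: (seq_identities abE (leqnn n)).2.
Qed.

(** This is the identity between alpha o gamma and theta o m. The products telescope, and the
    denominator of alpha cancels a power of the last coordinate. *)
Lemma gamma_alpha A : (forall i, isUnit (x i)) -> isAlpha p z A ->
  A = (\prod_i x i) ^+ (p.-1 * p ^ n).
Proof.
move=> ux; rewrite /isAlpha alpha_den prodE exprMn -exprM => E.
have uy : isUnit (pr a n ^+ (p ^ n)).
  by apply: isUnitX; rewrite /pr; case: (n) => [|m]; [exists 1; rewrite mulr1|apply: ux].
by apply: (isUnit_inj uy); rewrite mulrC E mulrC.
Qed.

(** The product of the z_i is the (p-1)-st power of that of the x_i, times the last coordinate. So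
    the last coordinate is 1, and the relations give the others in descending order: m is injective
    on the kernel of gamma. *)
Lemma gamma_ker : (forall i, z i = 1) -> \prod_i x i = 1 -> forall i, x i = 1.
Proof.
move=> z1 Px1; have := prodE; rewrite Px1 expr1n mul1r big1 => [y1|i _]; last exact: z1.
have a1 : forall m k, (k + m.+1 = n)%N -> a k = 1.
  elim=> [|m IH] k km.
    by have kn : n = k.+1 by [rewrite -km addn1]; move: y1; rewrite [X in pr a X]kn.
  have k1n : (k.+1 < n)%N by rewrite -km; lia.
  by have := abE k1n; rewrite /b z1 mul1r /= => ->; rewrite IH ?expr1n // -km addSnnS.
have xi (i : 'I_n) : x (lift ord0 i) = 1.
  by rewrite aE; apply: (a1 (n - i).-1); have := ltn_ord i; lia.
move=> i; case: (unliftP ord0 i) => [k|] ->; first exact: xi.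
by move: Px1; rewrite big_ord_recl big1 ?mulr1 // => k _; apply: xi.
Qed.
End GammaIdentities.

Lemma gamma_ker_pow p n (T : comNzRingType) (x : {ffun 'I_n.+1 -> T}) :
  (0 < p)%N -> (forall i, isUnit (x i)) -> isGamma p x [ffun=> 1] ->
  (\prod_i x i) ^+ (p.-1 * p ^ n) = 1.
Proof.
move=> p0 ux Hx; apply/esym/(gamma_alpha p0 Hx) => //.
rewrite /isAlpha mul1r !big1 ?expr1n // => i _; rewrite ffunE ?expr1n //.
Qed.

Lemma isGamma_div p n (F : fieldType) (x y z : {ffun 'I_n.+1 -> F}) :
  (forall i, y i != 0) -> isGamma p x z -> isGamma p y z -> (forall i, z i != 0) ->
  isGamma p [ffun i => x i / y i] [ffun=> 1].
Proof.
move=> y0 Hx Hy z0 i; have := Hx i; have := Hy i; rewrite !ffunE.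
case: (val i) => [|[|k]] Ey Ex.
- by rewrite expr_div_n -Ex -Ey mulfV.
- by rewrite expr_div_n -Ex -Ey mulfV.
- by rewrite ffunE mul1r expr_div_n -Ex -Ey -mulf_div mulfV ?mul1r.
Qed.

(** * Arithmetic of Z_p[z] and Q_p[z] *)

Section CyclotomicArithmetic.
Variables (p n : nat) (Q : padicClosure p).
Hypothesis pp : prime p.
Variables (z : Q) (C : cyclotomic z).
Hypothesis hz : (p ^ n).-primitive_root z.

Lemma cR_conn : conn (cR C).
Proof.
move=> e ee; have : cRin C e * cRin C e = cRin C e by rewrite -rmorphM ee.
case/(conn_idomain (A := pcf Q)) => E; [left|right]; apply: (cRin_inj (c := C)).
  by rewrite E rmorph0.
by rewrite E rmorph1.
Qed.

Lemma cRK_inj : injective (cRK C).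
Proof. by move=> x y E; apply: (cRin_inj (c := C)); rewrite -!cRKE E. Qed.

Lemma cK_pchar0 : [pchar cK C] =i pred0.
Proof. by move=> q; rewrite -(fmorph_pchar (cKin C)); apply: pc_char0. Qed.

Lemma ratr_natM k (u : rat) : ratr (k%:R * u) = k%:R * ratr u :> Q.
Proof.
have den0 (w : rat) : (denq w)%:~R != 0 :> Q.
  have := denq_neq0 w; case: (denq w) => m m0.
    by rewrite -[_%:~R]/(m%:R : Q) Qnat_eq0.
  by rewrite -[_%:~R]/(- m.+1%:R : Q) oppr_eq0 Qnat_eq0.
have rE (w : rat) (a b : Q) : (denq w)%:~R = b -> (numq w)%:~R = a -> ratr w = a / b.
  by move=> <- <-.
rewrite !(rE _ _ _ erefl erefl) mulrA; apply/eqP; rewrite eqr_div //; apply/eqP.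
have -> : k%:R = (k%:Z)%:~R :> Q by []. 
rewrite -!intrM; congr (_%:~R); apply: (@intr_inj rat).
by rewrite !rmorphM /= !numqE; ring.
Qed.

Lemma isQp_zp (x : Q) : isQp (@pval p Q) x -> exists k, zp (p%:R ^+ k * x).
Proof.
move=> [u Hu]; have [k kx] := nat_ge (- pval x).
exists k; apply/(zpP pp); split; last first.
  apply/near_vge; rewrite subr0.
  have [->|x0] := eqVneq x 0; first by rewrite mulr0; left.
  by right; rewrite pvalM ?expf_neq0 ?Qp_neq0 // pvalpX //; lra.
exists (fun i => (p ^ k)%:R * u i); apply/limit_nat => l.
have [m Hm] := (limit_nat _ _).1 Hu l; exists m => i /Hm H.
rewrite ratr_natM natrX -mulrBr; apply: vgeMl H.
by apply: vgeX; apply: vge_nat.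
Qed.

Lemma cK_frac (x : cK C) : exists k a, cRK C a = p%:R ^+ k * x.
Proof.
have [P HP xP] := (cKin_im C (cKin C x)).1 (ex_intro _ x erefl).
have /choice[k kP] i := isQp_zp (HP i).
pose m := (\sum_(i < size P) k i)%N.
have [a aE] : exists a, cRin C a = p%:R ^+ m * cKin C x.
  apply/cRin_im; exists (p%:R ^+ m *: P); last by rewrite hornerZ -xP.
  move=> i; apply/(zpP pp); rewrite coefZ; case: (ltnP i (size P)) => iP; last first.
    by rewrite nth_default // mulr0; apply: (zp_nat Q 0).
  have -> : m = (k i + \sum_(j < size P | j != Ordinal iP) k j)%N.
    by rewrite /m (bigD1 (Ordinal iP)).
  rewrite addnC exprD -mulrA; apply: zpM; last exact: kP.
  by apply: zpX; apply: zp_nat.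
exists m, a; apply: (fmorph_inj (cKin C)).
by rewrite cRKE aE rmorphM rmorphXn rmorph_nat.
Qed.

Lemma expDp (T : comNzRingType) (a b : T) :
  exists w, (a + b) ^+ p = a ^+ p + b ^+ p + p%:R * w.
Proof.
case: p pp => // q pq; rewrite exprDn big_ord_recl big_ord_recr /=.
rewrite subn0 expr0 mulr1 bin0 subnn mul1r binn !mulr1n.
have : forall i : 'I_q, exists w, a ^+ (q.+1 - lift ord0 (widen_ord (leqnSn q) i)) *
    b ^+ lift ord0 (widen_ord (leqnSn q) i) *+ 'C(q.+1, lift ord0 (widen_ord (leqnSn q) i))
    = q.+1%:R * w.
  move=> i; have /dvdnP[c ->] : (q.+1 %| 'C(q.+1, lift ord0 (widen_ord (leqnSn q) i)))%N.
    by apply: prime_dvd_bin => //; rewrite lift0 /= ltnS ltn_ord.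
  set X := _ * _; exists (X *+ c); by rewrite mulrnA mulr_natl.
move=> /choice[w wE]; exists (\sum_i w i).
rewrite -addrA; congr (_ + _); rewrite addrC; congr (_ + _).
by rewrite mulr_sumr; apply: eq_bigr => i _; rewrite -wE.
Qed.

Lemma expDpn (T : comNzRingType) (a b : T) m :
  exists w, (a + b) ^+ (p ^ m) = a ^+ (p ^ m) + b ^+ (p ^ m) + p%:R * w.
Proof.
elim: m => [|m [w wE]]; first by exists 0; rewrite !expr1 mulr0 addr0.
rewrite expnSr !exprM wE.
have [w1 ->] := expDp (a ^+ (p ^ m) + b ^+ (p ^ m)) (p%:R * w).
have [w2 ->] := expDp (a ^+ (p ^ m)) (b ^+ (p ^ m)).
exists (w2 + p%:R ^+ p.-1 * w ^+ p + w1).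
rewrite exprMn; have -> : p%:R ^+ p = p%:R * p%:R ^+ p.-1 :> T.
  by rewrite -exprS prednK ?prime_gt0.
ring.
Qed.

(** The root z reduces to 1, since a^(p^n) = a in F_p, and (z - 1)^(p^n) is divisible by p. In x = s
    + (z - 1) y with s in Z_p, the residue shows that p divides s, hence p divides x^(p^n). *)
Lemma cRF_ker (x : cR C) : cRF C x = 0 -> exists m y, x ^+ m = p%:R * y.
Proof.
move=> rx0.
have inR (a : Q) : zp a -> exists b, cRin C b = a.
  move=> za; apply/cRin_im; exists a%:P; last by rewrite hornerC.
  move=> i; apply/(zpP pp); rewrite coefC; case: eqP => _ //; exact: (zp_nat Q 0).
have [z0 z0E] : exists b, cRin C b = z.
  apply/cRin_im; exists 'X; last by rewrite hornerX.
  by move=> i; apply/(zpP pp); rewrite coefX; apply: zp_nat.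
have z0n : z0 ^+ (p ^ n) = 1.
  by apply: (cRin_inj (c := C)); rewrite rmorphXn z0E (prim_expr_order hz) rmorph1.
have rz0 : cRF C z0 = 1.
  have Fpn (a : 'F_p) : a ^+ (p ^ n) = a.
    by elim: n => [|m IH]; rewrite ?expr1 // expnS exprM Fp_expp.
  by rewrite -[LHS]Fpn -rmorphXn z0n rmorph1.
have [P HP xP] := (cRin_im C (cRin C x)).1 (ex_intro _ x erefl).
have /choice[c cE] i : exists b, cRin C b = P`_i by apply/inR/(zpP pp).
pose N := size P; pose s := \sum_(i < N) c i.
pose y := \sum_(i < N) c i * \sum_(l < i) z0 ^+ l.
have xE : x = s + (z0 - 1) * y.
  transitivity (\sum_(i < N) c i * z0 ^+ i).
    apply: (cRin_inj (c := C)); rewrite xP horner_coef rmorph_sum; apply: eq_bigr => i _.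
    by rewrite rmorphM rmorphXn z0E cE.
  rewrite /s /y mulr_sumr -big_split; apply: eq_bigr => i _ /=.
  by rewrite mulrCA -subrX1; ring.
have zs : zp (cRin C s).
  by rewrite rmorph_sum; apply: zp_sum => i _; rewrite cE; apply/(zpP pp).
have [m sm] := zs 1%N.
have [b zb bE] := zp_div pp (zpB pp zs (zp_nat Q m)) sm.
have [b0 b0E] := inR b zb.
have sE : s = m%:R + p%:R * b0.
  apply: (cRin_inj (c := C)); rewrite rmorphD rmorphM !rmorph_nat b0E.
  by rewrite -[p%:R]expr1 -bE addrC subrK.
have pF : p%:R = 0 :> 'F_p by rewrite pchar_Fp_0.
have /dvdnP[m' m'E] : (p %| m)%N.
  move: rx0; rewrite xE sE !rmorphD !rmorphM !rmorph_nat pF mul0r addr0 rmorphB rz0.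
  by rewrite rmorph1 subrr mul0r addr0 => /eqP; rewrite -(dvdn_pcharf (pchar_Fp pp)).
have [w wE] : exists w, (z0 - 1) ^+ (p ^ n) = p%:R * w.
  have [w] := expDpn (z0 - 1) 1 n; rewrite subrK z0n expr1n => E.
  exists (- w); apply: (@addIr _ (1 + p%:R * w)); rewrite addrA -E; ring.
have x2 : x = p%:R * (m'%:R + b0) + (z0 - 1) * y.
  by rewrite xE sE m'E natrM; ring.
have [w' w'E] := expDpn (p%:R * (m'%:R + b0)) ((z0 - 1) * y) n.
exists (p ^ n)%N, (p%:R ^+ (p ^ n).-1 * (m'%:R + b0) ^+ (p ^ n) + w * y ^+ (p ^ n) + w').
rewrite {1}x2 w'E !exprMn wE.
have -> : p%:R ^+ (p ^ n) = p%:R * p%:R ^+ (p ^ n).-1 :> cR C.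
  by rewrite -exprS prednK // expn_gt0 prime_gt0.
ring.
Qed.
End CyclotomicArithmetic.

(** * The kernel of f on the special and the generic fibre *)

Lemma ghost_inj p (T : comNzRingType) n (x y : {ffun 'I_n -> T}) : (0 < p)%N ->
  (forall m (a b : T), (0 < m)%N -> a *+ m = b *+ m -> a = b) ->
  (forall k, ghost p x k = ghost p y k) -> x = y.
Proof.
move=> p0 tf xy; suff H : forall k (i : 'I_n), val i = k -> x i = y i.
  by apply/ffunP => i; apply: (H i).
elim/ltn_ind=> k IH i ik; have := xy i; rewrite /ghost.
rewrite (bigD1 i (leqnn i)) [X in _ = X](bigD1 i (leqnn i)) subnn !expr1 /=.
have -> : \sum_(l < n | (l <= i)%N && (l != i)) x l ^+ (p ^ (i - l)) *+ p ^ l =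
          \sum_(l < n | (l <= i)%N && (l != i)) y l ^+ (p ^ (i - l)) *+ p ^ l.
  apply: eq_bigr => l /andP[li ne]; rewrite (IH l) // -ik ltn_neqAle li andbT.
  exact: ne.
by move=> /addIr; apply: tf; rewrite expn_gt0 p0.
Qed.

(** [wittAdd] quantifies over the addition polynomials; as integral polynomials have no torsion,
    these are unique and the group law is a function. *)
Lemma wittPolys_uniq p n P P' : (0 < p)%N -> @wittPolys p n P -> wittPolys p P' -> P = P'.
Proof.
move=> p0 HP HP'; apply: (ghost_inj p0) => [m a b m0 E|k]; last by rewrite HP HP'.
apply/mpolyP => mo; apply/eqP.
by move/(f_equal (mcoeff mo)): E; rewrite !mcoeffMn => /eqP; rewrite eqr_pMn2r.
Qed.

Lemma gmWitt_fun p n (T : comNzRingType) (x y z z' : {ffun 'I_n.+1 -> T}) : (0 < p)%N ->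
  xop (gmWitt p n) x y z -> xop (gmWitt p n) x y z' -> z = z'.
Proof.
move=> p0 [z0 [P HP zP]] [z0' [P' HP' zP']].
have E := wittPolys_uniq p0 HP HP'.
apply/ffunP => i; case: (unliftP ord0 i) => [j|] ->; last by rewrite z0 z0'.
by have := zP j; rewrite E -(zP' j) !ffunE.
Qed.

Section FrobeniusPoints.
Variables (p n : nat) (pp : prime p) (op : odd p).
Variables (R K : comNzRingType) (j : {rmorphism R -> K}) (r : {rmorphism R -> 'F_p}).
Variables (D : sekiguchiSuwa n j r).
Local Notation Fp := (triv ('F_p : comNzRingType)).
Local Notation T := (resAlg r Fp).

Let p0 : (0 < p)%N. Proof. exact: prime_gt0. Qed.

(** The coordinates of the kernel on the special fibre; by [fpt_inj] and [fpt_ex] they identify Gam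
    with the F_p-points of G_m x W_n. *)
Definition fpt (c : Gam p n) : {ffun 'I_n.+1 -> 'F_p} := ssYF D Fp (ssT D T c).

Lemma fpt_inj : injective fpt.
Proof.
move=> a b E; apply: (ssT_inj pp op (D := D) (T := T)).
apply: (fiso_inj (f := ssYF D)); exact: E.
Qed.

Lemma fptD a b : xop (gmWitt p n) (fpt a) (fpt b) (fpt (gadd pp op a b)).
Proof. rewrite /fpt ssTD. exact (fisoM (ssYF D) (ssT D T a) (ssT D T b)). Qed.

Lemma fpt_unit c : fpt c ord0 != 0.
Proof.
by apply/isUnit_field; apply: (fiso_im (ssYF D) (T := Fp) (fpt c)).2; exists (ssT D T c).
Qed.

Lemma gmWitt_gone (Z : grpScheme R) (f : fibreIso r Z (gmWitt p n))
    (z x : {ffun 'I_n.+1 -> 'F_p}) :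
  xdom (gmWitt p n) z -> xdom (gmWitt p n) x -> xop (gmWitt p n) z x x ->
  z = f Fp (gone Z T).
Proof.
move=> /(fiso_im f (T := Fp))[u <-] /(fiso_im f (T := Fp))[k <-] H; congr (f Fp _).
apply: (@gmulI _ _ _ k); rewrite gmulC [RHS]gmulC gmul1.
by apply: (fiso_inj (f := f)); apply: (gmWitt_fun p0 _ H); exact (fisoM f u k).
Qed.

(** Frobenius fixes the F_p-points, so Lang sends them to the unit and they lie in the kernel of
    f. *)
Lemma fpt_ex (x : {ffun 'I_n.+1 -> 'F_p}) : x ord0 != 0 -> exists c, x = fpt c.
Proof.
move=> /isUnit_field x0; have /(fiso_im (ssYF D) (T := Fp))[k kx] : xdom (gmWitt p n) x by [].
have H := ssfF (T := Fp) k; rewrite /isLang kx in H.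
have xp : [ffun i => x i ^+ p] = x by apply/ffunP => i; rewrite ffunE Fp_expp.
rewrite xp in H.
have z1 : ssXF D Fp (hcomp k (ssf D)) = ssXF D Fp (gone (ssX D) T).
  apply: (gmWitt_gone (ssXF D) _ _ H) => //.
  by apply/(fiso_im (ssXF D) (T := Fp)); exists (hcomp k (ssf D)).
have cT : conn T by exact: (conn_idomain (A := 'F_p)).
have [c kc] := ssf_ker_ex cT (fiso_inj (f := ssXF D) z1).
by exists c; rewrite -kx kc.
Qed.

(** From e e = e: the first coordinate equals its square, and the p-adic integer of the Witt part is
    congruent to its double, so its digits vanish. *)
Lemma fpt0 (Q : padicClosure p) :
  fpt (g0 n pp op) ord0 = 1 /\ forall i, i != ord0 -> fpt (g0 n pp op) i = 0.
Proof.
set e := fpt _; have e0 := fpt_unit (g0 n pp op).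
have [E /(wittAdd_digits Q pp) W] : xop (gmWitt p n) e e e.
  by have := fptD (g0 n pp op) (g0 n pp op); rewrite gadd0.
split; first by apply: (mulfI e0); rewrite mulr1; exact/esym.
have et : ftail e = [ffun=> 0].
  apply/esym/(digits_inj (Q := Q) (pp := pp)).
  have -> : digits Q pp ([ffun=> 0] : {ffun 'I_n -> 'F_p}) = 0.
    by apply: big1 => i _; rewrite ffunE teich0 mulr0.
  by rewrite sub0r; move: W; rewrite opprD addrA subrr sub0r.
move=> i; case: (unliftP ord0 i) => [l|] -> //.
by move/ffunP/(_ l): et; rewrite !ffunE.
Qed.
End FrobeniusPoints.

Section KummerFibre.
Variables (p n : nat) (pp : prime p) (op : odd p).
Variables (R : comNzRingType) (K : fieldType).
Variables (j : {rmorphism R -> K}) (r : {rmorphism R -> 'F_p}).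
Variables (D : sekiguchiSuwa n (j : {rmorphism R -> (K : comNzRingType)}) r) (cR : conn R).
Local Notation KK := (triv (K : comNzRingType)).
Local Notation N := (p.-1 * p ^ n)%N.

Let p0 : (0 < p)%N. Proof. exact: prime_gt0. Qed.

Definition kap (c : Gam p n) : {ffun 'I_n.+1 -> K} := ssYK D KK (ssT D (resAlg j KK) c).

Lemma kapE (T : alg (K : comNzRingType)) c i :
  ssYK D T (ssT D (resAlg j T) c) i = astr T (kap c i).
Proof.
pose g : hom KK T := @Hom _ KK T (astr T) (fun=> erefl).
by rewrite -[RHS]/(g _) -(fiso_nat (ssYK D) g) ssT_nat.
Qed.

Lemma kapD a b i : kap (gadd pp op a b) i = kap a i * kap b i.
Proof. by rewrite /kap ssTD; exact (fisoM (ssYK D) (ssT D (resAlg j KK) a) _ i). Qed.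

Lemma kap_neq0 c i : kap c i != 0.
Proof.
apply/isUnit_field; move: i.
by apply: (fiso_im (ssYK D) (T := KK) (kap c)).2; exists (ssT D (resAlg j KK) c).
Qed.

Lemma kap_gamma c : isGamma p (kap c) [ffun=> 1].
Proof.
have := ssfK (T := KK) (ssT D (resAlg j KK) c).
rewrite (ssf_ker pp op) // -/(kap c).
suff -> : ssXK D KK (gone (ssX D) (resAlg j KK)) = [ffun=> 1] by [].
set e := gone _ _; apply/ffunP => i; rewrite ffunE.
have /(_ i)/isUnit_field e0 : xdom (torus n.+1) (ssXK D KK e).
  by apply: (fiso_im (ssXK D) (T := KK) _).2; exists e.
apply: (mulfI e0); rewrite mulr1.
by have := fisoM (ssXK D) e e i; rewrite gmul1 => <-.
Qed.

(** The restriction of m to the kernel of gamma. It is injective into the roots of unity of order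
    dividing (p-1)p^n, and by counting it identifies Gam with all of them; theta thereby becomes a
    Gam-torsor. *)
Definition kmu c := \prod_i kap c i.

Lemma kmuD a b : kmu (gadd pp op a b) = kmu a * kmu b.
Proof. by rewrite -big_split; apply: eq_bigr => i _; apply: kapD. Qed.

Lemma kmuN c : kmu c ^+ N = 1.
Proof.
apply: (gamma_ker_pow p0); last exact: kap_gamma.
by move=> i; apply/isUnit_field/kap_neq0.
Qed.

Lemma kmu_inj : injective kmu.
Proof.
move=> a b ab; have b0 := kap_neq0 b.
have G1 : isGamma p [ffun i => kap a i / kap b i] [ffun=> 1].
  by apply: isGamma_div b0 (kap_gamma a) (kap_gamma b) _ => i; rewrite ffunE oner_eq0.
have P1 : \prod_i [ffun i => kap a i / kap b i] i = 1.
  under eq_bigr => i _ do rewrite ffunE.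
  rewrite prodf_div -/(kmu a) ab -/(kmu b) mulfV //.
  by apply/prodf_neq0 => i _.
apply: (ssT_inj pp op (D := D) (T := resAlg j KK)); apply: (fiso_inj (f := ssYK D)).
apply/ffunP => i; have := gamma_ker p0 G1 (fun i => ffunE _ i) P1 i.
by rewrite ffunE => E; apply/(divIf (b0 i)); rewrite E divff.
Qed.
End KummerFibre.

(** * Equivariant maps between the covers *)

Section ThetaBaseChange.
Variables (F F' : fieldType) (j : {rmorphism F -> F'}).
Variables (O : coordRing (F : comNzRingType) (torus 1)).
Variables (O' : coordRing (F' : comNzRingType) (torus 1)).
Variable phi : hom O (resAlg (j : {rmorphism (F : comNzRingType) -> (F' : comNzRingType)}) O').
Hypothesis phit : phi (xuniv O ord0) = xuniv O' ord0.
Variables (Gam : finType) (mu : Gam -> F) (mu' : Gam -> F') (N : nat) (N0 : (0 < N)%N).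
Hypothesis mu'E : forall c, mu' c = j (mu c).
Hypotheses (muN : forall c, mu c ^+ N = 1) (muN' : forall c, mu' c ^+ N = 1).
Variables (th : hom O O) (th' : hom O' O').
Hypotheses (tht : th (xuniv O ord0) = xuniv O ord0 ^+ N)
  (tht' : th' (xuniv O' ord0) = xuniv O' ord0 ^+ N).

Lemma theta_base_change :
  exists g : hom (Alg (hmap th)) (resAlg (hmap phi) (Alg (hmap th'))), forall c,
    hcomp (resHom (hmap phi) (theta_act muN' N0 tht' c)) g = hcomp g (theta_act muN N0 tht c).
Proof.
have E : hcomp phi th = hcomp (resHom j th') phi.
  by apply: torus1_uniq; rewrite /= tht rmorphXn /= phit tht'.
have gE s : phi (th s) = th' (phi s).
  exact: (f_equal (fun h : hom O (resAlg j O') => h s) E).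
exists (@Hom O (Alg (hmap th)) (resAlg (hmap phi) (Alg (hmap th'))) (hmap phi) gE) => c.
apply: (theta_hom_eq (T := resAlg (hmap phi) (Alg (hmap th')))).
rewrite /= phit !theta_actE rmorphM phit; congr (_ * _).
by rewrite (hmapE phi) /= mu'E.
Qed.
End ThetaBaseChange.

Section GammaCover.
Variables (p n : nat) (pp : prime p) (op : odd p).
Variables (R : comNzRingType) (K : fieldType).
Variables (j : {rmorphism R -> K}) (r : {rmorphism R -> 'F_p}).
Variables (D : sekiguchiSuwa n (j : {rmorphism R -> (K : comNzRingType)}) r) (cR : conn R).
Local Notation N := (p.-1 * p ^ n)%N.
Variable O : coordRing (K : comNzRingType) (torus n.+1).
Variables (uY : hom (gring (ssY D)) (resAlg j O)) (uX : hom (gring (ssX D)) (resAlg j O)).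
Hypotheses (uYE : ssYK D O uY = xuniv O) (uXE : ssXK D O uX = xuniv O).
Variable q : hom O O.
Hypothesis qE : hcomp (resHom j q) uX = hcomp uY (ssf D).

Lemma gamma_univ : isGamma p (xuniv O) [ffun i => q (xuniv O i)].
Proof.
have := ssfK (T := O) uY; rewrite uYE -qE.
suff -> : ssXK D O (hcomp (resHom j q) uX) = [ffun i => q (xuniv O i)] by [].
by apply/ffunP => i; rewrite ffunE (fibre_coord uXE).
Qed.

Variable actq : Gam p n -> hom (Alg (hmap q)) (Alg (hmap q)).
Hypothesis actqE : forall c, exists2 a : hom O O, (forall x, a x = actq c x) &
        hcomp (resHom j a) uY = gmul uY (ssT D (resAlg j O) c).

Lemma gamma_act_coord c i : actq c (xuniv O i) = xuniv O i * astr O (kap D c i).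
Proof.
have [a aE aY] := actqE c; rewrite -aE -(fibre_coord uYE) aY.
by rewrite -(kapE D) -uYE; exact (fisoM (ssYK D) uY _ i).
Qed.

Variables (G : coordRing (K : comNzRingType) (torus 1)) (al : hom G O) (th : hom G G).
Hypothesis alE : isAlpha p (xuniv O) (al (xuniv G ord0)).
Hypothesis tht : th (xuniv G ord0) = xuniv G ord0 ^+ N.
Hypotheses (kN : forall c, kmu D c ^+ N = 1) (N0 : (0 < N)%N).

(** The map is m, and the square commutes by [gamma_alpha]. Translation by [c] multiplies the
    product of the coordinates by kmu(c), whence equivariance. *)
Lemma alpha_gamma_cover :
  exists g : hom (Alg (hmap th)) (resAlg (hmap al) (Alg (hmap q))), forall c,
    hcomp (resHom (hmap al) (actq c)) g = hcomp g (theta_act kN N0 tht c).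
Proof.
have xu i : isUnit (xuniv O i) by exact: (xuniv_dom O).
have [m mt] := torus1_hom G (x := \prod_i xuniv O i : O) (isUnit_prod _ (fun i _ => xu i)).
have qa : isAlpha p [ffun i => q (xuniv O i)] (q (al (xuniv G ord0))).
  have := f_equal q alE; rewrite /isAlpha rmorphM rmorphXn !rmorph_prod => E.
  under eq_bigr => i _ do rewrite ffunE -rmorphXn.
  by under [in RHS]eq_bigr => i _ do rewrite ffunE.
have E : hcomp m th = hcomp q al.
  apply: torus1_uniq; rewrite /= tht rmorphXn mt.
  exact/esym/(gamma_alpha (prime_gt0 pp) gamma_univ xu qa).
have gE s : m (th s) = q (al s).
  exact: (f_equal (fun h : hom G O => h s) E).
exists (@Hom G (Alg (hmap th)) (resAlg (hmap al) (Alg (hmap q))) (hmap m) gE) => c.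
apply: (theta_hom_eq (T := resAlg (hmap al) (Alg (hmap q)))).
rewrite /= theta_actE rmorphM mt (hmapE m) rmorph_prod.
under eq_bigr => i _ do rewrite gamma_act_coord.
by rewrite big_split /= -rmorph_prod mulrC.
Qed.
End GammaCover.

Section LangCover.
Variables (p n : nat) (pp : prime p) (op : odd p).
Variables (R : comNzRingType) (K : fieldType).
Variables (j : {rmorphism R -> (K : comNzRingType)}) (r : {rmorphism R -> 'F_p}).
Variables (D : sekiguchiSuwa n j r) (cR : conn R).
Local Notation FF := ('F_p : comNzRingType).
Variable O : coordRing FF (gmWitt p n).
Variables (uY : hom (gring (ssY D)) (resAlg r O)) (uX : hom (gring (ssX D)) (resAlg r O)).
Hypotheses (uYE : ssYF D O uY = xuniv O) (uXE : ssXF D O uX = xuniv O).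
Variable q : hom O O.
Hypothesis qE : hcomp (resHom r q) uX = hcomp uY (ssf D).

Lemma lang_univ : isLang p (gmWitt p n) (xuniv O) [ffun i => q (xuniv O i)] .
Proof.
have := ssfF (T := O) uY; rewrite uYE -qE.
suff -> : ssXF D O (hcomp (resHom r q) uX) = [ffun i => q (xuniv O i)] by [].
by apply/ffunP => i; rewrite ffunE (fibre_coord uXE).
Qed.

Variable actq : Gam p n -> hom (Alg (hmap q)) (Alg (hmap q)).
Hypothesis actqE : forall c, exists2 a : hom O O, (forall x, a x = actq c x) &
        hcomp (resHom r a) uY = gmul uY (ssT D (resAlg r O) c).
Hypothesis actqT : torsor (gadd (n := n) pp op) actq.

(** Here h is the Frobenius of h'. By the Lang equation it is the product of h' with the image of h'
    under Lang, which is x, the kernel point [c]. Going from h to h' is therefore translation by -c,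
    the source of the inverse in the trace. *)
Lemma frob_point (k : finClosure p) (x : hom O (triv FF)) (c : Gam p n)
    (h h' : hom (Alg (hmap q)) (geomIm (hmap x) (fcPt k))) :
  [ffun i => x (xuniv O i)] = fpt D c -> (forall b, hmap h b = hmap h' b ^+ p) ->
  h' = hcomp h (actq (gopp pp op c)).
Proof.
move=> xc hh'; pose T : alg FF := Alg (fcin k).
have hS (g : hom (Alg (hmap q)) (geomIm (hmap x) (fcPt k))) s : g (astr O s) = astr T s.
  have := hmapE g (astr O s); rewrite /= (hmapE q) => ->.
  by rewrite -[x _]/(hmap x _) (hmapE x).
pose F (g : hom (Alg (hmap q)) (geomIm (hmap x) (fcPt k))) : hom O T := @Hom FF O T (hmap g) (hS g).
pose y g := hcomp (resHom r (F g)) uY.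
have yE g i : ssYF D T (y g) i = g (xuniv O i) by rewrite (fibre_coord uYE).
have sE i : ssYF D T (ssT D (resAlg r T) c) i = fcin k (x (xuniv O i)).
  have := f_equal (fun f : {ffun 'I_n.+1 -> 'F_p} => f i) xc; rewrite ffunE => ->.
  pose g : hom (triv FF) T := @Hom _ (triv FF) T (astr T) (fun=> erefl).
  by rewrite -[RHS]/(g _) -(fiso_nat (ssYF D) g) ssT_nat.
have yh : y h = gmul (ssT D (resAlg r T) c) (y h').
  have L := ssfF (T := T) (y h').
  have xE : ssXF D T (hcomp (y h') (ssf D)) = ssYF D T (ssT D (resAlg r T) c).
    apply/ffunP => i; rewrite sE -hcompA -qE.
    have -> : hcomp (resHom r (F h')) (hcomp (resHom r q) uX) =
       hcomp (resHom r (hcomp (F h') q)) uX by apply: hom_ext.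
    by rewrite (fibre_coord uXE); exact: (hmapE h').
  have pE : [ffun i => ssYF D T (y h') i ^+ p] = ssYF D T (y h).
    by apply/ffunP => i; rewrite ffunE !yE -hh'.
  rewrite /isLang xE pE in L.
  apply: (fiso_inj (f := ssYF D)); apply: (gmWitt_fun (prime_gt0 pp) L).
  exact (fisoM (ssYF D) (ssT D (resAlg r T) c) (y h')).
have hE : h = hcomp h' (actq c).
  have [a aE aY] := actqE c.
  have E : F h = hcomp (F h') a.
    apply: (fibre_uniq uYE); rewrite -/(y h) yh gmulC.
    have -> : hcomp (resHom r (hcomp (F h') a)) uY = hcomp (resHom r (F h')) (hcomp (resHom r a) uY).
      exact: hom_ext.
    by rewrite aY gmul_nat ssT_nat.
  apply: hom_ext => s.
  by rewrite -[LHS]/(F h s) E /= aE.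
have h1 : hcomp h' (actq (g0 n pp op)) = h'.
  have [c0 c0E] := tor_ex h' h' actqT; rewrite {2}c0E.
  suff -> : g0 n pp op = c0 by [].
  apply: (tor_inj (h := h') actqT).
  have : hcomp (hcomp h' (actq c0)) (actq (g0 n pp op)) = hcomp h' (actq c0).
    by rewrite -hcompA (torD actqT) gaddC gadd0.
  by rewrite -c0E.
by rewrite hE -hcompA (torD actqT) gaddN h1.
Qed.
End LangCover.

(** * Characters of the units through Gam *)

Section UnitCharacters.
Variables (p n : nat) (pp : prime p) (op : odd p).
Variables (R : comNzRingType) (K : fieldType).
Variables (j : {rmorphism R -> (K : comNzRingType)}) (r : {rmorphism R -> 'F_p}).
Variables (D : sekiguchiSuwa n j r).
Variables (Q : padicClosure p) (l : nat) (Ql : padicClosure l).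
Local Notation G0 := (g0 n pp op).
Local Notation gadd := (gadd (n := n) pp op).

Lemma depthLe_trivial m (c : zpchar Q Ql) : depthLe m c <-> trivialOn c m.
Proof.
split=> [[d [dt _] dm] u /near_vge um|cm].
  apply: dt; apply/near_vge; apply: vge_le um; by rewrite ler_nat ltnS.
have ex : exists d, `[< trivialOn c d >] by exists m; apply/asboolP.
case: (ex_minnP ex) => d /asboolP dt dmin; exists d; last exact/dmin/asboolP.
by split=> // k /asboolP; apply: dmin.
Qed.

Lemma unit_pt_ex (u : Zpunit Q) : exists c, expIso u (fpt D c).
Proof.
have [x x0 ux] := expIso_total pp op n u.
by have [c xc] := fpt_ex pp D x0; exists c; rewrite -xc.
Qed.

(** The class of u modulo 1 + p^(n+1) Z_p as an element of Gam, by exponential coordinates followed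
    by the inverse of [fpt]. *)
Definition unit_pt u := projT1 (cid (unit_pt_ex u)).
Lemma unit_ptP u : expIso u (fpt D (unit_pt u)).
Proof. exact: (projT2 (cid (unit_pt_ex u))). Qed.

Lemma unit_pt_uniq u c : expIso u (fpt D c) -> c = unit_pt u.
Proof.
move=> uc; apply: (fpt_inj pp op (D := D)).
exact: (expIso_inj pp op uc (unit_ptP u)).
Qed.

Lemma unit_ptM u v t : uval t = uval u * uval v ->
  unit_pt t = gadd (unit_pt u) (unit_pt v).
Proof.
move=> tE; apply/esym/unit_pt_uniq.
exact: (expIso_mul pp op tE (unit_ptP u) (unit_ptP v) (fptD _ _ _ _ _)).
Qed.

Lemma unit_pt1 u : near (@pval p Q) n.+1%:R (uval u) 1 -> unit_pt u = G0.
Proof.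
move=> u1; apply/esym/unit_pt_uniq; have [e0 ei] := fpt0 pp op D Q.
exact: (expIso_one pp).
Qed.

Lemma unit_pt_surj c : exists u, unit_pt u = c.
Proof.
have [u uc] := expIso_ex Q pp op (fpt_unit D c).
by exists u; apply/esym/unit_pt_uniq.
Qed.

Lemma is_char1 (chi : Gam p n -> Ql) : is_char gadd chi -> chi G0 = 1.
Proof.
move=> [c0 cM]; have := cM G0 G0; rewrite gadd0 => E.
by apply: (mulfI (c0 G0)); rewrite mulr1 -E.
Qed.

(** The inverse is the one introduced by geometric Frobenius. Continuity is immediate, since the
    character is 1 on the open subgroup 1 + p^(n+1) Z_p. *)
Lemma unit_char_ex (chi : Gam p n -> Ql) : is_char gadd chi ->
  exists2 c : zpchar Q Ql, trivialOn c n & forall u, c u = (chi (unit_pt u))^-1.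
Proof.
move=> Hchi; have [c0 cM] := Hchi; pose z u := (chi (unit_pt u))^-1.
have z0 u : z u != 0 by rewrite invr_eq0.
have zM u v t : uval t = uval u * uval v -> z t = z u * z v.
  by move=> /unit_ptM E; rewrite /z E cM invfM.
have z1 u : near (@pval p Q) n.+1%:R (uval u) 1 -> z u = 1.
  by move=> /unit_pt1 E; rewrite /z E is_char1 ?invr1.
have zc (M : rat) : exists m : rat, forall u : Zpunit Q,
    near (@pval p Q) m (uval u) 1 -> near (@pval l Ql) M (z u) 1.
  by exists n.+1%:R => u /z1 ->; left.
by exists (ZpChar z0 zM zc).
Qed.

Lemma trivialOn_char (c : zpchar Q Ql) : trivialOn c n ->
  exists2 chi : Gam p n -> Ql, is_char gadd chi & forall u, c u = (chi (unit_pt u))^-1.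
Proof.
move=> ct; have /choice[s sE] := unit_pt_surj.
have key u v : unit_pt u = unit_pt v -> c u = c v.
  move=> uv; have [w wE] := zunit_div pp u v.
  have -> : c u = c v * c w by exact: zfunM.
  suff w1 : near (@pval p Q) n.+1%:R (uval w) 1 by rewrite (ct w w1) mulr1.
  apply/near_vge.
  have [_ v0 vv] := uvalP v; apply: (unit_vge v0 vv); rewrite mulrBr mulr1 -wE.
  by apply: (expIso_close pp (unit_ptP u)); rewrite uv; apply: unit_ptP.
exists (fun k => (c (s k))^-1); last by move=> u; rewrite invrK; apply: key; rewrite sE.
split=> [k|a b]; first by rewrite invr_eq0 zfun_neq0.
have [u uE] : exists u : Zpunit Q, uval u = uval (s a) * uval (s b).
  have [_ a0 va] := uvalP (s a); have [_ b0 vb] := uvalP (s b).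
  apply: (mk_zunit pp); rewrite ?mulf_neq0 ?pvalM ?va ?vb ?addr0 //.
  by apply: zpM; apply: zunit_zp.
have cab : c (s a) * c (s b) = c u by exact/esym/zfunM.
by rewrite -invfM cab; congr (_^-1); apply: key; rewrite (unit_ptM uE) !sE.
Qed.
End UnitCharacters.

(** * The correspondence *)

Section Correspondence.
Variables (p l : nat) (pp : prime p) (op : odd p) (n : nat).
Variables (Qp : padicClosure p) (Ql : padicClosure l) (Fp : finClosure p).
Variables (z : Qp) (hz : (p ^ n).-primitive_root z) (C : cyclotomic z).
Variable D : sekiguchiSuwa n (cRK C) (cRF C).
Variable Gbar : coordRing (Qp : comNzRingType) (torus 1).
Variable G : coordRing (cK C : comNzRingType) (torus 1).
Variable Gn : coordRing (cK C : comNzRingType) (torus n.+1).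
Variable GW : coordRing ('F_p : comNzRingType) (gmWitt p n).
Variables (wbar : geomPt Gbar) (wG : geomPt G) (wGn : geomPt Gn).
Variables (wX : geomPt (gring (ssX D))) (wW : geomPt GW).
Local Notation N := (p.-1 * p ^ n)%N.
Local Notation gadd := (gadd (n := n) pp op).
Implicit Types (chi : Gam p n -> Ql).

Let cR : conn (Defs.cR C) := @cR_conn p Qp z C.
Let p0 : (0 < p)%N := prime_gt0 pp.
Let N0 : (0 < N)%N. Proof. by rewrite muln_gt0 p1_gt0 // expn_gt0 p0. Qed.

Let cGbar : conn Gbar := coord_conn (O := Gbar) (@torus_dom 1).
Let cG : conn G := coord_conn (O := G) (@torus_dom 1).
Let cGn : conn Gn := coord_conn (O := Gn) (@torus_dom n.+1).
Let cGW : conn GW := coord_conn (O := GW) (@gmWitt_dom p n).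

Let NK : N%:R != 0 :> cK C.
Proof. by rewrite (pcharf0P _).1 -?lt0n //; apply: cK_pchar0. Qed.

Lemma ssY_conn : conn (gring (ssY D)).
Proof.
apply: (grp_conn pp (ssYK D) (ssYF D) cGn cGW cR (@cRK_inj _ _ _ C) (cK_frac pp (C := C))).
  by move=> x; apply: (cRF_ker pp hz).
by rewrite (pcharf0P _).1 -?lt0n //; apply: cK_pchar0.
Qed.

(** The functions on X embed into those on the connected Y. *)
Lemma ssX_conn : conn (gring (ssX D)).
Proof.
move=> e ee; have [|E|E] := ssY_conn (e := ssf D e); first by rewrite -rmorphM ee.
  by left; apply: (ssf_inj (s := D)); rewrite E rmorph0.
by right; apply: (ssf_inj (s := D)); rewrite E rmorph1.
Qed.

Let mu := kmu D.
Let mub c := cKin C (mu c).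
Let muN : forall c, mu c ^+ N = 1 := kmuN pp op D cR.
Let mubN c : mub c ^+ N = 1. Proof. by rewrite -rmorphXn muN rmorph1. Qed.
Let mui : injective mu := kmu_inj pp op (D := D) cR.
Let mubi : injective mub. Proof. by move=> a b /fmorph_inj/mui. Qed.
Let mubD c d : mub (gadd c d) = mub c * mub d.
Proof. by rewrite -rmorphM /mub /mu kmuD. Qed.

Let ssT := ss_torsor pp op D cR.

Let thetaG_torsor (th : hom G G) (tht : isTheta N th) : torsor gadd (theta_act muN N0 tht).
Proof. exact: (theta_torsor (kmuD pp op D) mui muN (card_Gam p n) N0 NK). Qed.

(** One and the same cover of G_m^(n+1) is compared with f on X and, through alpha, with theta; this
    is how a character passes from G_m to X. *)
Lemma generic_cover (uK : hom (gring (ssX D)) (resAlg (cRK C) Gn)) :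
  ssXK D Gn uK = xuniv Gn ->
  exists (q : hom Gn Gn) (act : Gam p n -> hom (Alg (hmap q)) (Alg (hmap q))),
  [/\ torsor gadd act,
      exists g : hom (Alg (hmap (ssf D))) (resAlg (hmap uK) (Alg (hmap q))),
        forall c, hcomp (resHom (hmap uK) (act c)) g = hcomp g (ssact pp op D cR c) &
      forall (al : hom G Gn) (th : hom G G) (tht : isTheta N th),
        isAlpha p (xuniv Gn) (al (xuniv G ord0)) ->
        exists g : hom (Alg (hmap th)) (resAlg (hmap al) (Alg (hmap q))),
        forall c, hcomp (resHom (hmap al) (act c)) g = hcomp g (theta_act muN N0 tht c)].
Proof.
move=> uKE; have [uY uYE] := fibre_pt_ex (ssYK D) Gn.
have [q qE] := fibre_map_ex uY uKE.
have [act [actT actE actC]] := cover_torsor uYE uKE qE pp op cR.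
exists q, act; split=> //; first by exists (cover_map qE).
by move=> al th tht alE; apply: (alpha_gamma_cover pp uYE uKE qE actC alE tht muN N0).
Qed.

Lemma special_cover (uF : hom (gring (ssX D)) (resAlg (cRF C) GW)) :
  ssXF D GW uF = xuniv GW ->
  exists (q : hom GW GW) (act : Gam p n -> hom (Alg (hmap q)) (Alg (hmap q))),
  [/\ torsor gadd act,
      exists g : hom (Alg (hmap (ssf D))) (resAlg (hmap uF) (Alg (hmap q))),
        forall c, hcomp (resHom (hmap uF) (act c)) g = hcomp g (ssact pp op D cR c),
      isLang p (gmWitt p n) (xuniv GW) [ffun i => q (xuniv GW i)] &
      forall (CL : locsys Ql wW) chi (x : hom GW (triv ('F_p : comNzRingType))) c t,
        is_char gadd chi -> char_of act CL chi -> [ffun i => x (xuniv GW i)] = fpt D c ->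
        frobTrace Fp CL (hmap x) t <-> t = (chi c)^-1].
Proof.
move=> uFE; have [uY uYE] := fibre_pt_ex (ssYF D) GW.
have [q qE] := fibre_map_ex uY uFE.
have [act [actT actE actC]] := cover_torsor uYE uFE qE pp op cR.
exists q, act; split=> //.
- by exists (cover_map qE).
- exact: (lang_univ uYE uFE qE).
move=> CL chi x c t Hchi CLchi xc.
have [h' _] := fibre_ne (geomIm (hmap x) (fcPt Fp)) cGW (tor_fet actT).
have [h hE] := frob_hom pp h'.
have h'E := frob_point uYE uFE qE actC actT xc hE.
have -> : (chi c)^-1 = chi (gopp pp op c).
  have [chi0 chiM] := Hchi; apply: (mulfI (chi0 c)).
  by rewrite mulfV // -chiM gaddN is_char1.
exact: (frobTrace_char pp t cGW actT CLchi hE h'E).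
Qed.

Variables (thb : hom Gbar Gbar) (thbt : isTheta N thb).
Let actb := theta_act mubN N0 thbt.

Let NQ : N%:R != 0 :> Qp.
Proof. by rewrite (pcharf0P _).1 -?lt0n //; apply: pc_char0. Qed.

Lemma thetab_torsor : torsor gadd actb.
Proof. exact: (theta_torsor mubD mubi mubN (card_Gam p n) N0 NQ). Qed.

(** A character is followed through KL, ML, XL and CL. On ML the characters coming from KL and from
    XL meet; they agree because the total space of gamma is a torus, hence connected. *)
Lemma correspondence_char (L : locsys Ql wbar) (KL : locsys Ql wG) (CL : locsys Ql wW)
    (c : zpchar Qp Ql) :
  inKummer N KL -> isBaseChange (cKin C) KL L -> isS (D := D) wGn wX KL CL ->
  isTraceChar Fp CL c ->
  exists chi, [/\ is_char gadd chi, char_of actb L chi &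
    forall u, c u = (chi (unit_pt pp op D u))^-1].
Proof.
move=> [th tht KLs] [phi phit KL_L] [al [uK [uF [ML [XL [alE uKE uFE XLs]]]]]].
move=> [KL_ML XL_ML XL_CL _] Htr.
have TH := thetaG_torsor tht.
have [chi Hchi KLchi] := (summand_char cG TH cG KL).1 KLs.
exists chi; split=> //.
  have [g gE] := theta_base_change phit N0 (mu' := mub) (fun=> erefl) muN mubN tht thbt.
  exact: (pullback_char (tor_fet TH) gE KLchi KL_L).
have [q [act [actT [g gE] galE]]] := generic_cover uKE.
have [ga gaE] := galE al th tht alE.
have MLchi := pullback_char (tor_fet TH) gaE KLchi KL_ML.
have [chi' Hchi' XLchi'] := (summand_char ssX_conn ssT ssY_conn XL).1 XLs.
have MLchi' := pullback_char (tor_fet ssT) gE XLchi' XL_ML.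
have chiE := char_of_inj cGn actT cGn MLchi' MLchi.
have XLchi := char_of_eq XLchi' chiE.
have [q' [act' [actT' [g' gE'] _ Hfr]]] := special_cover uFE.
have CLchi := pullback_char (tor_fet ssT) gE' XLchi XL_CL.
move=> u; have [x [ux Htx]] := Htr u.
have xE := expIso_inj pp op ux (unit_ptP pp op D u).
exact: ((Hfr CL chi x _ _ Hchi CLchi xE).1 Htx).
Qed.

(** Each intermediate local system is built from [chi] on its own torsor, and the equivariant maps
    provide the pull-backs. *)
Lemma char_correspondence (L : locsys Ql wbar) (c : zpchar Qp Ql) chi :
  is_char gadd chi -> char_of actb L chi ->
  (forall u, c u = (chi (unit_pt pp op D u))^-1) ->
  exists (KL : locsys Ql wG) (CL : locsys Ql wW),
    [/\ inKummer N KL, isBaseChange (cKin C) KL L, isS (D := D) wGn wX KL CL &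
        isTraceChar Fp CL c].
Proof.
move=> Hchi Lchi cE.
have ut : isUnit (xuniv G ord0 : G) by exact: torus1_unit.
have [th tht] := torus1_hom G (x := xuniv G ord0 ^+ N) (isUnitX N ut).
have TH := thetaG_torsor tht.
have [KL KLchi] := locsys_of_char wG cG TH Hchi.
have [uK uKE] := fibre_pt_ex (ssXK D) Gn.
have [uF uFE] := fibre_pt_ex (ssXF D) GW.
have [q [act [actT [g gE] galE]]] := generic_cover uKE.
have [q' [act' [actT' [g' gE'] q'L Hfr]]] := special_cover uFE.
have [ML MLchi] := locsys_of_char wGn cGn actT Hchi.
have [XL XLchi] := locsys_of_char wX ssX_conn ssT Hchi.
have [CL CLchi] := locsys_of_char wW cGW actT' Hchi.
exists KL, CL; split.
- by exists th => //; apply/(summand_char cG TH cG); exists chi.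
- have [|phi phit] := @torus1_hom _ G (resAlg (cKin C) Gbar) (xuniv Gbar ord0).
    exact: torus1_unit.
  exists phi => //.
  have [g1 gE1] := theta_base_change phit N0 (mu' := mub) (fun=> erefl) muN mubN tht thbt.
  exact: (char_pullback cG cGbar TH thetab_torsor gE1 KLchi Lchi).
- have ux i : isUnit (xuniv Gn i) by exact: (xuniv_dom Gn).
  have [d dE] : isUnit (\prod_(i < n.+1 | (0 < i)%N) xuniv Gn i ^+ (p ^ i.-1)).
    by apply: isUnit_prod => i _; apply: isUnitX.
  pose A := (\prod_(i < n.+1) xuniv Gn i) ^+ (p ^ n) * d.
  have uA : isUnit A.
    apply: isUnitM; first by apply/isUnitX/isUnit_prod => i _.
    by eexists; rewrite mulrC; apply: dE.
  have [al alt] := torus1_hom G uA.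
  have alE : isAlpha p (xuniv Gn) (al (xuniv G ord0)).
    by rewrite /isAlpha alt /A -mulrA [d * _]mulrC dE mulr1.
  have [ga gaE] := galE al th tht alE.
  exists al, uK, uF, ML, XL; split=> //.
    by apply/(summand_char ssX_conn ssT ssY_conn); exists chi.
  split.
  + exact: (char_pullback cG cGn TH actT gaE KLchi MLchi).
  + exact: (char_pullback ssX_conn cGn ssT actT gE XLchi MLchi).
  + exact: (char_pullback ssX_conn cGW ssT actT' gE' XLchi CLchi).
  + by exists q' => //; apply/(summand_char cGW actT' cGW); exists chi.
- move=> u; have xd : xdom (gmWitt p n) (fpt D (unit_pt pp op D u)).
    by apply/isUnit_field/fpt_unit.
  have [x xE] := @xuniv_ex _ _ _ GW (triv ('F_p : comNzRingType)) _ xd.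
  have xE' : [ffun i => x (xuniv GW i)] = fpt D (unit_pt pp op D u).
    by apply/ffunP => i; rewrite ffunE.
  exists x; rewrite xE'; split; first exact: unit_ptP.
  by apply/(Hfr CL chi x _ _ Hchi CLchi xE').
Qed.

Lemma correspondenceP (L : locsys Ql wbar) (c : zpchar Qp Ql) :
  (exists (KL : locsys Ql wG) (CL : locsys Ql wW),
    [/\ inKummer N KL, isBaseChange (cKin C) KL L, isS (D := D) wGn wX KL CL &
        isTraceChar Fp CL c]) <->
  exists chi, [/\ is_char gadd chi, char_of actb L chi &
    forall u, c u = (chi (unit_pt pp op D u))^-1].
Proof.
split=> [[KL [CL [H1 H2 H3 H4]]]|[chi [H1 H2 H3]]].
  exact: correspondence_char H1 H2 H3 H4.
exact: char_correspondence H1 H2 H3.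
Qed.

Lemma orderDvd_char (L : locsys Ql wbar) :
  orderDvd N L <-> exists2 chi, is_char gadd chi & char_of actb L chi.
Proof.
split=> [[d [d0 Ld _] /dvdnP[k Nk]]|[chi [chi0 chiM] Lchi]].
  apply: (kummer_char mubD mubi mubN (card_Gam p n) N0 (pc_char0 Qp)) => s.
  by rewrite Nk mulnC exprM Ld expr1n.
(* Translation by c permutes Gam and multiplies the product of all values of chi by chi(c)^N. *)
have chiN c : chi c ^+ N = 1.
  have mu0 a : mu a != 0.
    by apply/eqP => m0; have /eqP := muN a; rewrite m0 expr0n gtn_eqF // eq_sym oner_eq0.
  have inj : injective (gadd c).
    by move=> a b /(f_equal mu); rewrite /mu !kmuD => /(mulfI (mu0 c))/mui.
  have P0 : \prod_a chi a != 0 by apply/prodf_neq0 => a _.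
  apply: (mulIf P0); rewrite mul1r {2}(reindex_inj inj) /= -(card_Gam p n) -prodr_const.
  by rewrite -big_split; apply: eq_bigr => a _; rewrite chiM.
have LN s : L s ^+ N = 1.
  have [h _] := fibre_ne wbar cGbar (tor_fet thetab_torsor).
  have [c sc] := tor_ex h (s _ (tor_fet thetab_torsor) h) thetab_torsor.
  by rewrite (Lchi _ _ _ _ sc).
have ex : exists d, (0 < d)%N && `[< forall s, L s ^+ d = 1 >].
  by exists N; rewrite N0; apply/asboolP.
case: (ex_minnP ex) => d /andP[d0 /asboolP Ld] dmin; exists d.
  split=> [//|s|e e0 Le]; first exact: Ld.
  by apply: dmin; rewrite e0; apply/asboolP.
rewrite /dvdn; case: posnP => // r0; have : (d <= N %% d)%N.
  apply: dmin; rewrite r0; apply/asboolP => s.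
  by have := LN s; rewrite {1}(divn_eq N d) exprD mulnC exprM Ld expr1n mul1r.
by rewrite leqNgt ltn_pmod.
Qed.

Lemma orderDvd_char_ex chi : is_char gadd chi ->
  exists2 L : locsys Ql wbar, orderDvd N L & char_of actb L chi.
Proof.
move=> Hchi; have [L Lchi] := locsys_of_char wbar cGbar thetab_torsor Hchi.
by exists L => //; apply/orderDvd_char; exists chi.
Qed.

Lemma locsys_char_uniq (L L' : locsys Ql wbar) chi :
  char_of actb L chi -> char_of actb L' chi -> L = L'.
Proof. by move=> H H'; apply: (char_of_uniq cGbar thetab_torsor H H'). Qed.

Lemma locsys_char_inj (L : locsys Ql wbar) chi chi' :
  char_of actb L chi -> char_of actb L chi' -> chi =1 chi'.
Proof. by move=> H H' c; apply: (char_of_inj cGbar thetab_torsor cGbar H H'). Qed.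

(** [Rel] links L and c when they come from the same character of Gam, with the inverse on the side
    of units. It is total and single-valued in both directions, which gives [Phi] and its inverse,
    and [correspondenceP] identifies it with the geometric relation. *)
Theorem correspondence_bij :
  exists Phi : {L : locsys Ql wbar | orderDvd N L} -> {c : zpchar Qp Ql | depthLe n c},
    [/\ bijective Phi,
        forall L1 L2 L3, isTensor (sval L1) (sval L2) (sval L3) ->
          forall u : Zpunit Qp,
            sval (Phi L3) u = sval (Phi L1) u * sval (Phi L2) u &
        forall L c, Phi L = c <->
          exists (KL : locsys Ql wG) (CL : locsys Ql wW),
            [/\ inKummer N KL, isBaseChange (cKin C) KL (sval L),
                isS (D := D) wGn wX KL CL & isTraceChar Fp CL (sval c)]].
Proof.
pose TL := {L : locsys Ql wbar | orderDvd N L}; pose TC := {c : zpchar Qp Ql | depthLe n c}.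
pose Rel (L : TL) (c : TC) := exists chi, [/\ is_char gadd chi, char_of actb (sval L) chi &
    forall u, sval c u = (chi (unit_pt pp op D u))^-1].
have Linj (L L' : TL) : sval L = sval L' -> L = L' by exact: eq_sig_hprop.
have Cinj (c c' : TC) : (forall u, sval c u = sval c' u) -> c = c'.
  by move=> E; apply: eq_sig_hprop => [? ? ?|]; [exact: Prop_irrelevance|exact: zpchar_ext].
have RelL (L : TL) : exists c, Rel L c.
  have [chi Hchi Lchi] := (orderDvd_char (sval L)).1 (svalP L).
  have [c ct cE] := unit_char_ex D Qp Hchi.
  by exists (exist _ c ((depthLe_trivial n c).2 ct)), chi.
have RelC (c : TC) : exists L, Rel L c.
  have [chi Hchi cE] := trivialOn_char pp op D ((depthLe_trivial n _).1 (svalP c)).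
  have [L LN Lchi] := orderDvd_char_ex Hchi.
  by exists (exist _ L LN), chi.
have RelLu (L : TL) c c' : Rel L c -> Rel L c' -> c = c'.
  move=> [chi [_ Lchi cE]] [chi' [_ Lchi' cE']]; apply: Cinj => u.
  by rewrite cE cE' (locsys_char_inj Lchi Lchi').
have RelCu (L L' : TL) c : Rel L c -> Rel L' c -> L = L'.
  move=> [chi [_ Lchi cE]] [chi' [_ Lchi' cE']]; apply: Linj.
  apply: (locsys_char_uniq Lchi); apply: (char_of_eq Lchi') => k.
  have [u <-] := unit_pt_surj pp op D Qp k.
  by apply: invr_inj; rewrite -cE -cE'.
have /choice[Phi PhiP] := RelL; have /choice[Psi PsiP] := RelC.
exists Phi; split.
- exists Psi => [L|c]; [exact: RelCu (PsiP _) (PhiP L)|exact: RelLu (PhiP _) (PsiP c)].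
- move=> L1 L2 L3 L123 u.
  have [chi1 [H1 Lchi1 ->]] := PhiP L1; have [chi2 [H2 Lchi2 ->]] := PhiP L2.
  have [chi3 [H3 Lchi3 ->]] := PhiP L3.
  rewrite -invfM; congr (_^-1).
  exact: (locsys_char_inj Lchi3 (char_of_tensor L123 Lchi1 Lchi2)).
- move=> L c; split=> [<-|/correspondenceP]; first exact/correspondenceP/PhiP.
  exact/RelLu/PhiP.
Qed.
End Correspondence.

Theorem mainTheorem1 (p l : nat) (hp : prime p) (hodd : odd p)
  (hl : prime l) (hlp : l <> p) (n : nat)
  (Qp : padicClosure p) (Ql : padicClosure l) (Fp : finClosure p)
  (z : Qp) (hz : (p ^ n).-primitive_root z) (C : cyclotomic z)
  (D : sekiguchiSuwa n (cRK C) (cRF C))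
  (Gbar : coordRing (Qp : comNzRingType) (torus 1))
  (G : coordRing (cK C : comNzRingType) (torus 1))
  (Gn : coordRing (cK C : comNzRingType) (torus n.+1))
  (GW : coordRing ('F_p : comNzRingType) (gmWitt p n))
  (wbar : geomPt Gbar) (wG : geomPt G) (wGn : geomPt Gn)
  (wX : geomPt (gring (ssX D))) (wW : geomPt GW) :
  exists Phi : {L : locsys Ql wbar | orderDvd ((p - 1) * p ^ n) L} ->
               {c : zpchar Qp Ql | depthLe n c},
    [/\ bijective Phi,
        forall L1 L2 L3, isTensor (sval L1) (sval L2) (sval L3) ->
          forall u : Zpunit Qp,
            sval (Phi L3) u = sval (Phi L1) u * sval (Phi L2) u &
        forall L c, Phi L = c <->
          exists (KL : locsys Ql wG) (CL : locsys Ql wW),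
            [/\ inKummer ((p - 1) * p ^ n) KL,
                isBaseChange (cKin C) KL (sval L),
                isS (D := D) wGn wX KL CL &
                isTraceChar Fp CL (sval c)]].
Proof.
(* The covering theta of the geometric G_m is an auxiliary choice: it does not occur in the relation
   that characterises [Phi]. *)
have [thb thbt] := torus1_hom Gbar (isUnitX (p.-1 * p ^ n) (torus1_unit Gbar)).
by rewrite !subn1; apply: (correspondence_bij hp hodd Ql Fp hz wbar wG wGn wX wW thbt).
Qed.
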